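(* Let $a\in\mathbb{R}$, $a\neq0$. Let $U\subset\mathbb{R}^2$ be open with coordinates $(x,y)$, let $h,H:U\to\mathbb{R}$ be positive smooth functions such that $\Delta\ln H=2a^2h^2+4a^2H^2$ on $U$, where $\Delta=\partial_x^2+\partial_y^2$. Let $M=U\times N$ with $N=\{(z,t)\in\mathbb{R}^2: z<0\}$, and let $g=\theta_1^2+\theta_2^2+\theta_3^2+\theta_4^2$, i.e. $g(X,Y)=\sum_{i=1}^4\theta_i(X)\theta_i(Y)$, where $$\theta_1=\sinh(az)\,h\,dx,\qquad \theta_2=\sinh(az)\,h\,dy,$$ $$\theta_3=\sinh(2az)\,dt-\big(-\sin(2at)\cosh(2az)H+\sinh(2az)\,l_2\big)dx-\big(\cos(2at)\cosh(2az)H+\sinh(2az)\,n_2\big)dy,$$ $$\theta_4=dz-\cos(2at)\,H\,dx-\sin(2at)\,H\,dy,$$ with $l_2=\frac1{2a}(\ln H)_y$, $n_2=-\frac1{2a}(\ln H)_x$ (here $h,H,l_2,n_2$ are evaluated at $(x,y)$). Let $\{E_1,E_2,E_3,E_4\}$ be the $g$-orthonormal frame dual to $\{\theta_1,\theta_2,\theta_3,\theta_4\}$, let $\mathcal{D}=\mathrm{span}\{E_3,E_4\}$ and $\mathcal{D}^\perp=\mathrm{span}\{E_1,E_2\}$, let $\bar J$ be the Kähler structure with Kähler form $\bar\Omega=\theta_1\wedge\theta_2+\theta_4\wedge\theta_3$ and $J$ the Hermitian structure with Kähler form $\Omega=\theta_1\wedge\theta_2+\theta_3\wedge\theta_4$,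 with Lee form $\theta=-\alpha\theta_4$, $\alpha=-2a\coth(az)$. Then: (i) $\Delta\ln H=2a^2h^2+4a^2H^2$ on $U$. (ii) $\Gamma^2_{11}=-\dfrac{a\cosh(az)\sin(2at)H}{\sinh^2(az)\,h}-\dfrac{h_y}{\sinh(az)\,h^2}$ and $\Gamma^1_{22}=-\dfrac{a\cosh(az)\cos(2at)H}{\sinh^2(az)\,h}-\dfrac{h_x}{\sinh(az)\,h^2}$. (iii) In the frame $\{E_1,E_2,E_3,E_4\}$ the Ricci tensor of $(M,g)$ is $Ric=\mathrm{diag}(\lambda,\lambda,-6a^2,-6a^2)$ with $$\lambda=-\frac{4a^2h^2+2a^2H^2+\Delta\ln h}{h^2\sinh^2(az)}-6a^2.$$ (iv) The scalar curvature of $(M,g)$ is $\tau=-\dfrac{8a^2h^2+4a^2H^2+2\Delta\ln h}{h^2\sinh^2(az)}-24a^2$. (v) The conformal scalar curvature is $\kappa=-\dfrac{8a^2h^2+4a^2H^2+2\Delta\ln h}{h^2\sinh^2(az)}$. (vi) In the frame $\{\Omega,\phi,\psi\}$, where $\{\phi,\psi\}$ is any (local) orthonormal basis of $LM$, the Weyl tensor $W^-$ is $$W^-=\mathrm{diag}\Big(-\tfrac{4a^2h^2+2a^2H^2+\Delta\ln h}{3h^2\sinh^2(az)},\ \tfrac{4a^2h^2+2a^2H^2+\Delta\ln h}{6h^2\sinh^2(az)},\ \tfrac{4a^2h^2+2a^2H^2+\Delta\ln h}{6h^2\sinh^2(az)}\Big).$$ (vii) The sectional curvature of $(M,g)$ on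 $\mathcal{D}^\perp$ is $K(E_1,E_2)=-\dfrac{2a^2H^2+\Delta\ln h}{\sinh^2(az)\,h^2}-4a^2\coth^2(az)$ and on $\mathcal{D}$ is $K(E_3,E_4)=-4a^2$. (viii) $(M,g)$ is a space form if and only if $\Delta\ln h=-4a^2h^2-2a^2H^2$ on $U$; in that case it is locally isometric to the complex ball $B^2$ with its standard metric of constant holomorphic sectional curvature $-4a^2$.
   Context: It is known from earlier work that, for this metric, $\bar J$ is a Kähler structure and $J$ is an integrable orthogonal complex structure (inducing the opposite orientation) which is not locally conformally Kähler. Conventions. The Kähler form of an almost Hermitian structure $J$ is $\Omega(X,Y)=g(JX,Y)$; thus here $\bar JE_1=E_2$, $\bar JE_3=-E_4$, $JE_1=E_2$, $JE_3=E_4$. $M$ is oriented so that $\bar\Omega$ is self-dual; then $\Omega$ is anti-self-dual. $LM$ denotes the rank-2 bundle of anti-self-dual 2-forms orthogonal to $\Omega$. The Lee form $\theta$ of $(M,g,J)$ is defined by $d\Omega=2\theta\wedge\Omega$. $\Gamma^k_{ij}=g(\nabla_{E_i}E_j,E_k)$, with $\nabla$ the Levi-Civita connection. The curvature tensor is $R(X,Y)Z=([\nabla_X,\nabla_Y]-\nabla_{[X,Y]})Z$, $R(X,Y,Z,W)=g(R(X,Y)Z,W)$, and $K(X,Y)=R(X,Y,Y,X)$ for orthonormal $X,Y$. $Ric(X,Y)=\sum_i g(R(E_i,X)Y,E_i)$, and $\tau=\mathrm{tr}_g Ric$. The conformal scalar curvature (of $(M,g,J)$) is $\kappa=\tau-6(|\theta|^2+\delta\theta)$,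 where $\delta\theta=-\sum_i(\nabla_{E_i}\theta)(E_i)$. $W^-$ is the anti-self-dual part of the Weyl tensor, viewed as a symmetric endomorphism of the bundle of anti-self-dual 2-forms, normalized so that the curvature operator of a space of constant sectional curvature $1$ is the identity on 2-forms. ''Space form'' means that the Kähler surface $(M,g,\bar J)$ has constant holomorphic sectional curvature $R(X,\bar JX,\bar JX,X)$, $|X|=1$. $B^2$ is the unit ball in $\mathbb{C}^2$ with the complex hyperbolic (Bergman) metric, scaled to the indicated holomorphic sectional curvature. *)

(* Defs.v *)
From Stdlib Require Import Reals.
From Coquelicot Require Import Coquelicot.
Open Scope R_scope.

(* The index set serves both for coordinates and for the members of a frame. *)
Inductive ix : Set := i1 | i2 | i3 | i4.

Definition ix_eqb (i j : ix) : bool :=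
  match i, j with
  | i1, i1 | i2, i2 | i3, i3 | i4, i4 => true
  | _, _ => false
  end.

Definition kron (i j : ix) : R := if ix_eqb i j then 1 else 0.

Definition sum4 (f : ix -> R) : R := f i1 + f i2 + f i3 + f i4.

Definition ix_rank (i : ix) : R :=
  match i with i1 => 1 | i2 => 2 | i3 => 3 | i4 => 4 end.

(* The sign of the permutation (i, j, k, l) of (1, 2, 3, 4), and 0 if two
   indices agree: the product of differences equals 12 on (1, 2, 3, 4). *)
Definition perm_sign (i j k l : ix) : R :=
  let r := ix_rank in
  (r j - r i) * (r k - r i) * (r l - r i)
  * (r k - r j) * (r l - r j) * (r l - r k) / 12.

(* [pt] unfolds to a function space, so that Coquelicot's sup-norm uniform
   structure on functions gives it the usual topology of R^4. *)
Definition pt := ix -> R.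
Definition vec := ix -> R.
Definition vfield := pt -> vec.
Definition oneform := pt -> ix -> R.
Definition twoform := pt -> ix -> ix -> R.
Definition metric := pt -> ix -> ix -> R.
(* [J p k i] is the e_k-component of J e_i at p. *)
Definition endo := pt -> ix -> ix -> R.

Definition upd (p : pt) (i : ix) (s : R) : pt :=
  fun j => if ix_eqb i j then s else p j.

Definition partial (i : ix) (f : pt -> R) (p : pt) : R :=
  Derive (fun s => f (upd p i s)) (p i).

Definition ex_partial (i : ix) (f : pt -> R) (p : pt) : Prop :=
  ex_derive (fun s => f (upd p i s)) (p i).

(* [Ck k V f]: f is of class C^k on V (V is meant to be open). *)
Fixpoint Ck (k : nat) (V : (ix -> R) -> Prop) (f : (ix -> R) -> R) : Prop :=
  (forall p, V p -> continuous f p) /\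
  match k with
  | O => True
  | S k' => forall i, (forall p, V p -> ex_partial i f p)
                      /\ Ck k' V (partial i f)
  end.

Definition smooth_on (V : pt -> Prop) (f : pt -> R) : Prop :=
  forall k, Ck k V f.

Definition smooth_vec_on (V : pt -> Prop) (F : pt -> ix -> R) : Prop :=
  forall i, smooth_on V (fun p => F p i).

Definition eval1 (al : oneform) (X : vfield) (p : pt) : R :=
  sum4 (fun i => al p i * X p i).

Definition eval2 (w : twoform) (X Y : vfield) (p : pt) : R :=
  sum4 (fun i => sum4 (fun j => w p i j * X p i * Y p j)).

Definition gprod (g : metric) (X Y : vfield) (p : pt) : R :=
  sum4 (fun i => sum4 (fun j => g p i j * X p i * Y p j)).

Definition is_twoform_at (w : twoform) (p : pt) : Prop :=
  forall i j, w p i j = - w p j i.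

Definition wedge11 (al be : oneform) : twoform :=
  fun p i j => al p i * be p j - al p j * be p i.

Definition add_twoform (v w : twoform) : twoform := fun p i j => v p i j + w p i j.

Definition d_twoform (w : twoform) (p : pt) (i j k : ix) : R :=
  partial i (fun q => w q j k) p
  + partial j (fun q => w q k i) p
  + partial k (fun q => w q i j) p.

Definition wedge12 (al : oneform) (w : twoform) (p : pt) (i j k : ix) : R :=
  al p i * w p j k + al p j * w p k i + al p k * w p i j.

Definition app_endo (J : endo) (X : vfield) : vfield :=
  fun p k => sum4 (fun i => J p k i * X p i).

Definition dir (X : vfield) (f : pt -> R) (p : pt) : R :=
  sum4 (fun i => X p i * partial i f p).

Definition bracket (X Y : vfield) : vfield :=
  fun p k => dir X (fun q => Y q k) p - dir Y (fun q => X q k) p.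

Definition det4 (m : ix -> ix -> R) : R :=
  sum4 (fun i => sum4 (fun j => sum4 (fun k => sum4 (fun l =>
    perm_sign i j k l * m i1 i * m i2 j * m i3 k * m i4 l)))).

(* Cramer's rule: the (j, i) entry of the inverse of m. *)
Definition inv4 (m : ix -> ix -> R) (j i : ix) : R :=
  det4 (fun r c => if ix_eqb r i then kron j c else m r c) / det4 m.

(* Christoffel symbols of the Levi-Civita connection:
   nabla_{e_i} e_j = sum_k (christoffel g k i j) e_k for the coordinate
   fields e_i. *)
Definition christoffel (g : metric) (k i j : ix) (p : pt) : R :=
  / 2 * sum4 (fun l => inv4 (g p) k l *
    (partial i (fun q => g q j l) p
     + partial j (fun q => g q i l) p
     - partial l (fun q => g q i j) p)).

Definition nabla (g : metric) (X Y : vfield) : vfield :=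
  fun p k => dir X (fun q => Y q k) p
    + sum4 (fun i => sum4 (fun j =>
        christoffel g k i j p * X p i * Y p j)).

Definition curv (g : metric) (X Y Z : vfield) : vfield :=
  fun p k => nabla g X (nabla g Y Z) p k - nabla g Y (nabla g X Z) p k
             - nabla g (bracket X Y) Z p k.

Definition Rm (g : metric) (X Y Z W : vfield) (p : pt) : R :=
  gprod g (curv g X Y Z) W p.

(* For orthonormal X, Y. *)
Definition sec_curv (g : metric) (X Y : vfield) (p : pt) : R :=
  Rm g X Y Y X p.

(* In the traces below, E is a g-orthonormal frame. *)

Definition Ric (g : metric) (E : ix -> vfield) (X Y : vfield) (p : pt) : R :=
  sum4 (fun i => gprod g (curv g (E i) X Y) (E i) p).

Definition scal_curv (g : metric) (E : ix -> vfield) (p : pt) : R :=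
  sum4 (fun i => Ric g E (E i) (E i) p).

(* Weyl tensor in dimension 4, in the sign convention of [Rm], for which
   constant sectional curvature 1 means
   R(X,Y,Z,V) = g(Y,Z) g(X,V) - g(X,Z) g(Y,V). *)
Definition Weyl (g : metric) (E : ix -> vfield) (X Y Z V : vfield) (p : pt)
  : R :=
  Rm g X Y Z V p
  - / 2 * (Ric g E Y Z p * gprod g X V p - Ric g E X Z p * gprod g Y V p
           + gprod g Y Z p * Ric g E X V p - gprod g X Z p * Ric g E Y V p)
  + scal_curv g E p / 6 *
      (gprod g Y Z p * gprod g X V p - gprod g X Z p * gprod g Y V p).

(* A 2-form at p is handled through its components w(F_i, F_j) in a positively
   oriented orthonormal frame F. *)
Definition comp2 (F : ix -> vfield) (w : twoform) (p : pt) : ix -> ix -> R :=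
  fun i j => eval2 w (F i) (F j) p.

Definition hodge (c : ix -> ix -> R) : ix -> ix -> R :=
  fun i j => / 2 * sum4 (fun k => sum4 (fun l => perm_sign i j k l * c k l)).

(* F_i ^ F_j, i < j, are orthonormal. *)
Definition inner2 (c d : ix -> ix -> R) : R :=
  / 2 * sum4 (fun i => sum4 (fun j => c i j * d i j)).

Definition asd_part (c : ix -> ix -> R) : ix -> ix -> R :=
  fun i j => / 2 * (c i j - hodge c i j).

(* The Weyl tensor as an endomorphism of 2-forms,
   (W w)(X, Y) = 1/2 sum_{k,l} W(X, Y, F_l, F_k) w(F_k, F_l);
   the same expression with R in place of W is the identity when the
   sectional curvature is constantly 1. *)
Definition Weyl_op (g : metric) (F : ix -> vfield) (p : pt)
    (c : ix -> ix -> R) : ix -> ix -> R :=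
  fun i j => / 2 * sum4 (fun k => sum4 (fun l =>
    Weyl g F (F i) (F j) (F l) (F k) p * c k l)).

(* W^- is applied to components c of anti-self-dual 2-forms. *)
Definition Weyl_minus (g : metric) (F : ix -> vfield) (p : pt)
    (c : ix -> ix -> R) : ix -> ix -> R :=
  asd_part (Weyl_op g F p c).

Definition is_asd (F : ix -> vfield) (w : twoform) (p : pt) : Prop :=
  is_twoform_at w p /\
  forall i j, hodge (comp2 F w p) i j = - comp2 F w p i j.

(* LM: anti-self-dual 2-forms orthogonal to Omega. *)
Definition in_LM (F : ix -> vfield) (Omega w : twoform) (p : pt) : Prop :=
  is_asd F w p /\ inner2 (comp2 F Omega p) (comp2 F w p) = 0.

(* LM has rank 2, so two orthonormal members form a basis. *)
Definition orthonormal_basis_LM (F : ix -> vfield) (Omega phi psi : twoform)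
    (p : pt) : Prop :=
  in_LM F Omega phi p /\ in_LM F Omega psi p /\
  inner2 (comp2 F phi p) (comp2 F phi p) = 1 /\
  inner2 (comp2 F psi p) (comp2 F psi p) = 1 /\
  inner2 (comp2 F phi p) (comp2 F psi p) = 0.

(* Omega(X, Y) = g(J X, Y) *)
Definition kahler_form (g : metric) (J : endo) : twoform :=
  fun p i j => sum4 (fun k => J p k i * g p k j).

Definition is_Lee_form (M : pt -> Prop) (g : metric) (J : endo) (th : oneform)
  : Prop :=
  forall p, M p -> forall i j k,
    d_twoform (kahler_form g J) p i j k = 2 * wedge12 th (kahler_form g J) p i j k.

Definition norm2_oneform (E : ix -> vfield) (th : oneform) (p : pt) : R :=
  sum4 (fun i => eval1 th (E i) p ^ 2).

(* (nabla_X th)(Y) *)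
Definition nabla_oneform (g : metric) (X : vfield) (th : oneform) (Y : vfield)
    (p : pt) : R :=
  dir X (eval1 th Y) p - eval1 th (nabla g X Y) p.

Definition codiff (g : metric) (E : ix -> vfield) (th : oneform) (p : pt) : R :=
  - sum4 (fun i => nabla_oneform g (E i) th (E i) p).

(* th is the Lee form of the almost Hermitian structure. *)
Definition conf_scal (g : metric) (E : ix -> vfield) (th : oneform) (p : pt)
  : R :=
  scal_curv g E p - 6 * (norm2_oneform E th p + codiff g E th p).

Definition space_form (M : pt -> Prop) (g : metric) (J : endo) : Prop :=
  exists c : R, forall X : vfield, smooth_vec_on M X ->
    forall p, M p -> gprod g X X p = 1 ->
      Rm g X (app_endo J X) (app_endo J X) X p = c.

Definition locally_isometric (M : pt -> Prop) (g : metric)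
    (N : pt -> Prop) (g' : metric) : Prop :=
  forall p, M p ->
  exists (V W : (ix -> R) -> Prop) (F G : pt -> pt),
    open V /\ open W /\ V p /\
    (forall q, V q -> M q) /\ (forall q, W q -> N q) /\
    smooth_vec_on V F /\ smooth_vec_on W G /\
    (forall q, V q -> W (F q) /\ forall i, G (F q) i = q i) /\
    (forall q, W q -> V (G q) /\ forall i, F (G q) i = q i) /\
    (forall q, V q -> forall i j,
       g q i j = sum4 (fun k => sum4 (fun l =>
         g' (F q) k l * partial i (fun r => F r k) q
                      * partial j (fun r => F r l) q))).

Definition norm2 (w : pt) : R := sum4 (fun i => w i ^ 2).

(* C^2 = R^4 through (w1 + i w2, w3 + i w4). *)
Definition ball2 (w : pt) : Prop := norm2 w < 1.

Definition mul_I (w : pt) : pt :=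
  fun k => match k with i1 => - w i2 | i2 => w i1 | i3 => - w i4 | i4 => w i3 end.

(* The complex hyperbolic metric
     1/a^2 * ( |dw|^2 / (1 - |w|^2) + |<dw, w>|^2 / (1 - |w|^2)^2 ),
   with <,> the Hermitian product. On the complex line w3 = w4 = 0 it is
   |dw|^2 / (a^2 (1 - |w|^2)^2), of Gauss curvature -4a^2; this is the constant
   holomorphic sectional curvature. *)
Definition ball_metric (a : R) : metric :=
  fun w i j =>
    / a ^ 2 * (kron i j / (1 - norm2 w)
               + (w i * w j + mul_I w i * mul_I w j) / (1 - norm2 w) ^ 2).

Definition coth (x : R) : R := cosh x / sinh x.

Definition laplacian (f : R -> R -> R) (x y : R) : R :=
  partial_derive 2 0 f x y + partial_derive 0 2 f x y.

(* The coordinates i1, i2, i3, i4 are x, y, z, t, in this order. *)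
Definition domM (U : R * R -> Prop) (p : pt) : Prop :=
  U (p i1, p i2) /\ p i3 < 0.

Definition l2 (a : R) (H : R -> R -> R) (x y : R) : R :=
  / (2 * a) * partial_derive 0 1 (fun u v => ln (H u v)) x y.

Definition n2 (a : R) (H : R -> R -> R) (x y : R) : R :=
  - / (2 * a) * partial_derive 1 0 (fun u v => ln (H u v)) x y.

(* [covec A B C D] is A dx + B dy + C dz + D dt. *)
Definition covec (A B C D : R) (i : ix) : R :=
  match i with i1 => A | i2 => B | i3 => C | i4 => D end.

Definition coframe (a : R) (h H : R -> R -> R) (i : ix) : oneform := fun p =>
  let x := p i1 in let y := p i2 in let z := p i3 in let t := p i4 in
  match i with
  | i1 => covec (sinh (a * z) * h x y) 0 0 0
  | i2 => covec 0 (sinh (a * z) * h x y) 0 0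
  | i3 => covec
            (- (- sin (2 * a * t) * cosh (2 * a * z) * H x y
                + sinh (2 * a * z) * l2 a H x y))
            (- (cos (2 * a * t) * cosh (2 * a * z) * H x y
                + sinh (2 * a * z) * n2 a H x y))
            0
            (sinh (2 * a * z))
  | i4 => covec (- (cos (2 * a * t) * H x y)) (- (sin (2 * a * t) * H x y)) 1 0
  end.

Definition metric_of (th : ix -> oneform) : metric :=
  fun p i j => sum4 (fun k => th k p i * th k p j).

(* Positive for the orientation in which th_1 ^ th_2 + th_4 ^ th_3 is
   self-dual. *)
Definition oriented (E : ix -> vfield) (i : ix) : vfield :=
  match i with i3 => E i4 | i4 => E i3 | _ => E i end.

Definition alpha (a : R) (p : pt) : R := - 2 * a * coth (a * p i3).

(* Main.v *)
Require Import Defs.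
From Stdlib Require Import Reals Lra Lia Psatz FunctionalExtensionality ClassicalEpsilon.
From Coquelicot Require Import Coquelicot.
Open Scope R_scope.

(* The differentials of the coframe close up: with k = coth(az), A = H cos(2at) / (sinh(az) h),
   B = H sin(2at) / (sinh(az) h) and m = a (k - 1/k), the structure functions of the frame are
   polynomials in a k, a (k + 1/k), m A, m B and the first derivatives of h, the equation for ln H
   entering only through d(l2 dx + n2 dy). Koszul's formula then yields the curvature: it is that of
   constant holomorphic sectional curvature -4a^2, plus w times the square of the bivector E_1 ^ E_2,
   with w = (4a^2 h^2 + 2a^2 H^2 + Delta ln h) / (h sinh(az))^2. All curvature statements are read off
   from this, and M is a space form exactly when w = 0.

   If w = 0, the equations for ln h and ln H are the flatness of an su(2,1)-connection on U, the Frenet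
   equations of a holomorphic curve in the ball with unit tangent e_1. Integrating it gives a
   pseudo-unitary frame (e_0, e_1, e_2) of C^{2,1} over a small rectangle, and the point
   cosh(az) e_0 + sinh(az) e^{2iat} e_1 of the complex line tangent to the curve describes a local
   isometry from M to the ball. *)

(** * Functions of class C^k on R^4 *)

(** The definitions go through coordinate Christoffel symbols built on Cramer's rule, where direct
    expansion of the curvature is hopeless. In the frame, sinh, cosh, sin and cos disappear: k, A, B
    and the components p, q of d(ln h) are closed under frame derivatives up to a few free
    quantities, and the curvature becomes 256 rational identities. Space forms are tested on
    arbitrary smooth unit fields rather than on the frame, so the curvature must also be shown to be
    tensorial.

    Both equations have a meaning in the ball. A holomorphic curve with induced metric H^2 |dx + i
    dy|^2 has curvature - 4a^2 - 2a^2 h^2 / H^2 when h governs its second fundamental form: this is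
    the equation for ln H (Gauss), and with it the one for ln h amounts to the Ricci equation of the
    normal bundle. M is swept out by the complex geodesics tangent to the curve, - z being the
    distance along them and 2at the phase. Integrating the connection and inverting the resulting
    map rest on one contraction principle, [contraction_fixpoint], used for linear ODEs and for the
    inverse function theorem. *)

Lemma upd_same (p : pt) (i : ix) (s : R) : upd p i s i = s.
Proof. unfold upd; destruct i; reflexivity. Qed.

Lemma upd_id (p : pt) (i : ix) : upd p i (p i) = p.
Proof.
  apply functional_extensionality; intro j; unfold upd.
  destruct i, j; reflexivity.
Qed.

Lemma upd_upd (p : pt) (i : ix) (s t : R) : upd (upd p i s) i t = upd p i t.
Proof.
  apply functional_extensionality; intro j; unfold upd.
  destruct i, j; reflexivity.
Qed.

Definition box (p : pt) (r : R) (q : pt) : Prop := forall i, Rabs (q i - p i) < r.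

(** Balls of the sup-norm uniform structure convert to boxes, which makes explicit radii usable
    below. *)
Lemma open_box_iff (V : pt -> Prop) :
  open V <-> forall p, V p -> exists r, 0 < r /\ forall q, box p r q -> V q.
Proof.
  split.
  - intros HV p Hp. destruct (HV p Hp) as [r Hr].
    exists r; split; [apply cond_pos|]. intros q Hq. apply Hr. exact Hq.
  - intros HV p Hp. destruct (HV p Hp) as [r [Hr H]].
    exists (mkposreal r Hr). intros q Hq. apply H. exact Hq.
Qed.

Lemma open_box (p : pt) (r : R) : open (box p r).
Proof.
  apply open_box_iff. intros q Hq.
  set (m := Rmin (Rmin (r - Rabs (q i1 - p i1)) (r - Rabs (q i2 - p i2)))
              (Rmin (r - Rabs (q i3 - p i3)) (r - Rabs (q i4 - p i4)))).
  assert (Hm : forall i, m <= r - Rabs (q i - p i)).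
  { unfold m. intros []; eauto using Rle_trans, Rmin_l, Rmin_r. }
  exists m. split.
  - unfold m; repeat apply Rmin_glb_lt; match goal with |- 0 < _ - Rabs (_ ?i - _) => specialize (Hq i); lra end.
  - intros w Hw i. specialize (Hw i). specialize (Hm i).
    replace (w i - p i) with ((w i - q i) + (q i - p i)) by ring.
    eapply Rle_lt_trans; [apply Rabs_triang|]. lra.
Qed.

Lemma box_center (p : pt) (r : R) : 0 < r -> box p r p.
Proof. intros Hr i. replace (p i - p i) with 0 by ring. rewrite Rabs_R0. exact Hr. Qed.

Lemma box_upd (p q : pt) (r : R) (i : ix) (s : R) :
  box p r q -> Rabs (s - p i) < r -> box p r (upd q i s).
Proof.
  intros Hq Hs j. unfold upd. destruct (ix_eqb i j) eqn:E; [|apply Hq].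
  replace j with i; [exact Hs|]. destruct i, j; try discriminate; reflexivity.
Qed.

Lemma box_upd_center (p : pt) (r : R) (i : ix) (s : R) :
  Rabs (s - p i) < r -> box p r (upd p i s).
Proof.
  intro Hs. apply box_upd; [|exact Hs]. apply box_center.
  eapply Rle_lt_trans; [apply Rabs_pos | exact Hs].
Qed.


Lemma continuous_box_iff (f : pt -> R) (p : pt) :
  continuous f p <->
  forall e, 0 < e -> exists r, 0 < r /\ forall q, box p r q -> Rabs (f q - f p) < e.
Proof.
  split.
  - intros Hf e He.
    destruct (proj1 (filterlim_locally f (f p)) Hf (mkposreal e He)) as [r Hr].
    exists r; split; [apply cond_pos|]. intros q Hq. apply (Hr q Hq).
  - intros Hf. apply filterlim_locally. intros [e He].
    destruct (Hf e He) as [r [Hr H]].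
    exists (mkposreal r Hr). intros q Hq. apply (H q Hq).
Qed.

Lemma locally_upd (V : pt -> Prop) (p : pt) (i : ix) :
  open V -> V p -> locally (p i) (fun s => V (upd p i s)).
Proof.
  intros HV Hp. destruct (proj1 (open_box_iff V) HV p Hp) as [r [Hr H]].
  exists (mkposreal r Hr). intros s Hs. apply H. apply box_upd_center. exact Hs.
Qed.

Lemma partial_ext_open (V : pt -> Prop) (f g : pt -> R) (i : ix) (p : pt) :
  open V -> (forall q, V q -> f q = g q) -> V p -> partial i f p = partial i g p.
Proof.
  intros HV E Hp. apply Derive_ext_loc.
  generalize (locally_upd V p i HV Hp). apply filter_imp. intros s Hs. apply E, Hs.
Qed.

Lemma ex_partial_ext_open (V : pt -> Prop) (f g : pt -> R) (i : ix) (p : pt) :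
  open V -> (forall q, V q -> f q = g q) -> V p -> ex_partial i f p -> ex_partial i g p.
Proof.
  intros HV E Hp. apply ex_derive_ext_loc.
  generalize (locally_upd V p i HV Hp). apply filter_imp. auto.
Qed.

(** A relation instead of the operator [partial]: the calculus rules compose by unification and
    deliver existence and value together, which the tactic [hp] exploits. *)
Definition has_partial (i : ix) (f : pt -> R) (p : pt) (l : R) : Prop :=
  is_derive (fun s => f (upd p i s)) (p i) l.

Lemma has_partial_partial i f p l : has_partial i f p l -> partial i f p = l.
Proof. apply is_derive_unique. Qed.

Lemma has_partial_ex i f p l : has_partial i f p l -> ex_partial i f p.
Proof. intro H; exists l; exact H. Qed.

Lemma ex_has_partial i f p : ex_partial i f p -> has_partial i f p (partial i f p).
Proof. intro H. apply Derive_correct, H. Qed.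

Lemma has_partial_eq i f p l l' : has_partial i f p l -> l = l' -> has_partial i f p l'.
Proof. intros H <-; exact H. Qed.

Lemma has_partial_const i c p : has_partial i (fun _ => c) p 0.
Proof. exact (@is_derive_const R_AbsRing R_NormedModule c (p i)). Qed.

Lemma has_partial_coord i j p : has_partial i (fun q => q j) p (kron i j).
Proof.
  unfold has_partial, upd, kron. destruct (ix_eqb i j).
  - exact (@is_derive_id R_AbsRing (p i)).
  - exact (@is_derive_const R_AbsRing R_NormedModule (p j) (p i)).
Qed.

Lemma has_partial_plus i f g p l m :
  has_partial i f p l -> has_partial i g p m -> has_partial i (fun q => f q + g q) p (l + m).
Proof. intros Hf Hg. apply (is_derive_plus _ _ _ _ _ Hf Hg). Qed.

Lemma has_partial_opp i f p l : has_partial i f p l -> has_partial i (fun q => - f q) p (- l).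
Proof. intros Hf. apply (is_derive_opp _ _ _ Hf). Qed.

Lemma has_partial_minus i f g p l m :
  has_partial i f p l -> has_partial i g p m -> has_partial i (fun q => f q - g q) p (l - m).
Proof. intros Hf Hg. apply (is_derive_minus _ _ _ _ _ Hf Hg). Qed.

Lemma has_partial_mult i f g p l m :
  has_partial i f p l -> has_partial i g p m ->
  has_partial i (fun q => f q * g q) p (l * g p + f p * m).
Proof.
  intros Hf Hg.
  pose proof (is_derive_mult _ _ _ _ _ Hf Hg Rmult_comm) as K.
  cbv beta in K; rewrite upd_id in K. exact K.
Qed.

Lemma has_partial_comp i (u : R -> R) f p l m :
  is_derive u (f p) m -> has_partial i f p l -> has_partial i (fun q => u (f q)) p (l * m).
Proof.
  intros Hu Hf. apply (is_derive_comp u (fun s => f (upd p i s))); [|exact Hf].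
  rewrite upd_id. exact Hu.
Qed.

Lemma has_partial_inv i f p l :
  f p <> 0 -> has_partial i f p l -> has_partial i (fun q => / f q) p (- l / f p ^ 2).
Proof.
  intros Hp Hf. pose proof (is_derive_inv _ _ _ Hf) as K.
  cbv beta in K; rewrite upd_id in K. exact (K Hp).
Qed.

Lemma has_partial_sum4 i (f : ix -> pt -> R) p (l : ix -> R) :
  (forall j, has_partial i (f j) p (l j)) ->
  has_partial i (fun q => sum4 (fun j => f j q)) p (sum4 l).
Proof. intro Hf. unfold sum4. repeat apply has_partial_plus; apply Hf. Qed.

Lemma Ck_continuous k V f p : Ck k V f -> V p -> continuous f p.
Proof. destruct k; intros [Hc _]; apply Hc. Qed.

Lemma Ck_down k V f : Ck (S k) V f -> Ck k V f.
Proof.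
  revert f; induction k as [|k IH]; intros f [Hc Hd].
  - split; [exact Hc|exact I].
  - split; [exact Hc|]. intro i. destruct (Hd i) as [He Hp]. split; [exact He|]. apply IH, Hp.
Qed.

Lemma Ck_partial k V f i : Ck (S k) V f -> Ck k V (partial i f).
Proof. intros [_ Hd]. apply Hd. Qed.

Lemma Ck_ex_partial k V f i p : Ck (S k) V f -> V p -> ex_partial i f p.
Proof. intros [_ Hd]. apply Hd. Qed.

Lemma Ck_sub k (V W : pt -> Prop) f : (forall p, W p -> V p) -> Ck k V f -> Ck k W f.
Proof.
  intro HW. revert f; induction k as [|k IH]; intros f [Hc Hd]; split; auto.
  intro i. destruct (Hd i) as [He Hp]. split; auto.
Qed.

Lemma continuous_ext_open (V : pt -> Prop) (f g : pt -> R) p :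
  open V -> (forall q, V q -> f q = g q) -> V p -> continuous f p -> continuous g p.
Proof.
  intros HV E Hp Hf. apply continuous_ext_loc with f; [|exact Hf].
  generalize (HV p Hp). apply filter_imp. intros q Hq; apply E, Hq.
Qed.

Lemma Ck_ext k (V : pt -> Prop) f g :
  open V -> (forall p, V p -> f p = g p) -> Ck k V f -> Ck k V g.
Proof.
  intro HV. revert f g; induction k as [|k IH]; intros f g E [Hc Hd]; split.
  - intros p Hp. apply (continuous_ext_open V f); auto.
  - exact I.
  - intros p Hp. apply (continuous_ext_open V f); auto.
  - intro i. destruct (Hd i) as [He Hp]. split.
    + intros p Vp. apply (ex_partial_ext_open V f); auto.
    + apply (IH (partial i f)); [|exact Hp]. intros p Vp. apply (partial_ext_open V); auto.
Qed.

(** The induction step of the basic closure properties: candidate derivatives of class C^k are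
    exhibited, and [partial] is never unfolded. *)
Lemma Ck_intro k V f (f' : ix -> pt -> R) : open V ->
  (forall p, V p -> continuous f p) ->
  (forall i p, V p -> has_partial i f p (f' i p)) ->
  (forall i, Ck k V (f' i)) -> Ck (S k) V f.
Proof.
  intros HV Hc Hd Hk. split; [exact Hc|]. intro i. split.
  - intros p Vp. eapply has_partial_ex, Hd, Vp.
  - apply (Ck_ext k V (f' i)); auto. intros p Vp. symmetry. apply has_partial_partial, Hd, Vp.
Qed.

Lemma Ck_has_partial k V f i p : Ck (S k) V f -> V p -> has_partial i f p (partial i f p).
Proof. intros Hf Vp. apply ex_has_partial. eapply Ck_ex_partial; eauto. Qed.

Section Closure.
Variable V : pt -> Prop.
Hypothesis HV : open V.

Lemma Ck_const k c : Ck k V (fun _ => c).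
Proof.
  revert c; induction k as [|k IH]; intro c.
  - split; [|exact I]. intros p _. apply continuous_const.
  - apply Ck_intro with (fun _ _ => 0); auto.
    + intros p _. apply continuous_const.
    + intros i p _. apply has_partial_const.
Qed.

Lemma continuous_coord j p : continuous (fun q : pt => q j) p.
Proof.
  apply continuous_box_iff. intros e He. exists e. split; [exact He|]. intros q Hq. apply Hq.
Qed.

Lemma Ck_coord k j : Ck k V (fun p => p j).
Proof.
  destruct k.
  - split; [|exact I]. intros p _. apply continuous_coord.
  - apply Ck_intro with (fun i _ => kron i j); auto.
    + intros p _. apply continuous_coord.
    + intros i p _. apply has_partial_coord.
    + intro i. apply Ck_const.
Qed.

Lemma Ck_plus k f g : Ck k V f -> Ck k V g -> Ck k V (fun p => f p + g p).
Proof.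
  revert f g; induction k as [|k IH]; intros f g Hf Hg.
  - split; [|exact I]. intros p Vp.
    apply (continuous_plus f g); eapply Ck_continuous; eauto.
  - apply Ck_intro with (fun i p => partial i f p + partial i g p); auto.
    + intros p Vp. apply (continuous_plus f g); eapply Ck_continuous; eauto.
    + intros i p Vp. apply has_partial_plus; eapply Ck_has_partial; eauto.
    + intro i. apply IH; apply Ck_partial; assumption.
Qed.

Lemma Ck_mult k f g : Ck k V f -> Ck k V g -> Ck k V (fun p => f p * g p).
Proof.
  revert f g; induction k as [|k IH]; intros f g Hf Hg.
  - split; [|exact I]. intros p Vp.
    apply (continuous_mult f g); eapply Ck_continuous; eauto.
  - apply Ck_intro with (fun i p => partial i f p * g p + f p * partial i g p); auto.
    + intros p Vp. apply (continuous_mult f g); eapply Ck_continuous; eauto.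
    + intros i p Vp. apply has_partial_mult; eapply Ck_has_partial; eauto.
    + intro i. apply Ck_plus; apply IH; try (apply Ck_partial; assumption); apply Ck_down; assumption.
Qed.

Lemma Ck_opp k f : Ck k V f -> Ck k V (fun p => - f p).
Proof.
  intro Hf. apply Ck_ext with (fun p => (-1) * f p); auto.
  - intros; ring.
  - apply Ck_mult; [apply Ck_const|exact Hf].
Qed.

Lemma Ck_minus k f g : Ck k V f -> Ck k V g -> Ck k V (fun p => f p - g p).
Proof. intros Hf Hg. apply Ck_plus; [exact Hf|]. apply Ck_opp, Hg. Qed.

Lemma Ck_sum4 k (f : ix -> pt -> R) :
  (forall j, Ck k V (f j)) -> Ck k V (fun p => sum4 (fun j => f j p)).
Proof. intro Hf. unfold sum4. repeat apply Ck_plus; apply Hf. Qed.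

Lemma Ck_pow k f n : Ck k V f -> Ck k V (fun p => f p ^ n).
Proof.
  intro Hf. induction n as [|n IH]; simpl; [apply Ck_const|]. apply Ck_mult; assumption.
Qed.

Lemma Ck_inv k f : (forall p, V p -> f p <> 0) -> Ck k V f -> Ck k V (fun p => / f p).
Proof.
  intro Hn. revert f Hn; induction k as [|k IH]; intros f Hn Hf.
  - split; [|exact I]. intros p Vp. apply continuous_comp; [eapply Ck_continuous; eauto|].
    apply continuous_Rinv. auto.
  - apply Ck_intro with (fun i p => - partial i f p * (/ f p) * (/ f p)); auto.
    + intros p Vp. apply continuous_comp; [eapply Ck_continuous; eauto|].
      apply continuous_Rinv. auto.
    + intros i p Vp. eapply has_partial_eq.
      * apply has_partial_inv; [auto|]. eapply Ck_has_partial; eauto.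
      * field. auto.
    + intro i. assert (Ck k V (fun p => / f p)) by (apply IH; auto using Ck_down).
      repeat apply Ck_mult; auto. apply Ck_opp, Ck_partial, Hf.
Qed.

Lemma Ck_div k f g : (forall p, V p -> g p <> 0) -> Ck k V f -> Ck k V g -> Ck k V (fun p => f p / g p).
Proof. intros Hn Hf Hg. apply Ck_mult; [exact Hf|]. apply Ck_inv; assumption. Qed.

(** The pair with u' = v and v' = c u is treated at once, since neither half of the induction closes
    alone; c = -1 gives sine and cosine, c = 1 their hyperbolic counterparts. *)
Lemma Ck_comp1 (u v : R -> R) (c : R) k f :
  (forall x, is_derive u x (v x)) -> (forall x, is_derive v x (c * u x)) ->
  Ck k V f -> Ck k V (fun p => u (f p)) /\ Ck k V (fun p => v (f p)).
Proof.
  intros Hu Hv.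
  assert (Hc : forall (w dw : R -> R) n f, (forall x, is_derive w x (dw x)) -> Ck n V f ->
    forall p, V p -> continuous (fun q : ix -> R => w (f q)) p).
  { intros w dw n f0 Hw Hf p Vp. apply continuous_comp; [eapply Ck_continuous; eauto|].
    apply (@ex_derive_continuous R_AbsRing R_NormedModule); eexists; eauto. }
  revert f. induction k as [|k IH]; intros f Hf.
  - split; (split; [|exact I]); [apply (Hc u v 0%nat f)|apply (Hc v (fun x => c * u x) 0%nat f)]; assumption.
  - destruct (IH f (Ck_down _ _ _ Hf)) as [IHu IHv].
    split.
    + apply Ck_intro with (fun i p => partial i f p * v (f p)); [exact HV|apply (Hc u v (S k) f); assumption| |].
      * intros i p Vp. apply has_partial_comp; auto. eapply Ck_has_partial; eauto.
      * intro i. apply Ck_mult; auto. apply Ck_partial, Hf.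
    + apply Ck_intro with (fun i p => partial i f p * (c * u (f p))); [exact HV|apply (Hc v (fun x => c * u x) (S k) f); assumption| |].
      * intros i p Vp. apply (has_partial_comp i v); auto. eapply Ck_has_partial; eauto.
      * intro i. apply Ck_mult; [apply Ck_partial, Hf|]. apply Ck_mult; auto. apply Ck_const.
Qed.

Lemma is_derive_sinh x : is_derive sinh x (cosh x).
Proof. apply is_derive_Reals, derivable_pt_lim_sinh. Qed.

Lemma is_derive_cosh x : is_derive cosh x (sinh x).
Proof. apply is_derive_Reals, derivable_pt_lim_cosh. Qed.

Lemma is_derive_cos' x : is_derive cos x (-1 * sin x).
Proof. replace (-1 * sin x) with (- sin x) by ring. apply is_derive_cos. Qed.

Lemma Ck_sin k f : Ck k V f -> Ck k V (fun p => sin (f p)).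
Proof. intro Hf. apply (Ck_comp1 sin cos (-1)); auto using is_derive_sin, is_derive_cos'. Qed.

Lemma Ck_cos k f : Ck k V f -> Ck k V (fun p => cos (f p)).
Proof. intro Hf. apply (Ck_comp1 sin cos (-1)); auto using is_derive_sin, is_derive_cos'. Qed.

Lemma is_derive_cosh' x : is_derive cosh x (1 * sinh x).
Proof. rewrite Rmult_1_l. apply is_derive_cosh. Qed.

Lemma Ck_sinh k f : Ck k V f -> Ck k V (fun p => sinh (f p)).
Proof. intro Hf. apply (Ck_comp1 sinh cosh 1); auto using is_derive_sinh, is_derive_cosh'. Qed.

Lemma Ck_cosh k f : Ck k V f -> Ck k V (fun p => cosh (f p)).
Proof. intro Hf. apply (Ck_comp1 sinh cosh 1); auto using is_derive_sinh, is_derive_cosh'. Qed.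

End Closure.

Lemma smooth_on_has_partial V f i p : smooth_on V f -> V p -> has_partial i f p (partial i f p).
Proof. intros Hf Vp. apply (Ck_has_partial 0 V); auto. Qed.

Lemma smooth_on_ex V f i p : smooth_on V f -> V p -> ex_partial i f p.
Proof. intros Hf Vp. apply (Ck_ex_partial 0 V f i p); auto. Qed.

Lemma smooth_on_partial V f i : smooth_on V f -> smooth_on V (partial i f).
Proof. intros Hf k. apply Ck_partial, Hf. Qed.

Lemma Rabs_mult_le x y b c : Rabs x <= b -> Rabs y <= c -> Rabs (x * y) <= b * c.
Proof. intros. rewrite Rabs_mult. apply Rmult_le_compat; auto using Rabs_pos. Qed.

Lemma Rmult_neq_0 x y : x <> 0 -> y <> 0 -> x * y <> 0.
Proof. intros. apply Rmult_integral_contrapositive_currified; assumption. Qed.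

Ltac ck_step :=
  lazymatch goal with
  | |- Ck _ _ (fun _ => ?c) => apply Ck_const
  | |- Ck _ _ (fun q => q _) => apply Ck_coord
  | |- Ck _ _ (fun q => _ + _) => apply Ck_plus
  | |- Ck _ _ (fun q => _ - _) => apply Ck_minus
  | |- Ck _ _ (fun q => - _) => apply Ck_opp
  | |- Ck _ _ (fun q => _ * _) => apply Ck_mult
  | |- Ck _ _ (fun q => _ ^ _) => apply Ck_pow
  | |- Ck _ _ (fun q => _ / _) => apply Ck_div
  | |- Ck _ _ (fun q => / _) => apply Ck_inv
  | |- Ck _ _ (fun q => sin _) => apply Ck_sin
  | |- Ck _ _ (fun q => cos _) => apply Ck_cos
  | |- Ck _ _ (fun q => sinh _) => apply Ck_sinh
  | |- Ck _ _ (fun q => cosh _) => apply Ck_cosh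
  end.

(** * Functions of (x, y) as functions on R^4 *)

Definition lift2 (f : R -> R -> R) : pt -> R := fun p => f (p i1) (p i2).

Definition dom2 (U : R * R -> Prop) (p : pt) : Prop := U (p i1, p i2).

Lemma open_dom2 U : open U -> open (dom2 U).
Proof.
  intro HU. apply open_box_iff. intros p Hp.
  destruct (HU _ Hp) as [r Hr]. exists r. split; [apply cond_pos|].
  intros q Hq. apply Hr. split; apply Hq.
Qed.

Lemma open_domM U : open U -> open (domM U).
Proof.
  intro HU. apply open_and; [apply open_dom2, HU|].
  apply open_box_iff. intros p Hp. exists (- p i3). split; [lra|].
  intros q Hq. specialize (Hq i3). apply Rabs_def2 in Hq. lra.
Qed.

Lemma continuous_lift2 f p : continuity_2d_pt f (p i1) (p i2) -> continuous (lift2 f) p.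
Proof.
  intro Hf. apply continuous_box_iff. intros e He.
  destruct (Hf (mkposreal e He)) as [d Hd]. exists d. split; [apply cond_pos|].
  intros q Hq. apply Hd; apply Hq.
Qed.

(** Bridges the two notions of smoothness: [ex_diff_n] recurses through [Derive] in x and in y just
    as [Ck] recurses through [partial]. *)
Lemma Ck_lift2 U (f : R -> R -> R) k : open U ->
  (forall x y, U (x, y) -> forall n, ex_diff_n f n x y) -> Ck k (dom2 U) (lift2 f).
Proof.
  intro HU. pose proof (open_dom2 U HU) as HV.
  revert f; induction k as [|k IH]; intros f Hf.
  - split; [|exact I]. intros p Vp. apply continuous_lift2. apply (Hf _ _ Vp 0%nat).
  - apply Ck_intro with (fun i => match i with
       | i1 => lift2 (fun u v => Derive (fun z => f z v) u)
       | i2 => lift2 (fun u v => Derive (fun z => f u z) v)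
       | _ => fun _ => 0 end); auto.
    + intros p Vp. apply continuous_lift2. apply (Hf _ _ Vp 0%nat).
    + intros i p Vp. destruct (Hf _ _ Vp 1%nat) as [_ [Hx [Hy _]]].
      destruct i; unfold has_partial, lift2; simpl; unfold upd; simpl.
      * apply Derive_correct, Hx.
      * apply Derive_correct, Hy.
      * exact (@is_derive_const R_AbsRing R_NormedModule (f (p i1) (p i2)) (p i3)).
      * exact (@is_derive_const R_AbsRing R_NormedModule (f (p i1) (p i2)) (p i4)).
    + intro i. destruct i; try (apply Ck_const; auto).
      * apply IH. intros x y Uxy n. apply (Hf x y Uxy (S n)).
      * apply IH. intros x y Uxy n. apply (Hf x y Uxy (S n)).
Qed.

(** * Finite sums and 4x4 matrices *)

Lemma sum4_ext f g : (forall i, f i = g i) -> sum4 f = sum4 g.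
Proof. intro H. unfold sum4. rewrite !H. reflexivity. Qed.

Lemma sum4_kron_l (f : ix -> R) j : sum4 (fun i => kron i j * f i) = f j.
Proof. unfold sum4, kron. destruct j; simpl; ring. Qed.

Lemma sum4_kron_r (f : ix -> R) j : sum4 (fun i => kron j i * f i) = f j.
Proof. unfold sum4, kron. destruct j; simpl; ring. Qed.

(** Cofactor form, free of the 256 signed terms of the definition, so that later goals stay within
    reach of [ring]. *)
Lemma det4_expand m : det4 m =
   m i1 i1 * (m i2 i2 * (m i3 i3 * m i4 i4 - m i3 i4 * m i4 i3)
            - m i2 i3 * (m i3 i2 * m i4 i4 - m i3 i4 * m i4 i2)
            + m i2 i4 * (m i3 i2 * m i4 i3 - m i3 i3 * m i4 i2))
 - m i1 i2 * (m i2 i1 * (m i3 i3 * m i4 i4 - m i3 i4 * m i4 i3)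
            - m i2 i3 * (m i3 i1 * m i4 i4 - m i3 i4 * m i4 i1)
            + m i2 i4 * (m i3 i1 * m i4 i3 - m i3 i3 * m i4 i1))
 + m i1 i3 * (m i2 i1 * (m i3 i2 * m i4 i4 - m i3 i4 * m i4 i2)
            - m i2 i2 * (m i3 i1 * m i4 i4 - m i3 i4 * m i4 i1)
            + m i2 i4 * (m i3 i1 * m i4 i2 - m i3 i2 * m i4 i1))
 - m i1 i4 * (m i2 i1 * (m i3 i2 * m i4 i3 - m i3 i3 * m i4 i2)
            - m i2 i2 * (m i3 i1 * m i4 i3 - m i3 i3 * m i4 i1)
            + m i2 i3 * (m i3 i1 * m i4 i2 - m i3 i2 * m i4 i1)).
Proof. unfold det4, sum4, perm_sign, ix_rank. field. Qed.

Lemma inv4_r m : det4 m <> 0 -> forall r i, sum4 (fun j => m r j * inv4 m j i) = kron r i.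
Proof.
  intros Hd r i. unfold inv4.
  replace (kron r i) with (kron r i * det4 m / det4 m) by (field; exact Hd).
  transitivity (sum4 (fun j => m r j * det4 (fun r c => if ix_eqb r i then kron j c else m r c)) / det4 m).
  - unfold sum4. field. exact Hd.
  - f_equal. rewrite !det4_expand. unfold sum4. rewrite !det4_expand.
    destruct i; destruct r; unfold kron; simpl; ring.
Qed.

Lemma inv4_l m : det4 m <> 0 -> forall j c, sum4 (fun i => inv4 m j i * m i c) = kron j c.
Proof.
  intros Hd j c. unfold inv4.
  replace (kron j c) with (kron j c * det4 m / det4 m) by (field; exact Hd).
  transitivity (sum4 (fun i => det4 (fun r c => if ix_eqb r i then kron j c else m r c) * m i c) / det4 m).
  - unfold sum4. field. exact Hd.
  - f_equal. rewrite !det4_expand. unfold sum4. rewrite !det4_expand.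
    destruct j; destruct c; unfold kron; simpl; ring.
Qed.

Lemma det4_mul (m n : ix -> ix -> R) :
  det4 (fun i j => sum4 (fun k => m i k * n k j)) = det4 m * det4 n.
Proof.
  rewrite !det4_expand. unfold sum4. ring.
Qed.

(** * The Levi-Civita connection in an orthonormal frame *)

Lemma Ck_det4 V k (m : pt -> ix -> ix -> R) : open V ->
  (forall i j, Ck k V (fun p => m p i j)) -> Ck k V (fun p => det4 (m p)).
Proof.
  intros HV Hm. apply Ck_ext with (1 := HV) (f := fun p => _) (2 := fun p _ => eq_sym (det4_expand (m p))).
  repeat first [ apply Hm | ck_step; try exact HV ].
Qed.

Lemma Ck_inv4 V k (m : pt -> ix -> ix -> R) : open V -> (forall p, V p -> det4 (m p) <> 0) ->
  (forall i j, Ck k V (fun p => m p i j)) -> forall i j, Ck k V (fun p => inv4 (m p) i j).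
Proof.
  intros HV Hd Hm i j. unfold inv4.
  apply Ck_div; auto.
  - apply (Ck_det4 V k (fun p r c => if ix_eqb r j then kron i c else m p r c)); auto.
    intros r c. destruct (ix_eqb r j); [apply Ck_const; auto | apply Hm].
  - apply Ck_det4; auto.
Qed.

Definition cov (g : metric) (i : ix) (Y : vfield) (p : pt) (k : ix) : R :=
  partial i (fun q => Y q k) p + sum4 (fun j => christoffel g k i j p * Y p j).

Lemma nabla_cov g X Y p k : nabla g X Y p k = sum4 (fun i => X p i * cov g i Y p k).
Proof. unfold nabla, cov, dir, sum4. ring. Qed.

Section Metric.
Variable V : pt -> Prop.
Hypothesis HV : open V.
Variable g : metric.
Hypothesis g_sym : forall p i j, g p i j = g p j i.
Hypothesis g_smooth : forall i j, smooth_on V (fun p => g p i j).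
Hypothesis g_det : forall p, V p -> det4 (g p) <> 0.

Lemma christoffel_sym k i j p : christoffel g k i j p = christoffel g k j i p.
Proof.
  unfold christoffel. f_equal. apply sum4_ext. intro l. f_equal.
  replace (fun q => g q i j) with (fun q => g q j i)
    by (apply functional_extensionality; intro; apply g_sym).
  ring.
Qed.

Lemma christoffel_lower p m i j : V p ->
  sum4 (fun k => g p m k * christoffel g k i j p)
  = / 2 * (partial i (fun q => g q j m) p + partial j (fun q => g q i m) p
           - partial m (fun q => g q i j) p).
Proof.
  intro Vp. unfold christoffel.
  set (D := fun l => partial i (fun q => g q j l) p + partial j (fun q => g q i l) p
           - partial l (fun q => g q i j) p).
  transitivity (/ 2 * sum4 (fun l => sum4 (fun k => g p m k * inv4 (g p) k l) * D l)).
  - unfold sum4, D. ring.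
  - rewrite (sum4_ext _ (fun l => kron m l * D l)).
    + rewrite sum4_kron_r. reflexivity.
    + intro l. rewrite inv4_r; auto.
Qed.

(** Of the six derivatives in the two lowered symbols four cancel, and the other two coincide: the
    connection is compatible with the metric. *)
Lemma partial_metric p i k l : V p ->
  partial i (fun q => g q k l) p
  = sum4 (fun m => g p l m * christoffel g m i k p) + sum4 (fun m => g p k m * christoffel g m i l p).
Proof.
  intro Vp. rewrite !christoffel_lower by exact Vp.
  replace (fun q => g q l k) with (fun q => g q k l)
    by (apply functional_extensionality; intro; apply g_sym).
  lra.
Qed.

Lemma partial_gprod p i Y Z : V p ->
  (forall k, ex_partial i (fun q => Y q k) p) -> (forall k, ex_partial i (fun q => Z q k) p) ->
  partial i (gprod g Y Z) p
  = sum4 (fun k => sum4 (fun l => g p k l * (cov g i Y p k * Z p l + Y p k * cov g i Z p l))).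
Proof.
  intros Vp HY HZ.
  transitivity (sum4 (fun k => sum4 (fun l =>
     (partial i (fun q => g q k l) p * Y p k + g p k l * partial i (fun q => Y q k) p) * Z p l
     + g p k l * Y p k * partial i (fun q => Z q l) p))).
  - apply has_partial_partial. unfold gprod.
    apply has_partial_sum4 with (f := fun k q => sum4 (fun l => g q k l * Y q k * Z q l)). intro k.
    apply has_partial_sum4 with (f := fun l q => g q k l * Y q k * Z q l). intro l.
    apply has_partial_mult with (f := fun q => g q k l * Y q k) (g := fun q => Z q l); [|apply ex_has_partial, HZ].
    apply has_partial_mult with (f := fun q => g q k l) (g := fun q => Y q k); [|apply ex_has_partial, HY].
    apply ex_has_partial. eapply smooth_on_ex; [apply g_smooth|exact Vp].
  - rewrite (sum4_ext _ (fun k => sum4 (fun l =>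
     ((sum4 (fun m => g p m l * christoffel g m i k p) + sum4 (fun m => g p k m * christoffel g m i l p))
      * Y p k + g p k l * partial i (fun q => Y q k) p) * Z p l
     + g p k l * Y p k * partial i (fun q => Z q l) p))).
    + unfold cov, sum4. ring.
    + intro k. apply sum4_ext. intro l. rewrite partial_metric by exact Vp.
      rewrite (sum4_ext (fun m => g p l m * _) (fun m => g p m l * christoffel g m i k p)); [reflexivity|].
      intro m. rewrite g_sym. reflexivity.
Qed.

Lemma dir_gprod p X Y Z : V p -> smooth_vec_on V Y -> smooth_vec_on V Z ->
  dir X (gprod g Y Z) p = gprod g (nabla g X Y) Z p + gprod g Y (nabla g X Z) p.
Proof.
  intros Vp HY HZ. unfold dir.
  rewrite (sum4_ext _ (fun i => X p i * sum4 (fun k => sum4 (fun l =>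
     g p k l * (cov g i Y p k * Z p l + Y p k * cov g i Z p l))))).
  - unfold gprod.
    rewrite (sum4_ext (fun i => sum4 (fun j => g p i j * nabla g X Y p i * Z p j))
      (fun i => sum4 (fun j => g p i j * sum4 (fun n => X p n * cov g n Y p i) * Z p j))).
    rewrite (sum4_ext (fun i => sum4 (fun j => g p i j * Y p i * nabla g X Z p j))
      (fun i => sum4 (fun j => g p i j * Y p i * sum4 (fun n => X p n * cov g n Z p j)))).
    + unfold sum4. ring.
    + intro i. apply sum4_ext. intro j. rewrite nabla_cov. reflexivity.
    + intro i. apply sum4_ext. intro j. rewrite nabla_cov. reflexivity.
  - intro i. rewrite partial_gprod; auto; intro k; eapply smooth_on_ex; try exact Vp; auto.
Qed.

Lemma nabla_torsion X Y p k : nabla g X Y p k - nabla g Y X p k = bracket X Y p k.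
Proof.
  unfold nabla, bracket.
  assert (E : sum4 (fun i => sum4 (fun j => christoffel g k i j p * X p i * Y p j))
            = sum4 (fun i => sum4 (fun j => christoffel g k i j p * Y p i * X p j))).
  { rewrite (sum4_ext _ (fun i => sum4 (fun j => christoffel g k j i p * X p i * Y p j))).
    - unfold sum4. ring.
    - intro i; apply sum4_ext; intro j; rewrite christoffel_sym; reflexivity. }
  rewrite E. ring.
Qed.

Lemma smooth_christoffel k i j : smooth_on V (christoffel g k i j).
Proof.
  intro n. unfold christoffel.
  apply Ck_mult; [exact HV|apply Ck_const; exact HV|].
  apply (Ck_sum4 V HV n (fun l p => inv4 (g p) k l *
    (partial i (fun q => g q j l) p + partial j (fun q => g q i l) p - partial l (fun q => g q i j) p))).
  intro l. apply Ck_mult; [exact HV| |].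
  - apply Ck_inv4; auto. intros; apply g_smooth.
  - apply Ck_minus; auto; [apply Ck_plus; auto|]; apply smooth_on_partial, g_smooth.
Qed.

End Metric.

Lemma nabla_ext_open V g X Y Y' p k : open V -> V p ->
  (forall q, V q -> forall j, Y q j = Y' q j) -> nabla g X Y p k = nabla g X Y' p k.
Proof.
  intros HV Vp E. rewrite !nabla_cov. apply sum4_ext. intro i. f_equal. unfold cov.
  rewrite (partial_ext_open V (fun q => Y q k) (fun q => Y' q k)) by auto.
  f_equal. apply sum4_ext. intro j. rewrite E by exact Vp. reflexivity.
Qed.

Lemma nabla_frame_l g (c : ix -> R) (E : ix -> vfield) X Z p k :
  (forall i, X p i = sum4 (fun m => c m * E m p i)) ->
  nabla g X Z p k = sum4 (fun m => c m * nabla g (E m) Z p k).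
Proof.
  intro H. rewrite nabla_cov.
  rewrite (sum4_ext _ (fun i => sum4 (fun m => c m * E m p i) * cov g i Z p k)) by (intro; rewrite H; reflexivity).
  rewrite (sum4_ext (fun m => c m * _) (fun m => c m * sum4 (fun i => E m p i * cov g i Z p k)))
    by (intro; rewrite nabla_cov; reflexivity).
  unfold sum4. ring.
Qed.

Lemma nabla_frame_r g (f : ix -> pt -> R) (E : ix -> vfield) X p k :
  (forall i m, ex_partial i (f m) p) -> (forall i m j, ex_partial i (fun q => E m q j) p) ->
  nabla g X (fun q j => sum4 (fun m => f m q * E m q j)) p k
  = sum4 (fun m => dir X (f m) p * E m p k + f m p * nabla g X (E m) p k).
Proof.
  intros Hf HE. rewrite nabla_cov.
  rewrite (sum4_ext (fun m => _ + _) (fun m => dir X (f m) p * E m p k + f m p * sum4 (fun i => X p i * cov g i (E m) p k)))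
    by (intro; rewrite nabla_cov; reflexivity).
  unfold cov.
  rewrite (sum4_ext _ (fun i => X p i * (sum4 (fun m => partial i (f m) p * E m p k + f m p * partial i (fun q => E m q k) p)
     + sum4 (fun j => christoffel g k i j p * sum4 (fun m => f m p * E m p j))))).
  - unfold dir, sum4. ring.
  - intro i. f_equal. f_equal.
    apply has_partial_partial.
    apply has_partial_sum4 with (f := fun m q => f m q * E m q k). intro m.
    apply has_partial_mult with (f := f m) (g := fun q => E m q k); apply ex_has_partial; auto.
Qed.

Section Frame.
Variable V : pt -> Prop.
Hypothesis HV : open V.
Variable th : ix -> oneform.
Variable E : ix -> vfield.
Let g := metric_of th.
Hypothesis th_smooth : forall k, smooth_vec_on V (th k).
Hypothesis E_smooth : forall k, smooth_vec_on V (E k).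
Hypothesis th_det : forall p, V p -> det4 (fun i j => th i p j) <> 0.
Hypothesis dual : forall p, V p -> forall i j, eval1 (th i) (E j) p = kron i j.

Lemma metric_of_sym p i j : metric_of th p i j = metric_of th p j i.
Proof. unfold metric_of, sum4. ring. Qed.

Lemma metric_of_smooth i j : smooth_on V (fun p => metric_of th p i j).
Proof.
  intro k. unfold metric_of.
  apply (Ck_sum4 V HV k (fun m p => th m p i * th m p j)). intro m. apply Ck_mult; auto; apply th_smooth.
Qed.

Lemma metric_of_det p : V p -> det4 (metric_of th p) <> 0.
Proof.
  intro Vp.
  assert (K : det4 (metric_of th p) = det4 (fun i j => th i p j) ^ 2).
  { transitivity (det4 (fun i j => sum4 (fun k => th k p i * th k p j))); [reflexivity|].
    rewrite (det4_mul (fun i k => th k p i) (fun k j => th k p j)).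
    replace (det4 (fun i k => th k p i)) with (det4 (fun i j => th i p j)); [ring|].
    rewrite !det4_expand. ring. }
  rewrite K. apply pow_nonzero, th_det, Vp.
Qed.

Lemma gprod_metric_of X Y p : gprod g X Y p = sum4 (fun k => eval1 (th k) X p * eval1 (th k) Y p).
Proof. unfold gprod, g, metric_of, eval1, sum4. ring. Qed.

(** Duality makes E a one-sided inverse of the coframe matrix; multiplication by [inv4] identifies
    the two, and [inv4] is inverse on the other side as well. *)
Lemma codual p : V p -> forall i j, sum4 (fun k => E k p i * th k p j) = kron i j.
Proof.
  intro Vp. pose proof (th_det p Vp) as Hd. set (m := fun i j => th i p j) in *.
  assert (HE : forall k i, E k p i = inv4 m i k).
  { intros k i.
    transitivity (sum4 (fun j => kron i j * E k p j)); [rewrite sum4_kron_r; reflexivity|].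
    rewrite (sum4_ext _ (fun j => sum4 (fun n => inv4 m i n * m n j) * E k p j))
      by (intro; rewrite inv4_l; auto).
    transitivity (sum4 (fun n => inv4 m i n * eval1 (th n) (E k) p)).
    - unfold eval1, sum4, m. ring.
    - rewrite (sum4_ext _ (fun n => kron n k * inv4 m i n)).
      + apply sum4_kron_l.
      + intro n. rewrite dual by exact Vp. ring. }
  intros i j. rewrite <- (inv4_l m Hd i j). apply sum4_ext. intro k. rewrite HE. reflexivity.
Qed.

Lemma frame_expand X p i : V p -> X p i = sum4 (fun k => eval1 (th k) X p * E k p i).
Proof.
  intro Vp. transitivity (sum4 (fun j => kron i j * X p j)); [rewrite sum4_kron_r; reflexivity|].
  rewrite (sum4_ext _ (fun j => sum4 (fun k => E k p i * th k p j) * X p j))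
    by (intro; rewrite codual; auto).
  unfold eval1, sum4. ring.
Qed.

Lemma gprod_E_r X k p : V p -> gprod g X (E k) p = eval1 (th k) X p.
Proof.
  intro Vp. rewrite gprod_metric_of.
  rewrite (sum4_ext _ (fun n => kron n k * eval1 (th n) X p)).
  - apply sum4_kron_l.
  - intro n. rewrite dual by exact Vp. ring.
Qed.

Lemma gprod_sym X Y p : gprod g X Y p = gprod g Y X p.
Proof. rewrite !gprod_metric_of. unfold sum4. ring. Qed.

(* The structure functions of the frame: [E_a, E_b] = sum_k (c a b k) E_k. *)
Variable c : ix -> ix -> ix -> pt -> R.
Hypothesis structure : forall p, V p -> forall k i j,
  partial i (fun q => th k q j) p - partial j (fun q => th k q i) p
  = - sum4 (fun a => sum4 (fun b => c a b k p * th a p i * th b p j)).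

(** This is d theta(X, Y) = - theta([X, Y]) for fields on which theta is constant. Differentiating
    the constant theta_k(E_n) moves derivatives from the frame to the coframe, where [structure]
    applies. *)
Lemma eval1_bracket p a b k : V p -> eval1 (th k) (bracket (E a) (E b)) p = c a b k p.
Proof.
  intro Vp.
  assert (P : forall i n, sum4 (fun j => partial i (fun q => th k q j) p * E n p j)
            = - sum4 (fun j => th k p j * partial i (fun q => E n q j) p)).
  { intros i n.
    assert (Z : partial i (eval1 (th k) (E n)) p = 0).
    { rewrite (partial_ext_open V _ (fun _ => kron k n)) by auto.
      apply has_partial_partial, has_partial_const. }
    assert (Z' : partial i (eval1 (th k) (E n)) p
       = sum4 (fun j => partial i (fun q => th k q j) p * E n p j + th k p j * partial i (fun q => E n q j) p)).
    { apply has_partial_partial. unfold eval1.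
      apply has_partial_sum4 with (f := fun j q => th k q j * E n q j). intro j.
      apply has_partial_mult with (f := fun q => th k q j) (g := fun q => E n q j);
        eapply smooth_on_has_partial; try exact Vp; [apply th_smooth|apply E_smooth]. }
    rewrite Z in Z'. unfold sum4 in *. lra. }
  transitivity (sum4 (fun i => E a p i * sum4 (fun j => th k p j * partial i (fun q => E b q j) p))
              - sum4 (fun i => E b p i * sum4 (fun j => th k p j * partial i (fun q => E a q j) p))).
  { unfold eval1, bracket, dir, sum4. ring. }
  transitivity (- sum4 (fun i => sum4 (fun j =>
      (partial i (fun q => th k q j) p - partial j (fun q => th k q i) p) * E a p i * E b p j))).
  { rewrite (sum4_ext (fun i => E a p i * _) (fun i => - (E a p i * sum4 (fun j => partial i (fun q => th k q j) p * E b p j))))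
      by (intro; rewrite P; ring).
    rewrite (sum4_ext (fun i => E b p i * _) (fun i => - (E b p i * sum4 (fun j => partial i (fun q => th k q j) p * E a p j))))
      by (intro; rewrite P; ring).
    unfold sum4. ring. }
  rewrite (sum4_ext _ (fun i => sum4 (fun j => (- sum4 (fun a => sum4 (fun b => c a b k p * th a p i * th b p j))) * E a p i * E b p j)))
    by (intro; apply sum4_ext; intro; rewrite structure by exact Vp; reflexivity).
  transitivity (sum4 (fun a' => sum4 (fun b' => c a' b' k p * eval1 (th a') (E a) p * eval1 (th b') (E b) p))).
  { unfold eval1, sum4. ring. }
  rewrite (sum4_ext _ (fun a' => kron a' a * sum4 (fun b' => kron b' b * c a' b' k p))).
  { rewrite sum4_kron_l. rewrite sum4_kron_l. reflexivity. }
  intro a'. transitivity (sum4 (fun b' => kron a' a * (kron b' b * c a' b' k p))); [|unfold sum4; ring].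
  apply sum4_ext. intro b'. rewrite !dual by exact Vp. ring.
Qed.

(** Koszul's formula; its derivative terms vanish because the frame is orthonormal. *)
Definition conn (i j k : ix) (p : pt) : R := / 2 * (c i j k p - c j k i p + c k i j p).

(** Vanishing torsion ([S1]) and skew-symmetry in the last two indices ([S2]) determine the
    connection; [lra] performs the usual cyclic elimination. *)
Lemma gprod_nabla i j k p : V p -> gprod g (nabla g (E i) (E j)) (E k) p = conn i j k p.
Proof.
  intro Vp.
  set (n := fun i j k => eval1 (th k) (nabla g (E i) (E j)) p).
  assert (S1 : forall i j k, n i j k - n j i k = c i j k p).
  { intros a b d. unfold n. rewrite <- eval1_bracket by exact Vp.
    unfold eval1.
    rewrite (sum4_ext (fun i0 => th d p i0 * bracket (E a) (E b) p i0)
      (fun i0 => th d p i0 * (nabla g (E a) (E b) p i0 - nabla g (E b) (E a) p i0))).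
    - unfold sum4; ring.
    - intro. rewrite nabla_torsion by apply metric_of_sym. reflexivity. }
  assert (S2 : forall i j k, n i j k + n i k j = 0).
  { intros a b d.
    assert (Z : dir (E a) (gprod g (E b) (E d)) p = 0).
    { unfold dir. rewrite (sum4_ext _ (fun i => E a p i * 0)).
      - unfold sum4; ring.
      - intro i0. f_equal. rewrite (partial_ext_open V _ (fun _ => kron d b)); auto.
        + apply has_partial_partial, has_partial_const.
        + intros q Vq. rewrite gprod_E_r by exact Vq. apply dual; exact Vq. }
    rewrite (dir_gprod V) in Z; auto.
    - rewrite gprod_E_r in Z by exact Vp. rewrite gprod_sym, gprod_E_r in Z by exact Vp. exact Z.
    - apply metric_of_sym.
    - apply metric_of_smooth.
    - apply metric_of_det. }
  rewrite gprod_E_r by exact Vp. fold (n i j k). unfold conn.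
  rewrite <- !S1.
  pose proof (S2 i j k). pose proof (S2 j k i). pose proof (S2 k i j). lra.
Qed.

Lemma nabla_frame i j p l : V p ->
  nabla g (E i) (E j) p l = sum4 (fun k => conn i j k p * E k p l).
Proof.
  intro Vp. rewrite (frame_expand _ p l Vp). apply sum4_ext. intro k.
  rewrite <- gprod_E_r by exact Vp. rewrite gprod_nabla by exact Vp. reflexivity.
Qed.

Hypothesis c_smooth : forall a b k, smooth_on V (c a b k).

Definition curv_frame (i j k m : ix) (p : pt) : R :=
  dir (E i) (conn j k m) p - dir (E j) (conn i k m) p
  + sum4 (fun n => conn j k n p * conn i n m p - conn i k n p * conn j n m p - c i j n p * conn n k m p).

Lemma conn_smooth i j k : smooth_on V (conn i j k).
Proof.
  intro n. unfold conn. apply Ck_mult; auto; [apply Ck_const; auto|].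
  apply Ck_plus; auto; [apply Ck_minus; auto|]; apply c_smooth.
Qed.

Lemma curv_frame_eq i j k p l : V p ->
  curv g (E i) (E j) (E k) p l = sum4 (fun m => curv_frame i j k m p * E m p l).
Proof.
  intro Vp. unfold curv.
  assert (N : forall a b, nabla g (E a) (nabla g (E b) (E k)) p l
    = sum4 (fun m => dir (E a) (conn b k m) p * E m p l + conn b k m p * sum4 (fun n => conn a m n p * E n p l))).
  { intros a b.
    (* The inner derivative is a known frame combination on all of V, not only at p, so it can be
       differentiated once more. *)
    rewrite (nabla_ext_open V g (E a) _ (fun q j => sum4 (fun m => conn b k m q * E m q j))); auto.
    - rewrite nabla_frame_r.
      + apply sum4_ext. intro m. rewrite nabla_frame by exact Vp. reflexivity.
      + intros; eapply smooth_on_ex; [apply conn_smooth|exact Vp].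
      + intros; eapply smooth_on_ex; [apply E_smooth|exact Vp].
    - intros q Vq j0. apply nabla_frame, Vq. }
  rewrite !N.
  rewrite (nabla_frame_l g (fun m => c i j m p) E).
  - rewrite (sum4_ext (fun m => c i j m p * nabla _ _ _ _ _) (fun m => c i j m p * sum4 (fun n => conn m k n p * E n p l)))
      by (intro; rewrite nabla_frame by exact Vp; reflexivity).
    unfold curv_frame, sum4. ring.
  - intro i0. rewrite (frame_expand _ p i0 Vp). apply sum4_ext. intro m.
    rewrite eval1_bracket by exact Vp. reflexivity.
Qed.

Lemma Rm_frame i j k m p : V p -> Rm g (E i) (E j) (E k) (E m) p = curv_frame i j k m p.
Proof.
  intro Vp. unfold Rm. rewrite gprod_E_r by exact Vp. unfold eval1.
  rewrite (sum4_ext _ (fun l => th m p l * sum4 (fun n => curv_frame i j k n p * E n p l)))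
    by (intro; rewrite curv_frame_eq by exact Vp; reflexivity).
  transitivity (sum4 (fun n => eval1 (th m) (E n) p * curv_frame i j k n p)).
  - unfold eval1, sum4; ring.
  - rewrite (sum4_ext _ (fun n => kron m n * curv_frame i j k n p)) by (intro; rewrite dual by exact Vp; reflexivity).
    apply sum4_kron_r.
Qed.

End Frame.

(** * The curvature is a tensor *)

Lemma upd_comm (p : pt) i j s t : i <> j -> upd (upd p i s) j t = upd (upd p j t) i s.
Proof.
  intro H. apply functional_extensionality; intro k. unfold upd.
  destruct i, j, k; simpl; congruence.
Qed.

Lemma upd_other (p : pt) i j s : i <> j -> upd p i s j = p j.
Proof. intro H. unfold upd. destruct i, j; simpl; congruence. Qed.

(** Restriction to the plane through p in the directions i and j reduces this to the two-variable
    theorem of Schwarz. *)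
Lemma partial_comm V f i j p : open V -> Ck 2 V f -> V p ->
  partial i (partial j f) p = partial j (partial i f) p.
Proof.
  intros HV Hf Vp.
  assert (D : i = j \/ i <> j) by (destruct i, j; (left; reflexivity) || (right; discriminate)).
  destruct D as [->|N]; [reflexivity|].
  assert (N' : j <> i) by congruence.
  set (P := fun u v => upd (upd p i u) j v).
  set (F := fun u v => f (P u v)).
  assert (Pi : forall u v, P u v i = u) by (intros; unfold P; rewrite upd_other, upd_same; auto).
  assert (Pj : forall u v, P u v j = v) by (intros; unfold P; apply upd_same).
  assert (Ui : forall u v z, upd (P u v) i z = P z v)
    by (intros; unfold P; rewrite <- upd_comm, upd_upd; auto).
  assert (Uj : forall u v z, upd (P u v) j z = P u z) by (intros; unfold P; apply upd_upd).
  assert (Dx : forall h u v, Derive (fun z => h (P z v)) u = partial i h (P u v)).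
  { intros. unfold partial. rewrite Pi. apply Derive_ext. intro; rewrite Ui; reflexivity. }
  assert (Dy : forall h u v, Derive (fun z => h (P u z)) v = partial j h (P u v)).
  { intros. unfold partial. rewrite Pj. apply Derive_ext. intro; rewrite Uj; reflexivity. }
  assert (Ex : forall h u v, ex_partial i h (P u v) -> ex_derive (fun z => h (P z v)) u).
  { intros h u v K. unfold ex_partial in K. rewrite Pi in K. revert K. apply ex_derive_ext.
    intro; rewrite Ui; reflexivity. }
  assert (Ey : forall h u v, ex_partial j h (P u v) -> ex_derive (fun z => h (P u z)) v).
  { intros h u v K. unfold ex_partial in K. rewrite Pj in K. revert K. apply ex_derive_ext.
    intro; rewrite Uj; reflexivity. }
  assert (P0 : P (p i) (p j) = p) by (unfold P; rewrite upd_id, upd_id; reflexivity).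
  destruct (proj1 (open_box_iff V) HV p Vp) as [r [Hr HB]].
  assert (Bx : forall u v d, Rabs (u - p i) < d -> Rabs (v - p j) < d -> box p d (P u v)).
  { intros u v d Hu Hv. unfold P. apply box_upd; [|exact Hv]. apply box_upd_center, Hu. }
  assert (C2 : forall h, continuous h p -> continuity_2d_pt (fun u v => h (P u v)) (p i) (p j)).
  { intros h K e. destruct (proj1 (continuous_box_iff h p) K e (cond_pos e)) as [d [Hd H]].
    exists (mkposreal d Hd). intros u v Hu Hv. rewrite P0. apply H, Bx; assumption. }
  pose proof (Schwarz F (p i) (p j)) as S.
  assert (E1 : forall u v, Derive (fun z => Derive (fun t => F z t) v) u = partial i (partial j f) (P u v)).
  { intros u v. rewrite <- Dx. apply Derive_ext. intro z. apply (Dy f). }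
  assert (E2 : forall u v, Derive (fun z => Derive (fun t => F t z) u) v = partial j (partial i f) (P u v)).
  { intros u v. rewrite <- Dy. apply Derive_ext. intro z. apply (Dx f). }
  rewrite E1, E2, P0 in S. apply S.
  - exists (mkposreal r Hr). intros u v Hu Hv.
    assert (VP : V (P u v)) by (apply HB, Bx; assumption).
    repeat split.
    + apply (Ex f). eapply Ck_ex_partial; [exact Hf|exact VP].
    + apply (Ey f). eapply Ck_ex_partial; [exact Hf|exact VP].
    + apply ex_derive_ext with (fun z => partial j f (P z v)); [intro; symmetry; apply (Dy f)|].
      apply Ex. eapply Ck_ex_partial; [apply Ck_partial, Hf|exact VP].
    + apply ex_derive_ext with (fun z => partial i f (P u z)); [intro; symmetry; apply (Dx f)|].
      apply Ey. eapply Ck_ex_partial; [apply Ck_partial, Hf|exact VP].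
  - eapply continuity_2d_pt_ext; [intros; symmetry; apply E1|]. apply C2.
    eapply Ck_continuous; [apply Ck_partial, Ck_partial, Hf|exact Vp].
  - eapply continuity_2d_pt_ext; [intros; symmetry; apply E2|]. apply C2.
    eapply Ck_continuous; [apply Ck_partial, Ck_partial, Hf|exact Vp].
Qed.

Section Tensor.
Variable V : pt -> Prop.
Hypothesis HV : open V.
Variable g : metric.
Hypothesis Gam_smooth : forall k i j, smooth_on V (christoffel g k i j).

Definition curv_coord (i j l k : ix) (p : pt) : R :=
  partial i (christoffel g k j l) p - partial j (christoffel g k i l) p
  + sum4 (fun m => christoffel g k i m p * christoffel g m j l p - christoffel g k j m p * christoffel g m i l p).

Lemma smooth_cov i Z k : smooth_vec_on V Z -> smooth_on V (fun p => cov g i Z p k).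
Proof.
  intros HZ n. unfold cov. apply Ck_plus; auto; [apply smooth_on_partial, HZ|].
  apply (Ck_sum4 V HV n (fun j p => christoffel g k i j p * Z p j)). intro j.
  apply Ck_mult; auto; [apply Gam_smooth|apply HZ].
Qed.

(** The Ricci identity: second derivatives of Z cancel by [partial_comm], and the terms with first
    derivatives are symmetric in i and j, so only the value of Z is left. *)
Lemma cov_cov i j Z p k : V p -> smooth_vec_on V Z ->
  cov g i (cov g j Z) p k - cov g j (cov g i Z) p k = sum4 (fun l => Z p l * curv_coord i j l k p).
Proof.
  intros Vp HZ.
  assert (H : forall a b, cov g a (cov g b Z) p k =
    partial a (partial b (fun q => Z q k)) p
    + sum4 (fun l => partial a (christoffel g k b l) p * Z p l + christoffel g k b l p * partial a (fun q => Z q l) p)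
    + sum4 (fun m => christoffel g k a m p * cov g b Z p m)).
  { intros a b. unfold cov at 1. f_equal. apply has_partial_partial. unfold cov.
    apply has_partial_plus.
    - apply (smooth_on_has_partial V); auto. apply smooth_on_partial, HZ.
    - apply has_partial_sum4 with (f := fun l q => christoffel g k b l q * Z q l). intro l.
      apply has_partial_mult with (g := fun q => Z q l); eapply smooth_on_has_partial; try exact Vp;
        [apply Gam_smooth|apply HZ]. }
  rewrite !H. rewrite (partial_comm V _ i j p HV (HZ k 2%nat) Vp).
  unfold cov, curv_coord, sum4. ring.
Qed.

(** The derivatives of X and Y contribute exactly the derivative of Z along [X, Y], which the last
    term of [curv] removes. *)
Lemma curv_coord_eq X Y Z p k : V p ->
  smooth_vec_on V X -> smooth_vec_on V Y -> smooth_vec_on V Z ->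
  curv g X Y Z p k
  = sum4 (fun i => X p i * sum4 (fun j => Y p j * sum4 (fun l => Z p l * curv_coord i j l k p))).
Proof.
  intros Vp HX HY HZ.
  assert (H : forall X Y, smooth_vec_on V Y -> nabla g X (nabla g Y Z) p k
    = sum4 (fun i => X p i * sum4 (fun j => partial i (fun q => Y q j) p * cov g j Z p k + Y p j * cov g i (cov g j Z) p k))).
  { clear X Y HX HY. intros X Y HY. rewrite nabla_cov. apply sum4_ext. intro i. f_equal.
    unfold cov at 1.
    rewrite (partial_ext_open V _ (fun q => sum4 (fun j => Y q j * cov g j Z q k))); auto using nabla_cov.
    rewrite (has_partial_partial i _ p (sum4 (fun j => partial i (fun q => Y q j) p * cov g j Z p k
       + Y p j * partial i (fun q => cov g j Z q k) p))).
    - rewrite (sum4_ext (fun j => christoffel g k i j p * _)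
         (fun j => christoffel g k i j p * sum4 (fun n => Y p n * cov g n Z p j))) by (intro; rewrite nabla_cov; reflexivity).
      rewrite (sum4_ext (fun j => _ + Y p j * cov g i (cov g j Z) p k) (fun j => partial i (fun q => Y q j) p * cov g j Z p k
        + Y p j * (partial i (fun q => cov g j Z q k) p + sum4 (fun n => christoffel g k i n p * cov g j Z p n))))
        by (intro; reflexivity).
      generalize (fun j => cov g j Z p) (fun j => partial i (fun q => cov g j Z q k) p). intros. unfold sum4. ring.
    - apply has_partial_sum4 with (f := fun j q => Y q j * cov g j Z q k). intro j.
      apply has_partial_mult with (f := fun q => Y q j) (g := fun q => cov g j Z q k);
        eapply smooth_on_has_partial; try exact Vp; [apply HY|apply smooth_cov, HZ]. }
  unfold curv. rewrite (H X Y HY), (H Y X HX), nabla_cov.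
  rewrite (sum4_ext (fun i => bracket X Y p i * _) (fun i => (dir X (fun q => Y q i) p - dir Y (fun q => X q i) p) * cov g i Z p k))
    by (intro; reflexivity).
  transitivity (sum4 (fun i => X p i * sum4 (fun j => Y p j * (cov g i (cov g j Z) p k - cov g j (cov g i Z) p k)))).
  - unfold dir, sum4. ring.
  - apply sum4_ext; intro i; f_equal. apply sum4_ext; intro j; f_equal. apply cov_cov; auto.
Qed.

(** Only the values of the fields at p matter, which is how unit fields unrelated to the frame
    become accessible in the definition of a space form. *)
Lemma curv_expand (E : ix -> vfield) X Y Z p k (x y z : ix -> R) : V p ->
  (forall a, smooth_vec_on V (E a)) ->
  smooth_vec_on V X -> smooth_vec_on V Y -> smooth_vec_on V Z ->
  (forall i, X p i = sum4 (fun a => x a * E a p i)) ->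
  (forall i, Y p i = sum4 (fun a => y a * E a p i)) ->
  (forall i, Z p i = sum4 (fun a => z a * E a p i)) ->
  curv g X Y Z p k
  = sum4 (fun a => x a * sum4 (fun b => y b * sum4 (fun c => z c * curv g (E a) (E b) (E c) p k))).
Proof.
  intros Vp HE HX HY HZ Ex Ey Ez.
  assert (L : forall (w : ix -> R) (W : vec) (T : ix -> R),
    (forall i, W i = sum4 (fun a => w a * E a p i)) ->
    sum4 (fun i => W i * T i) = sum4 (fun a => w a * sum4 (fun i => E a p i * T i))).
  { intros w W T HW. rewrite (sum4_ext _ (fun i => sum4 (fun a => w a * E a p i) * T i)) by (intro; rewrite HW; reflexivity).
    unfold sum4. ring. }
  rewrite curv_coord_eq by auto.
  rewrite (L x) by exact Ex. apply sum4_ext; intro a; f_equal.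
  transitivity (sum4 (fun i => E a p i * sum4 (fun b => y b * sum4 (fun j => E b p j * sum4 (fun l => Z p l * curv_coord i j l k p))))).
  { apply sum4_ext; intro i; f_equal. apply (L y), Ey. }
  transitivity (sum4 (fun b => y b * sum4 (fun i => E a p i * sum4 (fun j => E b p j * sum4 (fun l => Z p l * curv_coord i j l k p))))).
  { unfold sum4; ring. }
  apply sum4_ext; intro b; f_equal.
  transitivity (sum4 (fun i => E a p i * sum4 (fun j => E b p j * sum4 (fun c => z c * sum4 (fun l => E c p l * curv_coord i j l k p))))).
  { apply sum4_ext; intro i; f_equal. apply sum4_ext; intro j; f_equal. apply (L z), Ez. }
  transitivity (sum4 (fun c => z c * sum4 (fun i => E a p i * sum4 (fun j => E b p j * sum4 (fun l => E c p l * curv_coord i j l k p))))).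
  { unfold sum4; ring. }
  apply sum4_ext; intro c; f_equal. symmetry. apply curv_coord_eq; auto.
Qed.

End Tensor.

(** * The curvature of the metric *)

(* The structure functions of the frame, linear in
   u = (a k, a (k + 1/k), m B, m A, a k B + q, a k A + p), where k = coth (a z), m = a (k - 1/k)
   and (p, q) are the first two frame components of d(ln h). *)
Definition ctab (u1 u2 u3 u4 u5 u6 : R) (i j k : ix) : R :=
  match i, j, k with
  | i4, i1, i1 => - u1 | i1, i4, i1 => u1
  | i1, i2, i1 => u5 | i2, i1, i1 => - u5
  | i4, i2, i2 => - u1 | i2, i4, i2 => u1
  | i1, i2, i2 => - u6 | i2, i1, i2 => u6
  | i4, i3, i3 => - u2 | i3, i4, i3 => u2
  | i4, i1, i3 => u3 | i1, i4, i3 => - u3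
  | i4, i2, i3 => - u4 | i2, i4, i3 => u4
  | i1, i2, i3 => - 2 * u1 | i2, i1, i3 => 2 * u1
  | i3, i1, i4 => - u3 | i1, i3, i4 => u3
  | i3, i2, i4 => u4 | i2, i3, i4 => - u4
  | _, _, _ => 0
  end.

Definition gtab (u1 u2 u3 u4 u5 u6 : R) (i j k : ix) : R :=
  / 2 * (ctab u1 u2 u3 u4 u5 u6 i j k - ctab u1 u2 u3 u4 u5 u6 j k i + ctab u1 u2 u3 u4 u5 u6 k i j).

Definition omega_bar (i j : ix) : R :=
  match i, j with i1, i2 => 1 | i2, i1 => -1 | i3, i4 => -1 | i4, i3 => 1 | _, _ => 0 end.

Definition omega_perp (i j : ix) : R :=
  match i, j with i1, i2 => 1 | i2, i1 => -1 | _, _ => 0 end.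

(* The curvature tensor of constant holomorphic sectional curvature -4a^2,
   corrected by w on the plane spanned by E_1, E_2. *)
Definition rtab (a w : R) (i j k l : ix) : R :=
  - a ^ 2 * (kron j k * kron i l - kron i k * kron j l
             + omega_bar j k * omega_bar i l - omega_bar i k * omega_bar j l
             - 2 * omega_bar i j * omega_bar k l)
  + w * omega_perp i j * omega_perp k l.

Section Algebra.
Variables a k A B p q X1 X2 L e1p e1q e2p : R.
Hypothesis k0 : k <> 0.

Let m := a * (k - / k).
Let P := a * k * B + q.
Let Q := a * k * A + p.
Let dz i := match i with i1 => A | i2 => B | i3 => 0 | i4 => 1 end.
Let dk i := a * (1 - k ^ 2) * dz i.
Let dA i := match i with
  | i1 => X1 - A * p - a * k * A ^ 2 + a * (k + / k) * B ^ 2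
  | i2 => X2 - A * q - a * k * A * B - a * (k + / k) * A * B
  | i3 => - m * B | i4 => - a * k * A end.
Let dB i := match i with
  | i1 => X2 - B * p - a * k * A * B - a * (k + / k) * A * B
  | i2 => - X1 - B * q - a * k * B ^ 2 + a * (k + / k) * A ^ 2
  | i3 => m * A | i4 => - a * k * B end.
Let dp i := match i with i1 => e1p | i2 => e2p | i3 => 0 | i4 => - a * k * p end.
Let dq i := match i with i1 => e1q
  | i2 => L - p ^ 2 - q ^ 2 - a * k * (A * p + B * q) - e1p | i3 => 0 | i4 => - a * k * q end.
Let dm i := a * (1 + / k ^ 2) * dk i.

Let C := ctab (a * k) (a * (k + / k)) (m * B) (m * A) P Q.
Let G := gtab (a * k) (a * (k + / k)) (m * B) (m * A) P Q.
Let dG i := gtab (a * dk i) (a * (1 - / k ^ 2) * dk i) (dm i * B + m * dB i) (dm i * A + m * dA i)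
   (a * dk i * B + a * k * dB i + dq i) (a * dk i * A + a * k * dA i + dp i).

(** The local definitions list frame derivatives: [dz i] is E_i(z), [dk] uses coth' = 1 - coth^2,
    [dA] to [dq] concern the other functions, and [dG] follows by linearity of [gtab]. L stands for
    Delta ln h / (h sinh(az))^2. The remaining derivatives X1, X2, e1p, e1q and e2p are free: the
    identity holds for all their values, since second derivatives of h reach the curvature only
    through e1p + [dq i2], where L replaces them. *)
Lemma curv_algebra i j l n :
  dG i j l n - dG j i l n
  + sum4 (fun r => G j l r * G i r n - G i l r * G j r n - C i j r * G r l n)
  = rtab a (4 * a ^ 2 * (k ^ 2 - 1) + 2 * a ^ 2 * (A ^ 2 + B ^ 2) + L) i j l n.
Proof.
  unfold rtab, kron, sum4.
  destruct i, j, l, n; unfold dG, G, C, gtab, dA, dB, dp, dq, dm, dk, dz, m, P, Q; cbn; field; exact k0.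
Qed.
End Algebra.

(** * Functions of two variables and syntax-directed differentiation *)

Definition ddx (f : R -> R -> R) (x y : R) : R := Derive (fun z => f z y) x.
Definition ddy (f : R -> R -> R) (x y : R) : R := Derive (fun z => f x z) y.

Definition smooth2 (U : R * R -> Prop) (f : R -> R -> R) :=
  forall x y, U (x, y) -> forall n, ex_diff_n f n x y.

Lemma smooth2_ddx U f : smooth2 U f -> smooth2 U (ddx f).
Proof. intros Hf x y Uxy n. apply (Hf x y Uxy (S n)). Qed.

Lemma smooth2_ddy U f : smooth2 U f -> smooth2 U (ddy f).
Proof. intros Hf x y Uxy n. apply (Hf x y Uxy (S n)). Qed.

Lemma smooth2_ex1 U f x y : smooth2 U f -> U (x, y) -> ex_derive (fun z => f z y) x.
Proof. intros Hf Uxy. apply (Hf x y Uxy 1%nat). Qed.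

Lemma smooth2_ex2 U f x y : smooth2 U f -> U (x, y) -> ex_derive (fun z => f x z) y.
Proof. intros Hf Uxy. apply (Hf x y Uxy 1%nat). Qed.

Lemma has_partial_lift2 U f i p : smooth2 U f -> U (p i1, p i2) ->
  has_partial i (lift2 f) p
    (match i with i1 => lift2 (ddx f) p | i2 => lift2 (ddy f) p | _ => 0 end).
Proof.
  intros Hf Up. destruct i; unfold has_partial, lift2, upd; simpl.
  - apply Derive_correct. apply (smooth2_ex1 U f); auto.
  - apply Derive_correct. apply (smooth2_ex2 U f); auto.
  - exact (@is_derive_const R_AbsRing R_NormedModule (f (p i1) (p i2)) (p i3)).
  - exact (@is_derive_const R_AbsRing R_NormedModule (f (p i1) (p i2)) (p i4)).
Qed.

Lemma has_partial_sin i f p l : has_partial i f p l -> has_partial i (fun q => sin (f q)) p (l * cos (f p)).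
Proof. apply has_partial_comp, is_derive_sin. Qed.
Lemma has_partial_cos i f p l : has_partial i f p l -> has_partial i (fun q => cos (f q)) p (l * - sin (f p)).
Proof. apply has_partial_comp, is_derive_cos. Qed.
Lemma has_partial_sinh i f p l : has_partial i f p l -> has_partial i (fun q => sinh (f q)) p (l * cosh (f p)).
Proof. apply has_partial_comp, is_derive_sinh. Qed.
Lemma has_partial_cosh i f p l : has_partial i f p l -> has_partial i (fun q => cosh (f q)) p (l * sinh (f p)).
Proof. apply has_partial_comp, is_derive_cosh. Qed.
Lemma has_partial_div i f g p l m :
  g p <> 0 -> has_partial i f p l -> has_partial i g p m ->
  has_partial i (fun q => f q / g q) p (l * / g p + f p * (- m / g p ^ 2)).
Proof. intros Hg Hf Hm. apply has_partial_mult; [exact Hf|]. apply has_partial_inv; assumption. Qed.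

Ltac nz :=
  repeat lazymatch goal with |- _ * _ <> 0 => apply Rmult_neq_0 end; assumption.

(** The derivative is an evar filled in by the rules; only the nonvanishing of denominators is left
    to prove. *)
Ltac hp :=
  lazymatch goal with
  | |- has_partial _ (fun _ => ?c) _ _ => apply has_partial_const
  | |- has_partial _ (fun q => lift2 ?f q) _ _ => change (fun q => lift2 f q) with (lift2 f); hp
  | |- has_partial _ (fun q => q _) _ _ => apply has_partial_coord
  | |- has_partial _ (fun q => - _) _ _ => eapply has_partial_opp; hp
  | |- has_partial _ (fun q => _ + _) _ _ => eapply has_partial_plus; hp
  | |- has_partial _ (fun q => _ - _) _ _ => eapply has_partial_minus; hp
  | |- has_partial _ (fun q => _ * _) _ _ => eapply has_partial_mult; hp
  | |- has_partial _ (fun q => _ / _) _ _ => eapply has_partial_div; [|hp|hp]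
  | |- has_partial _ (fun q => / _) _ _ => eapply has_partial_inv; [|hp]
  | |- has_partial _ (fun q => sin _) _ _ => eapply has_partial_sin; hp
  | |- has_partial _ (fun q => cos _) _ _ => eapply has_partial_cos; hp
  | |- has_partial _ (fun q => sinh _) _ _ => eapply has_partial_sinh; hp
  | |- has_partial _ (fun q => cosh _) _ _ => eapply has_partial_cosh; hp
  | |- has_partial _ (lift2 _) _ _ => eapply has_partial_lift2; [eassumption|assumption]
  | |- _ => idtac
  end.

Lemma cosh_sq x : cosh x ^ 2 = 1 + sinh x ^ 2.
Proof.
  unfold cosh, sinh. assert (exp x * exp (- x) = 1) by (rewrite <- exp_plus, Rplus_opp_r; apply exp_0).
  nra.
Qed.

Lemma sinh_double x : sinh (2 * x) = 2 * sinh x * cosh x.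
Proof.
  unfold cosh, sinh. replace (2 * x) with (x + x) by ring.
  rewrite Ropp_plus_distr, !exp_plus. field.
Qed.

Lemma cosh_double x : cosh (2 * x) = 1 + 2 * sinh x ^ 2.
Proof.
  unfold cosh, sinh. replace (2 * x) with (x + x) by ring.
  rewrite Ropp_plus_distr, !exp_plus.
  assert (exp x * exp (- x) = 1) by (rewrite <- exp_plus, Rplus_opp_r; apply exp_0).
  nra.
Qed.

Lemma sinh_neq_0 x : x <> 0 -> sinh x <> 0.
Proof.
  intro Hx. destruct (Rdichotomy _ _ Hx) as [K|K].
  - pose proof (sinh_lt _ _ K) as K'. rewrite sinh_0 in K'. lra.
  - pose proof (sinh_lt _ _ K) as K'. rewrite sinh_0 in K'. lra.
Qed.

Lemma cosh_pos x : 0 < cosh x.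
Proof. unfold cosh. pose proof (exp_pos x). pose proof (exp_pos (- x)). lra. Qed.

Lemma cos_sq x : cos x ^ 2 = 1 - sin x ^ 2.
Proof. pose proof (sin2_cos2 x). unfold Rsqr in *. nra. Qed.

(** * Derivatives and Laplacian of a logarithm *)

Section LogDerivatives.
Variables (U : R * R -> Prop) (f : R -> R -> R).
Hypothesis HU : open U.
Hypothesis f_pos : forall x y, U (x, y) -> 0 < f x y.
Hypothesis f_smooth : smooth2 U f.

Lemma open_slice1 x y : U (x, y) -> locally x (fun z => U (z, y)).
Proof.
  intro Uxy. destruct (HU _ Uxy) as [r Hr]. exists r. intros z Hz. apply Hr. split; [exact Hz|apply ball_center].
Qed.

Lemma open_slice2 x y : U (x, y) -> locally y (fun z => U (x, z)).
Proof.
  intro Uxy. destruct (HU _ Uxy) as [r Hr]. exists r. intros z Hz. apply Hr. split; [apply ball_center|exact Hz].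
Qed.

Lemma ddx_ln x y : U (x, y) -> Derive (fun z => ln (f z y)) x = ddx f x y / f x y.
Proof.
  intro Uxy. apply is_derive_unique. pose proof (f_pos x y Uxy).
  pose proof (smooth2_ex1 U f x y f_smooth Uxy).
  auto_derive; [auto|]. unfold ddx. field. lra.
Qed.

Lemma ddy_ln x y : U (x, y) -> Derive (fun z => ln (f x z)) y = ddy f x y / f x y.
Proof.
  intro Uxy. apply is_derive_unique. pose proof (f_pos x y Uxy).
  pose proof (smooth2_ex2 U f x y f_smooth Uxy).
  auto_derive; [auto|]. unfold ddy. field. lra.
Qed.

Lemma laplacian_ln x y : U (x, y) -> laplacian (fun u v => ln (f u v)) x y
  = (ddx (ddx f) x y + ddy (ddy f) x y) / f x y - (ddx f x y ^ 2 + ddy f x y ^ 2) / f x y ^ 2.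
Proof.
  intro Uxy. unfold laplacian, partial_derive, Derive_n.
  rewrite (Derive_ext_loc (fun x0 => Derive (fun x1 => ln (f x1 y)) x0) (fun z : R => ddx f z y / f z y)).
  2:{ generalize (open_slice1 x y Uxy). apply filter_imp. intros z Hz. apply ddx_ln, Hz. }
  rewrite (Derive_ext_loc (fun x0 => Derive (fun z => ln (f x z)) x0) (fun z : R => ddy f x z / f x z)).
  2:{ generalize (open_slice2 x y Uxy). apply filter_imp. intros z Hz. apply ddy_ln, Hz. }
  pose proof (f_pos x y Uxy) as P.
  pose proof (smooth2_ex1 U f x y f_smooth Uxy) as X1.
  pose proof (smooth2_ex2 U f x y f_smooth Uxy) as X2.
  pose proof (smooth2_ex1 U (ddx f) x y (smooth2_ddx U f f_smooth) Uxy) as X11.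
  pose proof (smooth2_ex2 U (ddy f) x y (smooth2_ddy U f f_smooth) Uxy) as X22.
  rewrite (is_derive_unique (fun z : R => ddx f z y / f z y) x
     ((ddx (ddx f) x y * f x y - ddx f x y * ddx f x y) / f x y ^ 2)).
  2:{ apply (is_derive_div (fun z : R => ddx f z y) (fun z : R => f z y) x (ddx (ddx f) x y) (ddx f x y)); try lra;
      [exact (Derive_correct _ _ X11)|exact (Derive_correct _ _ X1)]. }
  rewrite (is_derive_unique (fun z : R => ddy f x z / f x z) y
     ((ddy (ddy f) x y * f x y - ddy f x y * ddy f x y) / f x y ^ 2)).
  2:{ apply (is_derive_div (fun z : R => ddy f x z) (fun z : R => f x z) y (ddy (ddy f) x y) (ddy f x y)); try lra;
      [exact (Derive_correct _ _ X22)|exact (Derive_correct _ _ X2)]. }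
  field. lra.
Qed.
End LogDerivatives.

Lemma partial_sub_eq i j f g p l m r :
  has_partial i f p l -> has_partial j g p m -> l - m = r -> partial i f p - partial j g p = r.
Proof. intros Hf Hg <-. rewrite (has_partial_partial _ _ _ _ Hf), (has_partial_partial _ _ _ _ Hg). reflexivity. Qed.

(** * The coframe, its dual frame and the structure equations *)

Section Geometry.
Variables (a : R) (ha : a <> 0) (U : R * R -> Prop) (U_open : open U) (h H : R -> R -> R).
Hypothesis h_pos : forall x y, U (x, y) -> 0 < h x y.
Hypothesis H_pos : forall x y, U (x, y) -> 0 < H x y.
Hypothesis h_smooth : smooth2 U h.
Hypothesis H_smooth : smooth2 U H.
Hypothesis H_eq : forall x y, U (x, y) ->
  laplacian (fun u v => ln (H u v)) x y = 2 * a ^ 2 * h x y ^ 2 + 4 * a ^ 2 * H x y ^ 2.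

Let M := domM U.

Let H1_smooth : smooth2 U (ddx H) := smooth2_ddx U H H_smooth.
Let H2_smooth : smooth2 U (ddy H) := smooth2_ddy U H H_smooth.
Let h1_smooth : smooth2 U (ddx h) := smooth2_ddx U h h_smooth.
Let h2_smooth : smooth2 U (ddy h) := smooth2_ddy U h h_smooth.

Definition sn (p : pt) := sin (2 * a * p i4).
Definition cs (p : pt) := cos (2 * a * p i4).
Definition sh (p : pt) := sinh (a * p i3).
Definition ch (p : pt) := cosh (a * p i3).

(* The coframe, with logarithmic derivatives and double arguments expanded. *)
Definition coframe' (i : ix) : oneform := fun p =>
  match i with
  | i1 => covec (sh p * lift2 h p) 0 0 0
  | i2 => covec 0 (sh p * lift2 h p) 0 0
  | i3 => covec
      (sn p * (1 + 2 * (sh p * sh p)) * lift2 H p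
        - 2 * sh p * ch p * (/ (2 * a) * (lift2 (ddy H) p / lift2 H p)))
      (- (cs p * (1 + 2 * (sh p * sh p)) * lift2 H p
        - 2 * sh p * ch p * (/ (2 * a) * (lift2 (ddx H) p / lift2 H p))))
      0 (2 * sh p * ch p)
  | i4 => covec (- (cs p * lift2 H p)) (- (sn p * lift2 H p)) 1 0
  end.

Lemma coframe_eq p : M p -> forall i j, coframe a h H i p j = coframe' i p j.
Proof.
  intros [Up Np] i j. destruct i, j; cbn; try reflexivity.
  - unfold l2, partial_derive, Derive_n. rewrite (ddy_ln U H) by auto.
    replace (2 * a * p i3) with (2 * (a * p i3)) by ring.
    rewrite cosh_double, sinh_double. unfold sn, sh, ch, lift2. ring.
  - unfold n2, partial_derive, Derive_n. rewrite (ddx_ln U H) by auto.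
    replace (2 * a * p i3) with (2 * (a * p i3)) by ring.
    rewrite cosh_double, sinh_double. unfold cs, sh, ch, lift2. field.
    split; [apply Rgt_not_eq, H_pos, Up|exact ha].
  - replace (2 * a * p i3) with (2 * (a * p i3)) by ring. rewrite sinh_double. reflexivity.
Qed.

Lemma open_M : open M.
Proof. apply open_domM, U_open. Qed.

Lemma dom2_smooth_M f : smooth_on (dom2 U) f -> smooth_on M f.
Proof. intros Hf k. apply Ck_sub with (dom2 U); [|apply Hf]. intros p [Up _]; exact Up. Qed.

Lemma smooth_lift2 f : smooth2 U f -> smooth_on M (lift2 f).
Proof. intros Hf. apply dom2_smooth_M. intro k. apply Ck_lift2; auto. Qed.

Lemma sh_neq_0 p : M p -> sh p <> 0.
Proof. intros [_ Np]. apply sinh_neq_0. apply Rmult_neq_0; [exact ha|lra]. Qed.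

Lemma ch_neq_0 p : ch p <> 0.
Proof. apply Rgt_not_eq, cosh_pos. Qed.

Lemma ch_sq p : ch p ^ 2 = 1 + sh p ^ 2.
Proof. apply cosh_sq. Qed.

Lemma cs_sq p : cs p ^ 2 = 1 - sn p ^ 2.
Proof. apply cos_sq. Qed.

Lemma h_neq_0 p : M p -> lift2 h p <> 0.
Proof. intros [Up _]. apply Rgt_not_eq, h_pos, Up. Qed.

Lemma H_neq_0 p : M p -> lift2 H p <> 0.
Proof. intros [Up _]. apply Rgt_not_eq, H_pos, Up. Qed.

Lemma shh_neq_0 p : M p -> sh p * lift2 h p <> 0.
Proof. intro Mp. apply Rmult_neq_0; [apply sh_neq_0|apply h_neq_0]; exact Mp. Qed.

Ltac sm := repeat first
  [ apply open_M | apply smooth_lift2; assumption | ck_step; [apply open_M|..] | intros; apply H_neq_0; assumption ].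

Lemma coframe'_smooth i j : smooth_on M (fun p => coframe' i p j).
Proof.
  intro k. unfold coframe', sn, cs, sh, ch. destruct i, j; cbn -[Ck]; unfold Rdiv; sm.
Qed.

Lemma coframe'_det p : M p -> det4 (fun i j => coframe' i p j) <> 0.
Proof.
  intro Mp. rewrite det4_expand. cbn.
  replace (_ - _) with (- 2 * sh p ^ 3 * ch p * lift2 h p ^ 2) by ring.
  pose proof (sh_neq_0 p Mp) as H0. pose proof (ch_neq_0 p) as H1. pose proof (h_neq_0 p Mp) as H2.
  apply Rmult_neq_0; [|apply pow_nonzero, H2].
  apply Rmult_neq_0; [|exact H1].
  apply Rmult_neq_0; [|apply pow_nonzero, H0].
  apply Rlt_not_eq; lra.
Qed.

Definition kap (p : pt) := ch p / sh p.

Lemma kap_neq_0 p : M p -> kap p <> 0.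
Proof. intro Mp. apply Rmult_neq_0; [apply ch_neq_0|apply Rinv_neq_0_compat, sh_neq_0, Mp]. Qed.

(* H (cos(2at) dx + sin(2at) dy) = fA th_1 + fB th_2 and d(ln h) = fp0 th_1 + fq0 th_2. *)
Definition fA (p : pt) := lift2 H p * cs p / (sh p * lift2 h p).
Definition fB (p : pt) := lift2 H p * sn p / (sh p * lift2 h p).
Definition fp0 (p : pt) := lift2 (ddx h) p / (sh p * (lift2 h p * lift2 h p)).
Definition fq0 (p : pt) := lift2 (ddy h) p / (sh p * (lift2 h p * lift2 h p)).

(** At k = coth(az) this is 2a / sinh(2az), and [nK] is 2a coth(2az). Written through k alone, they
    bring in no denominator but k. *)
Definition mK (k : R) := a * (k - / k).
Definition nK (k : R) := a * (k + / k).

Definition sfun (i j k : ix) (p : pt) : R :=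
  ctab (a * kap p) (nK (kap p)) (mK (kap p) * fB p) (mK (kap p) * fA p)
       (a * kap p * fB p + fq0 p) (a * kap p * fA p + fp0 p) i j k.

Ltac refold p :=
  change (sinh (a * p i3)) with (sh p); change (cosh (a * p i3)) with (ch p);
  change (sin (2 * a * p i4)) with (sn p); change (cos (2 * a * p i4)) with (cs p).

Lemma structure' p : M p -> forall k i j,
  partial i (fun q => coframe' k q j) p - partial j (fun q => coframe' k q i) p
  = - sum4 (fun a => sum4 (fun b => sfun a b k p * coframe' a p i * coframe' b p j)).
Proof.
  intros Mp. pose proof (proj1 Mp) as Up.
  pose proof (sh_neq_0 p Mp) as S0. pose proof (ch_neq_0 p) as C0. pose proof (h_neq_0 p Mp) as h0. pose proof (H_neq_0 p Mp) as H0.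
  pose proof (ch_sq p) as E1. pose proof (cs_sq p) as E2.
  pose proof (H_eq _ _ Up) as E3. rewrite (laplacian_ln U H) in E3 by auto.
  set (H11 := lift2 (ddx (ddx H)) p).
  (* The equation for ln H solved for H_xx. Second derivatives of H arise only in the third form,
     from d(l2 dx + n2 dy), and there only as H_xx and H_yy. *)
  assert (E4 : H11 = (2 * a ^ 2 * lift2 h p ^ 2 + 4 * a ^ 2 * lift2 H p ^ 2) * lift2 H p - lift2 (ddy (ddy H)) p
    + (lift2 (ddx H) p ^ 2 + lift2 (ddy H) p ^ 2) / lift2 H p).
  { unfold H11, lift2 in *. rewrite <- E3. field. exact H0. }
  intros k i j. destruct (ix_eqb i j) eqn:Eij.
  { replace j with i by (destruct i, j; try discriminate; reflexivity).
    unfold sum4, sfun. destruct k; cbn -[partial coframe']; ring. }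
  destruct k, i, j; try discriminate; clear Eij; cbn -[partial sum4 lift2 sn cs sh ch sfun];
  (eapply partial_sub_eq; [unfold sn, cs, sh, ch, Rdiv; hp; exact H0 | unfold sn, cs, sh, ch, Rdiv; hp; exact H0 | ];
   cbn -[sum4 lift2 sinh cosh sin cos pow sfun]; refold p; fold H11; rewrite ?E4;
   unfold sum4, sfun; cbn; unfold mK, nK, kap, fA, fB, fp0, fq0;
   first [ring | field_simplify_eq [E1 E2]; [ring [E1 E2]|repeat split; auto]]).
Qed.

Lemma structure_coframe p : M p -> forall k i j,
  partial i (fun q => coframe a h H k q j) p - partial j (fun q => coframe a h H k q i) p
  = - sum4 (fun b => sum4 (fun c => sfun b c k p * coframe a h H b p i * coframe a h H c p j)).
Proof.
  intros Mp k i j.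
  rewrite !(partial_ext_open M (fun q => coframe a h H k q _) (fun q => coframe' k q _)) by (auto using open_M, coframe_eq).
  rewrite structure' by exact Mp. f_equal.
  apply sum4_ext; intro b; apply sum4_ext; intro c. rewrite !coframe_eq by exact Mp. reflexivity.
Qed.

Lemma coframe_smooth k : smooth_vec_on M (coframe a h H k).
Proof.
  intros i n. apply Ck_ext with (fun p => coframe' k p i); [apply open_M| |apply coframe'_smooth].
  intros p Mp. symmetry. apply coframe_eq, Mp.
Qed.

Lemma coframe_det p : M p -> det4 (fun i j => coframe a h H i p j) <> 0.
Proof.
  intro Mp. replace (fun i j => coframe a h H i p j) with (fun i j => coframe' i p j); [apply coframe'_det, Mp|].
  apply functional_extensionality; intro i; apply functional_extensionality; intro j.
  symmetry; apply coframe_eq, Mp.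
Qed.

(** The solution of the triangular duality relations. Every E dual to the coframe equals it, and the
    smoothness of E is read off from this formula. *)
Definition frame' (j : ix) : vfield := fun p i =>
  let x := kron i1 j / (sh p * lift2 h p) in
  let y := kron i2 j / (sh p * lift2 h p) in
  match i with
  | i1 => x
  | i2 => y
  | i3 => kron i4 j + cs p * lift2 H p * x + sn p * lift2 H p * y
  | i4 => (kron i3 j - coframe' i3 p i1 * x - coframe' i3 p i2 * y) / (2 * (sh p * ch p))
  end.

Variable E : ix -> vfield.
Hypothesis E_dual : forall p, M p -> forall i j, eval1 (coframe a h H i) (E j) p = kron i j.

Lemma frame_eq p : M p -> forall j i, E j p i = frame' j p i.
Proof.
  intros Mp j.
  pose proof (sh_neq_0 p Mp) as S0. pose proof (ch_neq_0 p) as C0. pose proof (h_neq_0 p Mp) as h0. pose proof (H_neq_0 p Mp) as H0.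
  assert (D : forall i, sum4 (fun n => coframe' i p n * E j p n) = kron i j).
  { intro i. rewrite <- (E_dual p Mp i j). apply sum4_ext; intro n. rewrite coframe_eq by exact Mp. reflexivity. }
  assert (Dx : E j p i1 = frame' j p i1).
  { generalize (D i1). unfold sum4, frame'; cbn. intros <-. field; auto. }
  assert (Dy : E j p i2 = frame' j p i2).
  { generalize (D i2). unfold sum4, frame'; cbn. intros <-. field; auto. }
  intros []; auto.
  - generalize (D i4). unfold sum4. rewrite Dx, Dy. unfold frame'; cbn. intros <-. field; auto.
  - generalize (D i3). unfold sum4. rewrite Dx, Dy. unfold frame'.
    set (c1 := coframe' i3 p i1). set (c2 := coframe' i3 p i2). cbn. intros <-. field; repeat split; auto.
Qed.

Lemma E_smooth k : smooth_vec_on M (E k).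
Proof.
  intros i n. apply Ck_ext with (fun p => frame' k p i); [apply open_M|intros p Mp; symmetry; apply frame_eq, Mp|].
  assert (N2 : forall p, M p -> 2 * (sh p * ch p) <> 0).
  { intros p Mp. apply Rmult_neq_0; [lra|].
    apply Rmult_neq_0; [apply sh_neq_0, Mp|apply ch_neq_0]. }
  unfold frame'. destruct i; cbn -[Ck coframe' kron];
  repeat first
  [ apply open_M | apply smooth_lift2; assumption | apply coframe'_smooth | intros; apply shh_neq_0; assumption | intros; apply N2; assumption
  | ck_step; [apply open_M|..] | progress unfold sn, cs, sh, ch ].
Qed.

(** * Frame derivatives of the structure functions, and the curvature *)

Let atom_dir (f : pt -> R) (i : ix) (p : pt) : R := sum4 (fun n => frame' i p n * partial n f p).

Lemma dir_atom f i p : M p -> dir (E i) f p = atom_dir f i p.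
Proof. intro Mp. unfold dir, atom_dir. apply sum4_ext; intro n. rewrite frame_eq by exact Mp. reflexivity. Qed.

(** [gtab] is linear in its six arguments, so differentiation acts on these alone and leaves the
    index pattern intact. *)
Lemma dir_gtab (X : vfield) (u1 u2 u3 u4 u5 u6 : pt -> R) p i j k :
  (forall n, ex_partial n u1 p /\ ex_partial n u2 p /\ ex_partial n u3 p /\ ex_partial n u4 p
     /\ ex_partial n u5 p /\ ex_partial n u6 p) ->
  dir X (fun q => gtab (u1 q) (u2 q) (u3 q) (u4 q) (u5 q) (u6 q) i j k) p
  = gtab (dir X u1 p) (dir X u2 p) (dir X u3 p) (dir X u4 p) (dir X u5 p) (dir X u6 p) i j k.
Proof.
  intro Hu. unfold dir.
  rewrite (sum4_ext _ (fun n => X p n * gtab (partial n u1 p) (partial n u2 p) (partial n u3 p) (partial n u4 p) (partial n u5 p) (partial n u6 p) i j k)).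
  - unfold gtab, sum4; destruct i, j, k; cbn; field.
  - intro n. f_equal. apply has_partial_partial.
    destruct (Hu n) as [K1 [K2 [K3 [K4 [K5 K6]]]]].
    apply ex_has_partial in K1, K2, K3, K4, K5, K6.
    assert (Hc : forall i j k, has_partial n (fun q => ctab (u1 q) (u2 q) (u3 q) (u4 q) (u5 q) (u6 q) i j k) p
       (ctab (partial n u1 p) (partial n u2 p) (partial n u3 p) (partial n u4 p) (partial n u5 p) (partial n u6 p) i j k)).
    { clear - K1 K2 K3 K4 K5 K6. intros i j k. destruct i, j, k; cbn;
        first [ apply has_partial_const | assumption | apply has_partial_opp; assumption
              | eapply has_partial_eq; [eapply has_partial_mult; [apply has_partial_const|eassumption]|cbv beta; ring] ]. }
    unfold gtab. eapply has_partial_eq.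
    + eapply has_partial_mult; [apply has_partial_const|].
      apply has_partial_plus; [apply has_partial_minus|]; apply Hc.
    + cbv beta; ring.
Qed.

Definition wfun (p : pt) : R :=
  (4 * a ^ 2 * lift2 h p ^ 2 + 2 * a ^ 2 * lift2 H p ^ 2 + laplacian (fun u v => ln (h u v)) (p i1) (p i2))
  / (lift2 h p ^ 2 * sinh (a * p i3) ^ 2).

(** With [hX2], the gradient of H rotated by the angle 2at and rescaled; [hX3] is the derivative of
    [fp0] along E_1. They are the values given to X1, X2 and e1p in [curv_algebra]. *)
Definition hX1 p := (lift2 (ddx H) p * cs p - lift2 (ddy H) p * sn p) / (sh p * lift2 h p) ^ 2.
Definition hX2 p := (lift2 (ddx H) p * sn p + lift2 (ddy H) p * cs p) / (sh p * lift2 h p) ^ 2.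

Definition hX3 p := lift2 (ddx (ddx h)) p / (sh p ^ 2 * lift2 h p ^ 3) - 2 * fp0 p ^ 2 - a * kap p * fA p * fp0 p.

Definition lap_h p := ((lift2 (ddx (ddx h)) p + lift2 (ddy (ddy h)) p) / lift2 h p - (lift2 (ddx h) p ^ 2 + lift2 (ddy h) p ^ 2) / lift2 h p ^ 2).

Lemma lap_h_eq p : M p -> laplacian (fun u v => ln (h u v)) (p i1) (p i2) = lap_h p.
Proof. intros [Up _]. apply (laplacian_ln U h); auto. Qed.

Lemma wfun_eq p : M p ->
  4 * a ^ 2 * (kap p ^ 2 - 1) + 2 * a ^ 2 * (fA p ^ 2 + fB p ^ 2) + lap_h p / (lift2 h p ^ 2 * sh p ^ 2) = wfun p.
Proof.
  intro Mp. unfold wfun. rewrite lap_h_eq by exact Mp. change (sinh (a * p i3)) with (sh p).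
  pose proof (sh_neq_0 p Mp) as S0. pose proof (h_neq_0 p Mp) as h0.
  pose proof (ch_sq p) as E1. pose proof (cs_sq p) as E2.
  unfold kap, fA, fB. field_simplify_eq [E1 E2]; [ring [E1 E2]|auto].
Qed.

Lemma atoms_smooth : smooth_on M kap /\ smooth_on M fA /\ smooth_on M fB /\ smooth_on M fp0 /\ smooth_on M fq0.
Proof.
  assert (N2 : forall p, M p -> sh p * (lift2 h p * lift2 h p) <> 0).
  { intros p Mp. pose proof (sh_neq_0 p Mp). pose proof (h_neq_0 p Mp).
    nz. }
  repeat split; intro n; unfold kap, fA, fB, fp0, fq0;
  repeat first
  [ apply open_M | apply smooth_lift2; assumption | intros; apply shh_neq_0; assumption | intros; apply N2; assumption
  | intros; apply sh_neq_0; assumption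
  | ck_step; [apply open_M|..] | progress unfold sn, cs, sh, ch ].
Qed.

(** Closure of the system under frame derivatives, in the shape that [curv_algebra] expects. The
    entries that merely repeat [atom_dir] are those whose values that lemma leaves arbitrary. *)
Lemma atom_partials p : M p ->
  (forall i, atom_dir kap i p = a * (1 - kap p ^ 2) * match i with i1 => fA p | i2 => fB p | i3 => 0 | i4 => 1 end)
  /\ (forall i, atom_dir fA i p = match i with
    | i1 => hX1 p - fA p * fp0 p - a * kap p * fA p ^ 2 + a * (kap p + / kap p) * fB p ^ 2
    | i2 => hX2 p - fA p * fq0 p - a * kap p * fA p * fB p - a * (kap p + / kap p) * fA p * fB p
    | i3 => - (a * (kap p - / kap p)) * fB p | i4 => - a * kap p * fA p end)
  /\ (forall i, atom_dir fB i p = match i with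
    | i1 => hX2 p - fB p * fp0 p - a * kap p * fA p * fB p - a * (kap p + / kap p) * fA p * fB p
    | i2 => - hX1 p - fB p * fq0 p - a * kap p * fB p ^ 2 + a * (kap p + / kap p) * fA p ^ 2
    | i3 => a * (kap p - / kap p) * fA p | i4 => - a * kap p * fB p end)
  /\ (forall i, atom_dir fp0 i p = match i with
    | i1 => hX3 p | i2 => atom_dir fp0 i2 p | i3 => 0 | i4 => - a * kap p * fp0 p end)
  /\ (forall i, atom_dir fq0 i p = match i with
    | i1 => atom_dir fq0 i1 p
    | i2 => lap_h p / (lift2 h p ^ 2 * sh p ^ 2) - fp0 p ^ 2 - fq0 p ^ 2
            - a * kap p * (fA p * fp0 p + fB p * fq0 p) - hX3 p
    | i3 => 0 | i4 => - a * kap p * fq0 p end).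
Proof.
  intro Mp. destruct (Mp) as [Up Np].
  pose proof (sh_neq_0 p Mp) as S0. pose proof (ch_neq_0 p) as C0. pose proof (h_neq_0 p Mp) as h0. pose proof (H_neq_0 p Mp) as H0.
  pose proof (ch_sq p) as E1. pose proof (cs_sq p) as E2.
  pose proof (shh_neq_0 p Mp) as N2.
  assert (N3 : sh p * (lift2 h p * lift2 h p) <> 0) by nz.
  assert (D : forall f i l1 l2 l3 l4 r, has_partial i1 f p l1 -> has_partial i2 f p l2 -> has_partial i3 f p l3 ->
    has_partial i4 f p l4 -> frame' i p i1 * l1 + frame' i p i2 * l2 + frame' i p i3 * l3 + frame' i p i4 * l4 = r ->
    atom_dir f i p = r).
  { intros f i l1 l2 l3 l4 r P1 P2 P3 P4 <-. unfold atom_dir, sum4.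
    rewrite (has_partial_partial _ _ _ _ P1), (has_partial_partial _ _ _ _ P2),
      (has_partial_partial _ _ _ _ P3), (has_partial_partial _ _ _ _ P4). reflexivity. }
  repeat split; intros []; try reflexivity;
  (eapply D; [unfold kap, fA, fB, fp0, fq0, sn, cs, sh, ch, Rdiv; hp; solve [exact S0|exact N2|exact N3]..|];
   cbn -[lift2 sinh cosh sin cos pow kron frame']; refold p;
   unfold frame', kron, hX1, hX2, hX3, lap_h, kap, fA, fB, fp0, fq0; cbn;
   field_simplify_eq [E1 E2]; [ring [E1 E2]|repeat split; auto]).
Qed.

Lemma Rm_E i j l n p : M p ->
  curv_frame E sfun i j l n p = rtab a (wfun p) i j l n.
Proof.
  intro Mp. destruct (atom_partials p Mp) as [Dk [DA [DB [Dp Dq]]]].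
  destruct atoms_smooth as [Sk [SA [SB [Sp Sq]]]].
  pose proof (kap_neq_0 p Mp) as K0.
  assert (Xk := fun n => smooth_on_has_partial M kap n p Sk Mp).
  assert (XA := fun n => smooth_on_has_partial M fA n p SA Mp).
  assert (XB := fun n => smooth_on_has_partial M fB n p SB Mp).
  assert (Xp := fun n => smooth_on_has_partial M fp0 n p Sp Mp).
  assert (Xq := fun n => smooth_on_has_partial M fq0 n p Sq Mp).
  assert (P1 : forall n, has_partial n (fun q => a * kap q) p (a * partial n kap p)).
  { intro r. eapply has_partial_eq; [apply has_partial_mult; [apply has_partial_const|apply Xk]|cbv beta; ring]. }
  assert (P2 : forall n, has_partial n (fun q => nK (kap q)) p (a * (1 - / kap p ^ 2) * partial n kap p)).
  { intro r. unfold nK. eapply has_partial_eq; [apply has_partial_mult; [apply has_partial_const|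
      apply has_partial_plus; [apply Xk|apply has_partial_inv; [exact K0|apply Xk]]]|cbv beta; field; exact K0]. }
  assert (Pm : forall n, has_partial n (fun q => mK (kap q)) p (a * (1 + / kap p ^ 2) * partial n kap p)).
  { intro r. unfold mK. eapply has_partial_eq; [apply has_partial_mult; [apply has_partial_const|
      apply has_partial_minus; [apply Xk|apply has_partial_inv; [exact K0|apply Xk]]]|cbv beta; field; exact K0]. }
  assert (P3 := fun n => has_partial_mult n _ _ p _ _ (Pm n) (XB n)).
  assert (P4 := fun n => has_partial_mult n _ _ p _ _ (Pm n) (XA n)).
  assert (P5 := fun n => has_partial_plus n _ _ p _ _ (has_partial_mult n _ _ p _ _ (P1 n) (XB n)) (Xq n)).
  assert (P6 := fun n => has_partial_plus n _ _ p _ _ (has_partial_mult n _ _ p _ _ (P1 n) (XA n)) (Xp n)).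
  assert (DD : forall b f d, (forall n, has_partial n f p (d n)) -> dir (E b) f p = sum4 (fun n => frame' b p n * d n)).
  { intros b f d Hd. rewrite dir_atom by exact Mp. apply sum4_ext; intro r. f_equal. apply has_partial_partial, Hd. }
  rewrite <- wfun_eq by exact Mp.
  rewrite <- (curv_algebra a (kap p) (fA p) (fB p) (fp0 p) (fq0 p) (hX1 p) (hX2 p) _
     (hX3 p) (atom_dir fq0 i1 p) (atom_dir fp0 i2 p) K0).
  unfold curv_frame.
  (* Brings the derivatives of the connection coefficients to the form of [dG]; once the entries of
     [atom_partials] are substituted, both sides are convertible. *)
  assert (DC : forall b i j k, dir (E b) (conn sfun i j k) p
    = gtab (a * atom_dir kap b p) (a * (1 - / kap p ^ 2) * atom_dir kap b p)
       (a * (1 + / kap p ^ 2) * atom_dir kap b p * fB p + a * (kap p - / kap p) * atom_dir fB b p)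
       (a * (1 + / kap p ^ 2) * atom_dir kap b p * fA p + a * (kap p - / kap p) * atom_dir fA b p)
       (a * atom_dir kap b p * fB p + a * kap p * atom_dir fB b p + atom_dir fq0 b p)
       (a * atom_dir kap b p * fA p + a * kap p * atom_dir fA b p + atom_dir fp0 b p) i j k).
  { intros b i0 j0 k0.
    transitivity (dir (E b) (fun p => gtab (a * kap p) (nK (kap p)) (mK (kap p) * fB p) (mK (kap p) * fA p)
       (a * kap p * fB p + fq0 p) (a * kap p * fA p + fp0 p) i0 j0 k0) p); [reflexivity|].
    rewrite dir_gtab.
    - rewrite (DD b _ _ P1), (DD b _ _ P2), (DD b _ _ P3), (DD b _ _ P4), (DD b _ _ P5), (DD b _ _ P6).
      unfold atom_dir, mK. f_equal; unfold sum4; ring.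
    - intro r. repeat split; eapply has_partial_ex; [apply P1|apply P2|apply P3|apply P4|apply P5|apply P6]. }
  rewrite !DC. clear DC.
  rewrite !Dk, !DA, !DB. rewrite (Dp i), (Dp j), (Dq i), (Dq j).
  reflexivity.
Qed.

(** * Ricci curvature, Lee form and conformal scalar curvature *)

Let g := metric_of (coframe a h H).

Lemma Rm_E_rtab i j l n p : M p -> Rm g (E i) (E j) (E l) (E n) p = rtab a (wfun p) i j l n.
Proof.
  intro Mp. rewrite <- Rm_E by exact Mp.
  apply (Rm_frame M); auto using open_M, coframe_smooth, E_smooth, coframe_det, structure_coframe.
  intros b c d. destruct atoms_smooth as [Sk [SA [SB [Sp Sq]]]].
  intro m. unfold sfun, nK, mK.
  destruct b, c, d; cbn -[Ck];
  repeat first [ apply open_M | apply Sk | apply SA | apply SB | apply Sp | apply Sq | exact kap_neq_0 | ck_step; [apply open_M|..]].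
Qed.

Lemma gprod_nabla_E i j k p : M p -> gprod g (nabla g (E i) (E j)) (E k) p = conn sfun i j k p.
Proof.
  intro Mp. apply (gprod_nabla M); auto using open_M, coframe_smooth, E_smooth, coframe_det, structure_coframe.
Qed.

Lemma Ric_rtab i j p : M p -> Ric g E (E i) (E j) p = sum4 (fun n => rtab a (wfun p) n i j n).
Proof. intro Mp. apply sum4_ext; intro n. apply Rm_E_rtab, Mp. Qed.

Lemma Ric_E i j p : M p -> Ric g E (E i) (E j) p
  = if ix_eqb i j then match i with i1 | i2 => - wfun p - 6 * a ^ 2 | i3 | i4 => - 6 * a ^ 2 end else 0.
Proof.
  intro Mp. rewrite Ric_rtab by exact Mp. unfold sum4, rtab, kron. destruct i, j; cbn; ring.
Qed.

Lemma scal_curv_E p : M p -> scal_curv g E p = - 2 * wfun p - 24 * a ^ 2.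
Proof. intro Mp. unfold scal_curv, sum4. rewrite !Ric_E by exact Mp. cbn. ring. Qed.

Lemma sec_curv_E i j p : M p -> sec_curv g (E i) (E j) p = rtab a (wfun p) i j j i.
Proof. intro Mp. apply Rm_E_rtab, Mp. Qed.

Lemma alpha_kap p : alpha a p = - 2 * a * kap p.
Proof. unfold alpha, coth, kap, ch, sh. reflexivity. Qed.

Let theta : oneform := fun p i => - alpha a p * coframe a h H i4 p i.

Lemma eval1_theta X p : eval1 theta X p = - alpha a p * eval1 (coframe a h H i4) X p.
Proof. unfold eval1, theta, sum4. ring. Qed.

(** Here theta = 2a kap theta_4, so |theta|^2 = 4a^2 kap^2, while delta theta = - 4a^2 (1 + kap^2).
    The sum is the constant - 4a^2, which cancels the - 24a^2 of the scalar curvature. *)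
Lemma conf_scal_E p : M p -> conf_scal g E theta p = - 2 * wfun p.
Proof.
  intro Mp. unfold conf_scal. rewrite scal_curv_E by exact Mp.
  destruct (atom_partials p Mp) as [Dk _].
  destruct atoms_smooth as [Sk _].
  pose proof (kap_neq_0 p Mp) as K0.
  assert (N : norm2_oneform E theta p = 4 * a ^ 2 * kap p ^ 2).
  { unfold norm2_oneform, sum4. rewrite !eval1_theta, !E_dual by exact Mp. rewrite alpha_kap. unfold kron; cbn. ring. }
  assert (D : forall i, nabla_oneform g (E i) theta (E i) p
     = 2 * a * (atom_dir kap i p * kron i4 i) - 2 * a * kap p * conn sfun i i i4 p).
  { intro i. unfold nabla_oneform. rewrite eval1_theta, alpha_kap.
    rewrite <- (gprod_E_r M (coframe a h H) E E_dual _ i4 p Mp). fold g.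
    rewrite gprod_nabla_E by exact Mp.
    replace (dir (E i) (eval1 theta (E i)) p) with (2 * a * (atom_dir kap i p * kron i4 i)); [ring|].
    rewrite dir_atom by exact Mp. unfold atom_dir.
    rewrite (sum4_ext (fun n => _ * partial n (eval1 theta (E i)) p)
       (fun n => frame' i p n * (2 * a * partial n kap p * kron i4 i))); [unfold sum4; ring|].
    intro n. f_equal.
    rewrite (partial_ext_open M _ (fun q => (2 * a * kron i4 i) * kap q)); auto using open_M.
    - apply has_partial_partial. eapply has_partial_eq.
      + apply has_partial_mult; [apply has_partial_const|apply (smooth_on_has_partial M); [apply Sk|exact Mp]].
      + cbv beta; ring.
    - intros q Mq. rewrite eval1_theta, E_dual, alpha_kap by exact Mq. ring. }
  unfold codiff, sum4. rewrite N, !D, !Dk.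
  unfold conn, sfun, kron, nK, mK. cbn. field. exact K0.
Qed.

Lemma partial_wedge11 i j k (al be : oneform) p :
  ex_partial i (fun q => al q j) p -> ex_partial i (fun q => al q k) p ->
  ex_partial i (fun q => be q j) p -> ex_partial i (fun q => be q k) p ->
  has_partial i (fun q => wedge11 al be q j k) p
  (partial i (fun q => al q j) p * be p k + al p j * partial i (fun q => be q k) p
   - (partial i (fun q => al q k) p * be p j + al p k * partial i (fun q => be q j) p)).
Proof.
  intros. unfold wedge11.
  apply has_partial_minus;
   [apply has_partial_mult with (f := fun q => al q j) (g := fun q => be q k)
   |apply has_partial_mult with (f := fun q => al q k) (g := fun q => be q j)]; apply ex_has_partial; assumption.
Qed.

Lemma Lee_form (J : endo) :
  (forall p, M p -> forall i j, kahler_form g J p i j =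
     add_twoform (wedge11 (coframe a h H i1) (coframe a h H i2)) (wedge11 (coframe a h H i3) (coframe a h H i4)) p i j) ->
  is_Lee_form M g J theta.
Proof.
  intros HJ p Mp i j k. unfold d_twoform, wedge12.
  set (th := coframe a h H) in *.
  assert (X : forall n m i, ex_partial i (fun q => th n q m) p).
  { intros n m i0. eapply smooth_on_ex; [apply coframe_smooth|exact Mp]. }
  assert (P : forall i j k, partial i (fun q => kahler_form g J q j k) p =
    (partial i (fun q => th i1 q j) p * th i2 p k + th i1 p j * partial i (fun q => th i2 q k) p
   - (partial i (fun q => th i1 q k) p * th i2 p j + th i1 p k * partial i (fun q => th i2 q j) p))
   + (partial i (fun q => th i3 q j) p * th i4 p k + th i3 p j * partial i (fun q => th i4 q k) p
   - (partial i (fun q => th i3 q k) p * th i4 p j + th i3 p k * partial i (fun q => th i4 q j) p))).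
  { intros a0 b0 c0.
    rewrite (partial_ext_open M _ (fun q => wedge11 (th i1) (th i2) q b0 c0 + wedge11 (th i3) (th i4) q b0 c0));
      auto using open_M.
    - apply has_partial_partial, has_partial_plus; apply partial_wedge11; apply X. }
  rewrite !P, !HJ by exact Mp.
  assert (S : forall n i j, partial i (fun q => th n q j) p = partial j (fun q => th n q i) p
    - sum4 (fun b => sum4 (fun c => sfun b c n p * th b p i * th c p j))).
  { intros n i0 j0. pose proof (structure_coframe p Mp n i0 j0) as S. fold th in S. lra. }
  (* Reversing one derivative for each pair of coordinates lets all derivatives cancel in the cyclic
     sum, so that only structure functions remain. *)
  rewrite (S i1 i j), (S i1 j k), (S i1 k i), (S i2 i j), (S i2 j k), (S i2 k i),
    (S i3 i j), (S i3 j k), (S i3 k i), (S i4 i j), (S i4 j k), (S i4 k i).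
  unfold theta, add_twoform, wedge11. fold th. rewrite alpha_kap.
  unfold sum4, sfun, mK, nK. cbn. ring.
Qed.

(** * Holomorphic sectional curvature and space forms *)

Section ComplexStructure.
Variable J : endo.
Hypothesis HJ : forall p, M p -> forall i j, kahler_form g J p i j =
     add_twoform (wedge11 (coframe a h H i1) (coframe a h H i2)) (wedge11 (coframe a h H i4) (coframe a h H i3)) p i j.

(** J is known only through its Kähler form; g(J X, E_m) is that form on (X, E_m), and these
    products are the frame components of J X. *)
Lemma app_endo_comp X p m : M p ->
  eval1 (coframe a h H m) (app_endo J X) p = sum4 (fun n => eval1 (coframe a h H n) X p * omega_bar n m).
Proof.
  intro Mp. rewrite <- (gprod_E_r M (coframe a h H) E E_dual _ m p Mp).
  transitivity (sum4 (fun i => X p i * sum4 (fun j => kahler_form g J p i j * E m p j))).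
  { unfold gprod, app_endo, kahler_form, sum4. fold g. ring. }
  rewrite (sum4_ext _ (fun i => X p i * sum4 (fun j => add_twoform (wedge11 (coframe a h H i1) (coframe a h H i2)) (wedge11 (coframe a h H i4) (coframe a h H i3)) p i j * E m p j)))
    by (intro; f_equal; apply sum4_ext; intro; rewrite HJ by exact Mp; reflexivity).
  transitivity (eval1 (coframe a h H i1) X p * eval1 (coframe a h H i2) (E m) p
    - eval1 (coframe a h H i2) X p * eval1 (coframe a h H i1) (E m) p
    + eval1 (coframe a h H i4) X p * eval1 (coframe a h H i3) (E m) p
    - eval1 (coframe a h H i3) X p * eval1 (coframe a h H i4) (E m) p).
  { unfold add_twoform, wedge11, eval1. set (th := coframe a h H). unfold sum4. ring. }
  rewrite !E_dual by exact Mp. unfold sum4, kron. destruct m; cbn; ring.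
Qed.

Lemma eval1_smooth X n : smooth_vec_on M X -> smooth_on M (eval1 (coframe a h H n) X).
Proof.
  intros HX k. unfold eval1. apply (Ck_sum4 M open_M k (fun i p => coframe a h H n p i * X p i)).
  intro i. apply Ck_mult; [apply open_M|apply coframe_smooth|apply HX].
Qed.

Lemma app_endo_smooth X : smooth_vec_on M X -> smooth_vec_on M (app_endo J X).
Proof.
  intros HX i k.
  apply Ck_ext with (fun p => sum4 (fun m => sum4 (fun n => eval1 (coframe a h H n) X p * omega_bar n m) * E m p i)).
  - apply open_M.
  - intros p Mp. rewrite (frame_expand M (coframe a h H) E coframe_det E_dual (app_endo J X) p i Mp).
    apply sum4_ext; intro m. rewrite app_endo_comp by exact Mp. reflexivity.
  - apply (Ck_sum4 M open_M k (fun m p => sum4 (fun n => eval1 (coframe a h H n) X p * omega_bar n m) * E m p i)).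
    intro m. apply Ck_mult; [apply open_M| |apply E_smooth].
    apply (Ck_sum4 M open_M k (fun n p => eval1 (coframe a h H n) X p * omega_bar n m)). intro n.
    apply Ck_mult; [apply open_M| |apply Ck_const, open_M]. apply eval1_smooth, HX.
Qed.

(** The first part of [rtab] contributes - 4a^2 |X|^4. The second multiplies the values of
    [omega_perp] on (X, J X) and (J X, X), which are plus and minus x_1^2 + x_2^2. *)
Lemma Rm_holomorphic X p : M p -> smooth_vec_on M X ->
  Rm g X (app_endo J X) (app_endo J X) X p
  = - 4 * a ^ 2 * gprod g X X p ^ 2
    - wfun p * (eval1 (coframe a h H i1) X p ^ 2 + eval1 (coframe a h H i2) X p ^ 2) ^ 2.
Proof.
  intros Mp HX.
  set (x := fun n => eval1 (coframe a h H n) X p).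
  set (y := fun m => sum4 (fun n => x n * omega_bar n m)).
  assert (EX : forall i, X p i = sum4 (fun b => x b * E b p i)).
  { intro i. apply (frame_expand M (coframe a h H) E coframe_det E_dual X p i Mp). }
  assert (EY : forall i, app_endo J X p i = sum4 (fun b => y b * E b p i)).
  { intro i. rewrite (frame_expand M (coframe a h H) E coframe_det E_dual (app_endo J X) p i Mp).
    apply sum4_ext; intro m. rewrite app_endo_comp by exact Mp. reflexivity. }
  assert (SG : forall k i j, smooth_on M (christoffel g k i j)).
  { intros. apply smooth_christoffel; [apply open_M| |].
    - intros; apply (metric_of_smooth M open_M (coframe a h H) coframe_smooth).
    - intros q Mq; apply (metric_of_det M (coframe a h H) coframe_det q Mq). }
  assert (R : Rm g X (app_endo J X) (app_endo J X) X p
    = sum4 (fun b => x b * sum4 (fun c => y c * sum4 (fun d => y d * sum4 (fun e => x e * rtab a (wfun p) b c d e))))).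
  { unfold Rm.
    transitivity (sum4 (fun k => sum4 (fun b => x b * sum4 (fun c => y c * sum4 (fun d => y d * curv g (E b) (E c) (E d) p k)))
        * sum4 (fun l => g p k l * sum4 (fun e => x e * E e p l)))).
    { unfold gprod. apply sum4_ext; intro k.
      rewrite (curv_expand M open_M g SG E X (app_endo J X) (app_endo J X) p k x y y); auto using E_smooth, app_endo_smooth.
      rewrite (sum4_ext (fun l => g p k l * sum4 (fun e => x e * E e p l)) (fun l => g p k l * X p l))
        by (intro; rewrite EX; reflexivity).
      unfold sum4. ring. }
    transitivity (sum4 (fun b => x b * sum4 (fun c => y c * sum4 (fun d => y d * sum4 (fun e => x e * Rm g (E b) (E c) (E d) (E e) p))))).
    { unfold Rm, gprod. set (cc := fun b c d => curv g (E b) (E c) (E d) p).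
      transitivity (sum4 (fun b => x b * sum4 (fun c => y c * sum4 (fun d => y d *
         sum4 (fun k => cc b c d k * sum4 (fun l => g p k l * sum4 (fun e => x e * E e p l))))))).
      - set (z := fun k => sum4 (fun l => g p k l * sum4 (fun e => x e * E e p l))).
        assert (L : forall (u : ix -> R) (T : ix -> ix -> R) (z : ix -> R),
          sum4 (fun k => sum4 (fun b => u b * T b k) * z k) = sum4 (fun b => u b * sum4 (fun k => T b k * z k)))
          by (intros; unfold sum4; ring).
        etransitivity; [apply (L x (fun b k => sum4 (fun c => y c * sum4 (fun d => y d * cc b c d k))) z)|].
        apply sum4_ext; intro b; f_equal.
        etransitivity; [apply (L y (fun c k => sum4 (fun d => y d * cc b c d k)) z)|].
        apply sum4_ext; intro c; f_equal. apply (L y (fun d k => cc b c d k) z).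
      - apply sum4_ext; intro b; f_equal. apply sum4_ext; intro c; f_equal. apply sum4_ext; intro d; f_equal.
        unfold cc. generalize (curv g (E b) (E c) (E d) p). intro cv. unfold sum4. ring. }
    apply sum4_ext; intro b; f_equal. apply sum4_ext; intro c; f_equal. apply sum4_ext; intro d; f_equal.
    apply sum4_ext; intro e; f_equal. apply Rm_E_rtab, Mp. }
  rewrite R. unfold g. rewrite gprod_metric_of.
  change (fun k => eval1 (coframe a h H k) X p * eval1 (coframe a h H k) X p) with (fun k => x k * x k).
  change (eval1 (coframe a h H i1) X p) with (x i1). change (eval1 (coframe a h H i2) X p) with (x i2).
  unfold y, sum4, rtab, kron. cbn. ring.
Qed.

Lemma space_form_iff : space_form M g J <->
  forall x y, U (x, y) -> laplacian (fun u v => ln (h u v)) x y = - 4 * a ^ 2 * h x y ^ 2 - 2 * a ^ 2 * H x y ^ 2.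
Proof.
  split.
  - intros [c Hc] x y Uxy.
    (* Some point of M over (x, y) is needed; z = -1 and t = 0 are arbitrary choices. *)
    set (p := fun i => match i with i1 => x | i2 => y | i3 => -1 | i4 => 0 end).
    assert (Mp : M p) by (split; [exact Uxy|unfold p; lra]).
    (* Each E_n is a unit field. Its holomorphic curvature is - 4a^2 - w for n = 1 and - 4a^2 for n
       = 3, so constancy forces w = 0. *)
    assert (K : forall n, - 4 * a ^ 2 - wfun p * (kron i1 n ^ 2 + kron i2 n ^ 2) ^ 2 = c).
    { intro n. assert (G1 : gprod g (E n) (E n) p = 1).
      { unfold g. rewrite (gprod_E_r M (coframe a h H) E E_dual (E n) n p Mp), E_dual by exact Mp. destruct n; reflexivity. }
      rewrite <- (Hc (E n) (E_smooth n) p Mp G1). rewrite Rm_holomorphic by auto using E_smooth.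
      rewrite G1, !E_dual by exact Mp. ring. }
    assert (W : wfun p = 0).
    { pose proof (K i1) as K1. pose proof (K i3) as K3. unfold kron in *. cbn in *. lra. }
    unfold wfun in W. apply Rmult_integral in W. destruct W as [W|W].
    + unfold lift2, p in W. lra.
    + exfalso. revert W. apply Rinv_neq_0_compat, Rmult_neq_0; apply pow_nonzero;
        [apply h_neq_0, Mp|apply (sh_neq_0 p Mp)].
  - intros HL. exists (- 4 * a ^ 2). intros X HX p Mp G1. rewrite Rm_holomorphic by auto.
    replace (wfun p) with 0; [rewrite G1; ring|].
    unfold wfun. rewrite HL by apply Mp. unfold lift2, Rdiv. ring.
Qed.
End ComplexStructure.

(** * The anti-self-dual Weyl tensor *)

Definition swap34 (i : ix) : ix := match i with i3 => i4 | i4 => i3 | _ => i end.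

Lemma oriented_swap i : oriented E i = E (swap34 i).
Proof. destruct i; reflexivity. Qed.

Lemma Ric_oriented X Y p : Ric g (oriented E) X Y p = Ric g E X Y p.
Proof. unfold Ric, sum4. cbn. ring. Qed.

Lemma scal_oriented p : scal_curv g (oriented E) p = scal_curv g E p.
Proof. unfold scal_curv, sum4. rewrite !Ric_oriented. cbn. ring. Qed.

Definition weyl_tab (i j k l : ix) (w : R) : R :=
  let r i j := if ix_eqb i j then match i with i1 | i2 => - w - 6 * a ^ 2 | i3 | i4 => - 6 * a ^ 2 end else 0 in
  rtab a w i j k l - / 2 * (r j k * kron i l - r i k * kron j l + kron j k * r i l - kron i k * r j l)
  + (- 2 * w - 24 * a ^ 2) / 6 * (kron j k * kron i l - kron i k * kron j l).

Lemma Weyl_E i j k l p : M p ->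
  Weyl g (oriented E) (E i) (E j) (E k) (E l) p = weyl_tab i j k l (wfun p).
Proof.
  intro Mp. unfold Weyl, weyl_tab.
  rewrite !Ric_oriented, scal_oriented, Rm_E_rtab, !Ric_E, scal_curv_E by exact Mp.
  unfold g. rewrite !(gprod_E_r M (coframe a h H) E E_dual) by exact Mp. rewrite !E_dual by exact Mp.
  unfold kron.
  destruct i, j, k, l; cbn; ring.
Qed.

(** For w = 0 the curvature is that of the ball, whose W^- vanishes, so the result is linear in w.
    An anti-self-dual c is determined by c_12, c_13, c_14; the tensor acts as w/6, corrected by -
    w/2 in the direction of Omega, whose components form the sign table. *)
Lemma Weyl_minus_E p (c : ix -> ix -> R) : M p ->
  (forall i j, c i j = - c j i) -> (forall i j, hodge c i j = - c i j) ->
  forall i j, Weyl_minus g (oriented E) p c i j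
   = wfun p / 6 * c i j - wfun p / 2 * c i1 i2 *
      match i, j with i1, i2 | i4, i3 => 1 | i2, i1 | i3, i4 => -1 | _, _ => 0 end.
Proof.
  intros Mp Ac Hc.
  assert (D : forall i, c i i = 0) by (intro i; pose proof (Ac i i); lra).
  assert (C34 : c i3 i4 = - c i1 i2).
  { pose proof (Hc i1 i2) as K. unfold hodge, sum4, perm_sign, ix_rank in K. rewrite (Ac i4 i3) in K. lra. }
  assert (C24 : c i2 i4 = c i1 i3).
  { pose proof (Hc i1 i3) as K. unfold hodge, sum4, perm_sign, ix_rank in K. rewrite (Ac i4 i2) in K. lra. }
  assert (C23 : c i2 i3 = - c i1 i4).
  { pose proof (Hc i1 i4) as K. unfold hodge, sum4, perm_sign, ix_rank in K. rewrite (Ac i3 i2) in K. lra. }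
  assert (O : forall i j, Weyl_op g (oriented E) p c i j
    = / 2 * sum4 (fun k => sum4 (fun l => weyl_tab (swap34 i) (swap34 j) (swap34 l) (swap34 k) (wfun p) * c k l))).
  { intros i j. unfold Weyl_op. f_equal. apply sum4_ext; intro k; apply sum4_ext; intro l.
    rewrite !oriented_swap, Weyl_E by exact Mp. reflexivity. }
  set (N := fun i j : ix => match i, j with i1, i2 | i4, i3 => 1 | i2, i1 | i3, i4 => -1 | _, _ => 0 end).
  assert (O' : forall i j, Weyl_op g (oriented E) p c i j = wfun p / 6 * c i j - wfun p / 2 * c i1 i2 * N i j).
  { intros i j. rewrite O. unfold sum4. rewrite !D, (Ac i2 i1), (Ac i3 i1), (Ac i4 i1), (Ac i3 i2), (Ac i4 i2), (Ac i4 i3), C34, C24, C23.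
    destruct i, j; cbn -[rtab]; unfold weyl_tab, rtab, kron; cbn;
      rewrite ?D, ?(Ac i2 i1), ?(Ac i3 i1), ?(Ac i4 i1), ?(Ac i3 i2), ?(Ac i4 i2), ?(Ac i4 i3), ?C34, ?C24, ?C23; field. }
  intros i j. unfold Weyl_minus, asd_part.
  (* The image is anti-self-dual already, so the projection in [Weyl_minus] changes nothing. *)
  assert (HH : hodge (Weyl_op g (oriented E) p c) i j = - Weyl_op g (oriented E) p c i j).
  { unfold hodge. rewrite (sum4_ext _ (fun k => sum4 (fun l => perm_sign i j k l * (wfun p / 6 * c k l - wfun p / 2 * c i1 i2 * N k l))))
      by (intro; apply sum4_ext; intro; rewrite O'; reflexivity).
    rewrite O'.
    transitivity (wfun p / 6 * hodge c i j - wfun p / 2 * c i1 i2 * hodge N i j).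
    - unfold hodge, sum4. field.
    - rewrite Hc. replace (hodge N i j) with (- N i j); [ring|].
      unfold hodge, sum4, perm_sign, ix_rank. destruct i, j; cbn; field. }
  rewrite HH, O'. unfold N. field.
Qed.

Lemma Weyl_minus_LM p phi psi : M p ->
  let F := oriented E in
  let Omega := add_twoform (wedge11 (coframe a h H i1) (coframe a h H i2)) (wedge11 (coframe a h H i3) (coframe a h H i4)) in
  orthonormal_basis_LM F Omega phi psi p ->
  forall i j,
        Weyl_minus g F p (comp2 F Omega p) i j = - (wfun p / 3) * comp2 F Omega p i j
        /\ Weyl_minus g F p (comp2 F phi p) i j = wfun p / 6 * comp2 F phi p i j
        /\ Weyl_minus g F p (comp2 F psi p) i j = wfun p / 6 * comp2 F psi p i j.
Proof.
  intros Mp F Omega [Hphi [Hpsi _]] i j.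
  set (N := fun i j : ix => match i, j with i1, i2 | i4, i3 => 1 | i2, i1 | i3, i4 => -1 | _, _ => 0 end).
  assert (CO : forall i j, comp2 F Omega p i j = N i j).
  { intros i0 j0. unfold comp2.
    transitivity (eval1 (coframe a h H i1) (F i0) p * eval1 (coframe a h H i2) (F j0) p
    - eval1 (coframe a h H i1) (F j0) p * eval1 (coframe a h H i2) (F i0) p
    + eval1 (coframe a h H i3) (F i0) p * eval1 (coframe a h H i4) (F j0) p
    - eval1 (coframe a h H i3) (F j0) p * eval1 (coframe a h H i4) (F i0) p).
    - unfold Omega, eval2, add_twoform, wedge11, eval1. set (th := coframe a h H). unfold sum4. ring.
    - unfold F. rewrite !oriented_swap, !E_dual by exact Mp. unfold kron. destruct i0, j0; cbn; ring. }
  assert (AN : forall i j, N i j = - N j i) by (intros [] []; cbn; ring).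
  assert (HN : forall i j, hodge N i j = - N i j).
  { intros i0 j0. unfold hodge, sum4, perm_sign, ix_rank. destruct i0, j0; cbn; field. }
  assert (K : forall om, in_LM F Omega om p -> Weyl_minus g F p (comp2 F om p) i j = wfun p / 6 * comp2 F om p i j).
  { intros om [[Aom Hom] Oom].
    assert (Ac : forall i j, comp2 F om p i j = - comp2 F om p j i).
    { intros i0 j0. unfold comp2, eval2.
      rewrite (sum4_ext _ (fun n => sum4 (fun m => - om p m n * F i0 p n * F j0 p m))).
      - unfold sum4; ring.
      - intro n; apply sum4_ext; intro m. rewrite (Aom n m). reflexivity. }
    (* Orthogonality to Omega kills the component along the exceptional direction and leaves the
       eigenvalue w/6. *)
    assert (Z : comp2 F om p i1 i2 = 0).
    { pose proof (Hom i1 i2) as K. unfold hodge, sum4, perm_sign, ix_rank in K.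
      unfold inner2, sum4 in Oom. rewrite !CO in Oom. unfold N in Oom. cbn in Oom.
      rewrite (Ac i4 i3) in K. rewrite (Ac i2 i1), (Ac i4 i3) in Oom. lra. }
    unfold F in *. rewrite Weyl_minus_E by auto. rewrite Z. ring. }
  split; [|split; apply K; assumption].
  unfold F in *. rewrite Weyl_minus_E; auto.
  - rewrite !CO. fold (N i j). unfold N. cbn. field.
  - intros i0 j0. rewrite !CO. apply AN.
  - intros i0 j0. rewrite CO, <- HN. unfold hodge. f_equal. apply sum4_ext; intro k; apply sum4_ext; intro l.
    rewrite CO. reflexivity.
Qed.
End Geometry.

(** * Banach fixed points, the chain rule and the inverse function theorem *)

Lemma half_pow_small (C : R) (e : R) : 0 < e -> exists N, forall n, (N <= n)%nat -> C / 2 ^ n < e.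
Proof.
  intro He. assert (K : is_lim_seq (fun n => C * (/ 2) ^ n) 0).
  { replace (Finite 0) with (Rbar_mult C 0) by (simpl; f_equal; ring).
    apply is_lim_seq_scal_l, is_lim_seq_geom. rewrite Rabs_pos_eq; lra. }
  apply is_lim_seq_spec in K. destruct (K (mkposreal e He)) as [N HN].
  exists N. intros n Hn. specialize (HN n Hn). simpl in HN. rewrite Rminus_0_r in HN.
  apply Rabs_def2 in HN. rewrite pow_inv in HN. apply HN.
Qed.

Lemma Rle_of_half_pow x C : (forall n, x <= C / 2 ^ n) -> x <= 0.
Proof.
  intro H. destruct (Rle_lt_dec x 0) as [|L]; [assumption|].
  destruct (half_pow_small C x L) as [N HN]. specialize (HN N (le_n _)). specialize (H N). lra.
Qed.

(** Distances are uniform bounds on D and S is stable under pointwise limits, so no function space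
    has to be built. With T = component and time it solves linear ODEs; with T = [ix] it finds
    points of R^4. *)
Lemma contraction_fixpoint (T : Type) (D : T -> Prop) (S : (T -> R) -> Prop)
  (Phi : (T -> R) -> T -> R) (f0 : T -> R) (C : R) :
  S f0 -> (forall f, S f -> S (Phi f)) ->
  (forall (fn : nat -> T -> R) (f : T -> R), (forall n, S (fn n)) ->
     (forall t, D t -> is_lim_seq (fun n => fn n t) (f t)) -> S f) ->
  (forall f g d, S f -> S g -> (forall t, D t -> Rabs (f t - g t) <= d) ->
     forall t, D t -> Rabs (Phi f t - Phi g t) <= d / 2) ->
  (forall t, D t -> Rabs (Phi f0 t - f0 t) <= C) ->
  exists f, S f /\ forall t, D t -> Phi f t = f t.
Proof.
  intros S0 SPhi Slim Hc Hs.
  set (u := fix u n := match n with O => f0 | Datatypes.S n => Phi (u n) end).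
  assert (Su : forall n, S (u n)) by (induction n; simpl; auto).
  assert (Hstep : forall n t, D t -> Rabs (u (Datatypes.S n) t - u n t) <= C / 2 ^ n).
  { induction n as [|n IH]; intros t Dt.
    - simpl. specialize (Hs t Dt). lra.
    - replace (C / 2 ^ Datatypes.S n) with (C / 2 ^ n / 2) by (simpl; field; apply pow_nonzero; lra).
      apply (Hc (u (Datatypes.S n)) (u n)); auto. }
  (* The exact tail of the geometric series is subtracted so that the induction on k closes. *)
  assert (Hdist : forall k n t, D t -> Rabs (u (n + k)%nat t - u n t) <= 2 * C / 2 ^ n - 2 * C / 2 ^ (n + k)).
  { induction k as [|k IH]; intros n t Dt.
    - rewrite Nat.add_0_r, Rminus_diag, Rabs_R0. lra.
    - replace (n + Datatypes.S k)%nat with (Datatypes.S (n + k)) by lia.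
      replace (u (Datatypes.S (n + k)) t - u n t) with
        ((u (Datatypes.S (n + k)) t - u (n + k)%nat t) + (u (n + k)%nat t - u n t)) by ring.
      eapply Rle_trans; [apply Rabs_triang|].
      specialize (IH n t Dt). specialize (Hstep (n + k)%nat t Dt).
      replace (2 * C / 2 ^ Datatypes.S (n + k)) with (C / 2 ^ (n + k)) by (simpl; field; apply pow_nonzero; lra).
      lra. }
  assert (Hdist' : forall k n t, D t -> Rabs (u (n + k)%nat t - u n t) <= 2 * C / 2 ^ n).
  { intros k n t Dt. specialize (Hdist k n t Dt).
    assert (0 <= C) by (eapply Rle_trans; [apply Rabs_pos|apply Hs, Dt]).
    assert (0 <= 2 * C / 2 ^ (n + k)) by (apply Rmult_le_pos; [lra|]; left; apply Rinv_0_lt_compat, pow_lt; lra).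
    lra. }
  (* Off D this may be a default value; [Slim] accordingly relies on convergence on D only. *)
  set (f := fun t => real (Lim_seq (fun n => u n t))).
  assert (Hl : forall t, D t -> is_lim_seq (fun n => u n t) (f t)).
  { intros t Dt. apply Lim_seq_correct', ex_lim_seq_cauchy_corr. intros e.
    destruct (half_pow_small (2 * C) (e / 2)) as [N HN]; [apply is_pos_div_2|].
    exists N. intros n m Hn Hm.
    replace (u n t - u m t) with ((u (N + (n - N))%nat t - u N t) - (u (N + (m - N))%nat t - u N t))
      by (replace (N + (n - N))%nat with n by lia; replace (N + (m - N))%nat with m by lia; ring).
    specialize (HN N (le_n _)).
    pose proof (Hdist' (n - N)%nat N t Dt). pose proof (Hdist' (m - N)%nat N t Dt).
    eapply Rle_lt_trans; [apply Rabs_triang|]. rewrite Rabs_Ropp. lra. }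
  assert (Hf : forall n t, D t -> Rabs (f t - u n t) <= 2 * C / 2 ^ n).
  { intros n t Dt.
    assert (K : is_lim_seq (fun k => Rabs (u (k + n)%nat t - u n t)) (Rabs (f t - u n t))).
    { apply (is_lim_seq_abs _ (Finite (f t - u n t))).
      apply (is_lim_seq_minus' _ (fun _ => u n t)); [|apply is_lim_seq_const].
      apply (is_lim_seq_incr_n (fun k => u k t)), Hl, Dt. }
    apply (is_lim_seq_le _ (fun _ => 2 * C / 2 ^ n) (Finite (Rabs (f t - u n t))) (Finite (2 * C / 2 ^ n))) in K.
    - exact K.
    - intro k. rewrite Nat.add_comm. apply Hdist', Dt.
    - apply is_lim_seq_const. }
  assert (Sf : S f) by (apply (Slim u f); auto).
  exists f. split; [exact Sf|]. intros t Dt.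
  apply Rminus_diag_uniq.
  assert (K : Rabs (Phi f t - f t) <= 0).
  { apply (Rle_of_half_pow _ (2 * C)). intro n.
    replace (Phi f t - f t) with ((Phi f t - Phi (u n) t) - (f t - u (Datatypes.S n) t)) by (simpl; ring).
    eapply Rle_trans; [apply Rabs_triang|]. rewrite Rabs_Ropp.
    pose proof (Hc f (u n) _ Sf (Su n) (Hf n) t Dt). pose proof (Hf (Datatypes.S n) t Dt) as K.
    replace (2 * C / 2 ^ Datatypes.S n) with (2 * C / 2 ^ n / 2) in K by (simpl; field; apply pow_nonzero; lra).
    lra. }
  pose proof (Rabs_pos (Phi f t - f t)).
  destruct (Req_dec (Phi f t - f t) 0) as [|N]; [assumption|]. apply Rabs_pos_lt in N. lra.
Qed.

(** * Mean values, total differentiability and the chain rule on R^4 *)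

Lemma is_derive_eps (f : R -> R) (x l : R) :
  is_derive f x l <->
  forall e, 0 < e -> exists d, 0 < d /\ forall h, Rabs h < d -> Rabs (f (x + h) - f x - l * h) <= e * Rabs h.
Proof.
  rewrite is_derive_Reals. split.
  - intros Hf e He. destruct (Hf e He) as [d Hd]. exists d. split; [apply cond_pos|].
    intros h Hh. destruct (Req_dec h 0) as [->|N].
    + rewrite Rplus_0_r, Rmult_0_r, Rminus_diag, Rminus_0_r, Rabs_R0. lra.
    + specialize (Hd h N Hh).
      replace (f (x + h) - f x - l * h) with (((f (x + h) - f x) / h - l) * h) by (field; exact N).
      rewrite Rabs_mult. apply Rmult_le_compat_r; [apply Rabs_pos|lra].
  - intros Hf e He. destruct (Hf (e / 2)) as [d [Hd H]]; [lra|]. exists (mkposreal d Hd).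
    intros h N Hh. specialize (H h Hh).
    replace ((f (x + h) - f x) / h - l) with ((f (x + h) - f x - l * h) / h) by (field; exact N).
    unfold Rdiv. rewrite Rabs_mult, Rabs_inv. pose proof (Rabs_pos_lt h N).
    apply Rmult_lt_reg_r with (Rabs h); [assumption|]. rewrite Rmult_assoc, Rinv_l by lra. nra.
Qed.

Definition sum_abs (x : ix -> R) : R := sum4 (fun i => Rabs (x i)).

Lemma sum4_ge_term (f : ix -> R) i : (forall j, 0 <= f j) -> f i <= sum4 f.
Proof.
  intro H. unfold sum4. pose proof (H i1). pose proof (H i2). pose proof (H i3). pose proof (H i4).
  destruct i; lra.
Qed.

Lemma sum_abs_ge x i : Rabs (x i) <= sum_abs x.
Proof. apply (sum4_ge_term (fun i => Rabs (x i))). intro; apply Rabs_pos. Qed.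

Lemma sum_abs_nonneg x : 0 <= sum_abs x.
Proof. eapply Rle_trans; [apply Rabs_pos|apply (sum_abs_ge x i1)]. Qed.

Lemma Rabs_sum4_le (f b : ix -> R) : (forall i, Rabs (f i) <= b i) -> Rabs (sum4 f) <= sum4 b.
Proof.
  intro H. unfold sum4.
  repeat (eapply Rle_trans; [apply Rabs_triang|]; apply Rplus_le_compat; [|apply H]). apply H.
Qed.

Lemma mvt_coord f w i s :
  (forall c, Rmin (w i) s <= c <= Rmax (w i) s -> ex_partial i f (upd w i c)) ->
  exists c, Rmin (w i) s <= c <= Rmax (w i) s /\
    f (upd w i s) - f w = partial i f (upd w i c) * (s - w i).
Proof.
  intro H.
  assert (D : forall c, Rmin (w i) s <= c <= Rmax (w i) s ->
     is_derive (fun x => f (upd w i x)) c (partial i f (upd w i c))).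
  { intros c Hc. pose proof (ex_has_partial i f _ (H c Hc)) as K. unfold has_partial in K.
    rewrite upd_same in K. revert K. apply is_derive_ext. intro t. rewrite upd_upd. reflexivity. }
  destruct (MVT_gen (fun x => f (upd w i x)) (w i) s (fun c => partial i f (upd w i c))) as [c [Hc E]].
  - intros x Hx. apply D. lra.
  - intros x Hx. apply continuity_pt_filterlim. apply (@ex_derive_continuous R_AbsRing R_NormedModule).
    eexists; apply D, Hx.
  - exists c. split; [exact Hc|]. rewrite upd_id in E. exact E.
Qed.

Lemma between_dist (x y c : R) : Rmin x y <= c <= Rmax x y -> Rabs (c - x) <= Rabs (y - x).
Proof. unfold Rmin, Rmax, Rabs. repeat destruct Rle_dec; repeat destruct Rcase_abs; lra. Qed.

Lemma between_box (x y c p r : R) : Rmin x y <= c <= Rmax x y ->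
  Rabs (x - p) < r -> Rabs (y - p) < r -> Rabs (c - p) < r.
Proof. unfold Rmin, Rmax, Rabs. repeat destruct Rle_dec; repeat destruct Rcase_abs; lra. Qed.

(* The mean value theorem along the coordinate path from q to q'. *)
Lemma mvt4 f p r q q' : box p r q -> box p r q' ->
  (forall w i, box p r w -> ex_partial i f w) ->
  exists xi : ix -> pt,
    (forall i, box p r (xi i)) /\
    (forall i j, Rabs (xi i j - q j) <= Rabs (q' j - q j)) /\
    f q' - f q = sum4 (fun i => partial i f (xi i) * (q' i - q i)).
Proof.
  intros Bq Bq' Hf.
  assert (St : forall i w, box p r w -> (forall j, Rabs (w j - q j) <= Rabs (q' j - q j)) -> w i = q i ->
    exists v, box p r v /\ (forall j, Rabs (v j - q j) <= Rabs (q' j - q j)) /\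
      f (upd w i (q' i)) - f w = partial i f v * (q' i - q i)).
  { intros i w Bw Hw Ewi.
    destruct (mvt_coord f w i (q' i)) as [c [Hc E]].
    - intros c Hc. apply Hf, box_upd; [exact Bw|].
      apply (between_box (w i) (q' i)); auto.
    - exists (upd w i c). split; [|split].
      + apply box_upd; [exact Bw|]. apply (between_box (w i) (q' i)); auto.
      + intro j. unfold upd. destruct (ix_eqb i j) eqn:Eij; [|apply Hw].
        replace j with i by (destruct i, j; try discriminate; reflexivity).
        rewrite <- Ewi. apply between_dist, Hc.
      + rewrite E, Ewi. reflexivity. }
  assert (Up : forall i w, box p r w -> (forall j, Rabs (w j - q j) <= Rabs (q' j - q j)) ->
    box p r (upd w i (q' i)) /\ (forall j, Rabs (upd w i (q' i) j - q j) <= Rabs (q' j - q j))).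
  { intros i w Bw Hw. split; [apply box_upd; auto|]. intro j. unfold upd. destruct (ix_eqb i j) eqn:Eij; [|apply Hw].
    replace j with i by (destruct i, j; try discriminate; reflexivity). lra. }
  assert (H0 : forall j, Rabs (q j - q j) <= Rabs (q' j - q j)).
  { intro j. rewrite Rminus_diag, Rabs_R0. apply Rabs_pos. }
  destruct (St i1 q Bq H0 eq_refl) as [v1 [B1 [K1 E1]]].
  destruct (Up i1 q Bq H0) as [Bu1 Hu1]. set (w1 := upd q i1 (q' i1)) in *.
  destruct (St i2 w1 Bu1 Hu1 eq_refl) as [v2 [B2 [K2 E2]]].
  destruct (Up i2 w1 Bu1 Hu1) as [Bu2 Hu2]. set (w2 := upd w1 i2 (q' i2)) in *.
  destruct (St i3 w2 Bu2 Hu2 eq_refl) as [v3 [B3 [K3 E3]]].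
  destruct (Up i3 w2 Bu2 Hu2) as [Bu3 Hu3]. set (w3 := upd w2 i3 (q' i3)) in *.
  destruct (St i4 w3 Bu3 Hu3 eq_refl) as [v4 [B4 [K4 E4]]].
  assert (E : upd w3 i4 (q' i4) = q').
  { apply functional_extensionality; intro j; destruct j; reflexivity. }
  rewrite E in E4.
  exists (fun i => match i with i1 => v1 | i2 => v2 | i3 => v3 | i4 => v4 end).
  split; [intros []; assumption|]. split; [intros []; assumption|].
  unfold sum4. rewrite <- E1, <- E2, <- E3, <- E4. ring.
Qed.

Lemma box_mono p r r' q : r <= r' -> box p r q -> box p r' q.
Proof. intros H B i. specialize (B i). lra. Qed.

Lemma common_radius (P : ix -> R -> Prop) :
  (forall i r r', 0 < r' <= r -> P i r -> P i r') ->
  (forall i, exists r, 0 < r /\ P i r) -> exists r, 0 < r /\ forall i, P i r.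
Proof.
  intros Hm H. destruct (H i1) as [r1 [? ?]], (H i2) as [r2 [? ?]], (H i3) as [r3 [? ?]], (H i4) as [r4 [? ?]].
  exists (Rmin (Rmin r1 r2) (Rmin r3 r4)). split; [repeat apply Rmin_glb_lt; assumption|].
  assert (0 < Rmin (Rmin r1 r2) (Rmin r3 r4)) by (repeat apply Rmin_glb_lt; assumption).
  pose proof (Rmin_l (Rmin r1 r2) (Rmin r3 r4)). pose proof (Rmin_r (Rmin r1 r2) (Rmin r3 r4)).
  pose proof (Rmin_l r1 r2). pose proof (Rmin_r r1 r2). pose proof (Rmin_l r3 r4). pose proof (Rmin_r r3 r4).
  intros []; [apply (Hm i1 r1)|apply (Hm i2 r2)|apply (Hm i3 r3)|apply (Hm i4 r4)]; try assumption; split; lra.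
Qed.

Lemma continuous_radius (f : ix -> pt -> R) p e : 0 < e -> (forall i, continuous (f i) p) ->
  exists r, 0 < r /\ forall i q, box p r q -> Rabs (f i q - f i p) < e.
Proof.
  intros He Hf. apply (common_radius (fun i r => forall q, box p r q -> Rabs (f i q - f i p) < e)).
  - intros i r r' Hr H q Bq. apply H. apply (box_mono p r'); [lra|exact Bq].
  - intro i. apply (proj1 (continuous_box_iff _ _) (Hf i) e He).
Qed.

(** [mvt4] turns the error into differences of partial derivatives between p and nearby points,
    which continuity makes small. *)
Lemma frechet V f p : open V -> Ck 1 V f -> V p -> forall e, 0 < e ->
  exists r, 0 < r /\ forall q, box p r q ->
    Rabs (f q - f p - sum4 (fun i => partial i f p * (q i - p i))) <= e * sum_abs (fun i => q i - p i).
Proof.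
  intros HV Hf Vp e He.
  destruct (proj1 (open_box_iff V) HV p Vp) as [r0 [Hr0 HB]].
  destruct (continuous_radius (fun i => partial i f) p e He) as [r1 [Hr1 H1]].
  { intro i. apply (Ck_continuous 0 V); [apply Ck_partial, Hf|exact Vp]. }
  exists (Rmin r0 r1). split; [apply Rmin_glb_lt; assumption|]. intros q Bq.
  destruct (mvt4 f p (Rmin r0 r1) p q) as [xi [Bxi [_ E]]]; auto.
  - apply box_center, Rmin_glb_lt; assumption.
  - intros w i Bw. apply (Ck_ex_partial 0 V); [exact Hf|]. apply HB. apply (box_mono p (Rmin r0 r1)); [apply Rmin_l|exact Bw].
  - rewrite E.
    replace (_ - _) with (sum4 (fun i => (partial i f (xi i) - partial i f p) * (q i - p i))) by (unfold sum4; ring).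
    unfold sum_abs.
    replace (e * sum4 _) with (sum4 (fun i => e * Rabs (q i - p i))) by (unfold sum4; ring).
    apply Rabs_sum4_le. intro i. rewrite Rabs_mult. apply Rmult_le_compat_r; [apply Rabs_pos|].
    left. apply H1. apply (box_mono p (Rmin r0 r1)); [apply Rmin_r|apply Bxi].
Qed.

Lemma chain_rule V f (c : R -> pt) (l : ix -> R) s : open V -> Ck 1 V f -> V (c s) ->
  (forall i, is_derive (fun t => c t i) s (l i)) ->
  is_derive (fun t => f (c t)) s (sum4 (fun i => partial i f (c s) * l i)).
Proof.
  intros HV Hf Vs Hc. apply is_derive_eps. intros e He.
  (* K bounds the increment of the curve per unit of time (one extra unit for each coordinate) and Q
     the gradient of f; each of the two error terms then receives e / 2. *)
  set (K := sum_abs l + 4). set (Q := sum_abs (fun i => partial i f (c s)) + 1).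
  assert (HK : 4 <= K) by (unfold K; pose proof (sum_abs_nonneg l); lra).
  assert (HQ : 1 <= Q) by (unfold Q; pose proof (sum_abs_nonneg (fun i => partial i f (c s))); lra).
  destruct (frechet V f (c s) HV Hf Vs (e / (2 * K))) as [r [Hr HF]]; [apply Rdiv_lt_0_compat; lra|].
  set (e' := Rmin 1 (e / (2 * Q))).
  assert (He' : 0 < e') by (apply Rmin_glb_lt; [lra|apply Rdiv_lt_0_compat; lra]).
  destruct (common_radius (fun i d => forall h, Rabs h < d -> Rabs (c (s + h) i - c s i - l i * h) <= e' * Rabs h)) as [d [Hd HD]].
  { intros i d d' Hd H h Hh. apply H. lra. }
  { intro i. apply (proj1 (is_derive_eps _ _ _) (Hc i) e' He'). }
  exists (Rmin d (r / K)). split; [apply Rmin_glb_lt; [exact Hd|apply Rdiv_lt_0_compat; lra]|].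
  intros h Hh.
  assert (Hh1 : Rabs h < d) by (eapply Rlt_le_trans; [exact Hh|apply Rmin_l]).
  assert (Hh2 : Rabs h * K < r).
  { assert (K' : Rabs h < r / K) by (eapply Rlt_le_trans; [exact Hh|apply Rmin_r]).
    apply (Rmult_lt_compat_r K) in K'; [|lra]. unfold Rdiv in K'. rewrite Rmult_assoc, Rinv_l in K' by lra. lra. }
  pose proof (Rabs_pos h) as Ph.
  assert (Bi : forall i, Rabs (c (s + h) i - c s i) <= (Rabs (l i) + 1) * Rabs h).
  { intro i. replace (c (s + h) i - c s i) with ((c (s + h) i - c s i - l i * h) + l i * h) by ring.
    eapply Rle_trans; [apply Rabs_triang|]. rewrite Rabs_mult. specialize (HD i h Hh1).
    assert (e' <= 1) by apply Rmin_l. nra. }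
  assert (Li : forall i, Rabs (l i) + 1 <= K) by (intro i; unfold K; pose proof (sum_abs_ge l i); lra).
  assert (B : box (c s) r (c (s + h))).
  { intro i. eapply Rle_lt_trans; [apply Bi|]. specialize (Li i). nra. }
  specialize (HF _ B).
  assert (SA : sum_abs (fun i => c (s + h) i - c s i) <= K * Rabs h).
  { unfold K, sum_abs, sum4. pose proof (Bi i1). pose proof (Bi i2). pose proof (Bi i3). pose proof (Bi i4). lra. }
  assert (SB : Rabs (sum4 (fun i => partial i f (c s) * (c (s + h) i - c s i - l i * h))) <= Q * (e / (2 * Q) * Rabs h)).
  { eapply Rle_trans; [apply (Rabs_sum4_le _ (fun i => Rabs (partial i f (c s)) * (e / (2 * Q) * Rabs h)))|].
    - intro i. rewrite Rabs_mult. apply Rmult_le_compat_l; [apply Rabs_pos|].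
      eapply Rle_trans; [apply HD, Hh1|]. apply Rmult_le_compat_r; [exact Ph|]. apply Rmin_r.
    - replace (sum4 _) with ((Q - 1) * (e / (2 * Q) * Rabs h)) by (unfold Q, sum_abs, sum4; ring).
      apply Rmult_le_compat_r; [|lra]. apply Rmult_le_pos; [|exact Ph]. left. apply Rdiv_lt_0_compat; lra. }
  replace (Q * (e / (2 * Q) * Rabs h)) with (e / 2 * Rabs h) in SB by (field; lra).
  assert (SC : e / (2 * K) * sum_abs (fun i => c (s + h) i - c s i) <= e / 2 * Rabs h).
  { replace (e / 2 * Rabs h) with (e / (2 * K) * (K * Rabs h)) by (field; lra).
    apply Rmult_le_compat_l; [|exact SA]. left. apply Rdiv_lt_0_compat; lra. }
  replace (_ - _) with ((f (c (s + h)) - f (c s) - sum4 (fun i => partial i f (c s) * (c (s + h) i - c s i)))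
     + sum4 (fun i => partial i f (c s) * (c (s + h) i - c s i - l i * h))) by (unfold sum4; ring).
  eapply Rle_trans; [apply Rabs_triang|]. lra.
Qed.

Lemma has_partial_compose V f (G : pt -> pt) w i (l : ix -> R) : open V -> Ck 1 V f -> V (G w) ->
  (forall j, has_partial i (fun q => G q j) w (l j)) ->
  has_partial i (fun q => f (G q)) w (sum4 (fun j => partial j f (G w) * l j)).
Proof.
  intros HV Hf VG HG. unfold has_partial.
  pose proof (chain_rule V f (fun s => G (upd w i s)) l (w i) HV Hf) as K.
  cbv beta in K. rewrite upd_id in K. apply K; auto.
Qed.

Lemma continuous_compose (f : pt -> R) (G : pt -> pt) (w : pt) : continuous f (G w) ->
  (forall j, continuous (fun q : ix -> R => G q j) w) -> continuous (fun q : ix -> R => f (G q)) w.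
Proof.
  intros Hf HG. apply continuous_box_iff. intros e He.
  destruct (proj1 (continuous_box_iff _ _) Hf e He) as [d [Hd H]].
  destruct (continuous_radius (fun j q => G q j) w d Hd HG) as [r [Hr HR]].
  exists r. split; [exact Hr|]. intros q Bq. apply H. intro j. apply HR, Bq.
Qed.

(** The induction is over all f, because the chain rule produces compositions of [partial j f] with
    the same G. *)
Lemma Ck_compose k V W f (G : pt -> pt) : open V -> open W -> (forall w, W w -> V (G w)) ->
  (forall j, Ck k W (fun w => G w j)) -> Ck k V f -> Ck k W (fun w => f (G w)).
Proof.
  intros HV HW HG. revert f; induction k as [|k IH]; intros f HGk Hf.
  - split; [|exact I]. intros w Ww. apply continuous_compose.
    + apply (Ck_continuous 0 V); auto.
    + intro j. apply (Ck_continuous 0 W (fun w => G w j)); auto.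
  - apply Ck_intro with (fun i w => sum4 (fun j => partial j f (G w) * partial i (fun q => G q j) w)); auto.
    + intros w Ww. apply continuous_compose.
      * apply (Ck_continuous (S k) V); auto.
      * intro j. apply (Ck_continuous (S k) W (fun w => G w j)); auto.
    + intros i w Ww. apply (has_partial_compose V); auto.
      * clear - Hf. revert f Hf. intros f [Hc Hd]. split; [exact Hc|]. intro i. destruct (Hd i) as [He Hp]. split; [exact He|].
        split; [|exact I]. intros p Vp. apply (Ck_continuous k V); auto.
      * intro j. apply (Ck_has_partial k W (fun q => G q j)); auto.
    + intro i. apply (Ck_sum4 W HW k (fun j w => partial j f (G w) * partial i (fun q => G q j) w)). intro j.
      apply Ck_mult; auto.
      * apply (IH (partial j f)); [intro n; apply Ck_down, HGk|apply Ck_partial, Hf].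
      * apply Ck_partial, HGk.
Qed.

Lemma max_component (x : ix -> R) : exists m, 0 <= m /\ (forall i, Rabs (x i) <= m) /\ exists i, m = Rabs (x i).
Proof.
  set (m1 := Rmax (Rabs (x i1)) (Rabs (x i2))). set (m2 := Rmax (Rabs (x i3)) (Rabs (x i4))).
  exists (Rmax m1 m2).
  assert (B : forall i, Rabs (x i) <= Rmax m1 m2).
  { intros []; unfold m1, m2; eauto using Rle_trans, Rmax_l, Rmax_r. }
  split; [eapply Rle_trans; [apply Rabs_pos|apply (B i1)]|]. split; [exact B|].
  unfold m1, m2, Rmax. repeat destruct Rle_dec; eauto.
Qed.

(** * The inverse function theorem *)

Section InverseFunction.
Variables (V : pt -> Prop) (F : pt -> pt).
Hypothesis HV : open V.
Hypothesis HF : smooth_vec_on V F.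
Let DF (q : pt) (k i : ix) : R := partial i (fun r => F r k) q.
Hypothesis HD : forall q, V q -> det4 (DF q) <> 0.
Variable p : pt.
Hypothesis Vp : V p.

(** Normalising F by L makes the differential of [Phi] at p the identity, so that q - Phi(q) has
    small derivatives near p. *)
Let L := inv4 (DF p).
Let Phi (q : pt) (k : ix) : R := sum4 (fun j => L k j * F q j).

Lemma Phi_smooth k : smooth_on V (fun q => Phi q k).
Proof.
  intro n. apply (Ck_sum4 V HV n (fun j q => L k j * F q j)). intro j.
  apply Ck_mult; [exact HV|apply Ck_const, HV|apply HF].
Qed.

Lemma Phi_partial q i k : V q -> partial i (fun q => Phi q k) q = sum4 (fun j => L k j * DF q j i).
Proof.
  intro Vq. apply has_partial_partial. unfold Phi.
  apply has_partial_sum4 with (f := fun j q => L k j * F q j). intro j.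
  eapply has_partial_eq.
  - apply has_partial_mult; [apply has_partial_const|]. apply (smooth_on_has_partial V); [apply HF|exact Vq].
  - unfold DF. ring.
Qed.

Lemma contraction_radius : exists r, 0 < r /\ (forall q, box p r q -> V q) /\
  forall q q' d, box p r q -> box p r q' -> (forall i, Rabs (q' i - q i) <= d) ->
    forall k, Rabs ((q' k - Phi q' k) - (q k - Phi q k)) <= d / 2.
Proof.
  destruct (proj1 (open_box_iff V) HV p Vp) as [r0 [Hr0 HB]].
  (* Four partial derivatives, each within 1/8 of the identity, give the contraction factor 1/2. *)
  destruct (common_radius (fun k r => forall i q, box p r q -> Rabs (partial i (fun q => Phi q k) q - partial i (fun q => Phi q k) p) < / 8)) as [r1 [Hr1 H1]].
  { intros k r r' Hr H i q Bq. apply H, (box_mono p r'); [lra|exact Bq]. }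
  { intro k. apply continuous_radius; [lra|]. intro i.
    apply (Ck_continuous 0 V); [apply smooth_on_partial, Phi_smooth|exact Vp]. }
  assert (H0 : forall q, box p (Rmin r0 r1) q -> V q).
  { intros q Bq. apply HB, (box_mono p (Rmin r0 r1)); [apply Rmin_l|exact Bq]. }
  exists (Rmin r0 r1). split; [apply Rmin_glb_lt; assumption|]. split; [exact H0|].
  intros q q' d Bq Bq' Hd k.
  destruct (mvt4 (fun q => Phi q k) p (Rmin r0 r1) q q') as [xi [Bxi [_ E]]]; auto.
  { intros w i Bw. apply (smooth_on_ex V); [apply Phi_smooth|apply H0, Bw]. }
  replace (_ - _) with (- sum4 (fun i => (partial i (fun q => Phi q k) (xi i) - kron k i) * (q' i - q i))).
  2:{ transitivity (sum4 (fun i => kron k i * (q' i - q i)) - (Phi q' k - Phi q k)).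
      - rewrite E. unfold sum4. ring.
      - rewrite sum4_kron_r. ring. }
  rewrite Rabs_Ropp.
  apply Rle_trans with (sum4 (fun i => / 8 * d)); [|unfold sum4; lra].
  apply Rabs_sum4_le. intro i. apply Rabs_mult_le; [|apply Hd].
  rewrite <- (inv4_l (DF p) (HD p Vp) k i).
  rewrite <- Phi_partial by exact Vp. left. apply H1, (box_mono p (Rmin r0 r1)); [apply Rmin_r|apply Bxi].
Qed.

Lemma Phi_inj q w : (forall k, Phi q k = sum4 (fun j => L k j * w j)) -> forall i, F q i = w i.
Proof.
  intros H i.
  assert (K : forall u : ix -> R, sum4 (fun k => DF p i k * sum4 (fun j => L k j * u j)) = u i).
  { intro u. transitivity (sum4 (fun j => sum4 (fun k => DF p i k * L k j) * u j)); [unfold sum4; ring|].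
    rewrite (sum4_ext _ (fun j => kron i j * u j)); [apply sum4_kron_r|].
    intro j. unfold L. rewrite inv4_r by (apply HD, Vp). reflexivity. }
  rewrite <- (K (F q)), <- (K w). apply sum4_ext; intro k. f_equal. apply H.
Qed.

(** G(w) is the fixed point of q -> q - Phi(q) + L w. The contraction estimate makes G Lipschitz,
    then differentiable with the inverse Jacobian at G(w); this formula contains only F and G, so
    smoothness follows by bootstrap. *)
Lemma inverse_function : exists (V' W : pt -> Prop) (G : pt -> pt),
  open V' /\ open W /\ V' p /\ (forall q, V' q -> V q) /\ smooth_vec_on W G /\
  (forall q, V' q -> W (F q) /\ forall i, G (F q) i = q i) /\
  (forall w, W w -> V' (G w) /\ forall i, F (G w) i = w i).
Proof.
  destruct contraction_radius as [r [Hr [HB HC]]].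
  set (ell := fun (w : pt) k => sum4 (fun j => L k j * (w j - F p j))).
  (* A displacement below r / 4, plus the contraction of r / 2 to r / 4, keeps the iterates within r
     / 2 of p. *)
  set (W := fun w : pt => forall k, Rabs (ell w k) < r / 4).
  (* Stated for every w, with the dummy value p outside W, so that a total function G can be
     chosen. *)
  assert (Ex : forall w, exists q, W w -> box p r q /\ forall i, F q i = w i).
  { intro w. destruct (excluded_middle_informative (W w)) as [Ww|N]; [|exists p; intro; contradiction].
    destruct (contraction_fixpoint ix (fun _ => True) (fun q => forall i, Rabs (q i - p i) <= r / 2)
      (fun q k => q k - Phi q k + sum4 (fun j => L k j * w j)) p (r / 4)) as [q [Sq Eq]].
    - intro i. rewrite Rminus_diag, Rabs_R0. lra.
    - intros q Sq k.
      replace (q k - Phi q k + sum4 (fun j => L k j * w j) - p k)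
        with (((q k - Phi q k) - (p k - Phi p k)) + ell w k) by (unfold ell, Phi, sum4; ring).
      eapply Rle_trans; [apply Rabs_triang|]. specialize (Ww k).
      assert (Rabs ((q k - Phi q k) - (p k - Phi p k)) <= r / 2 / 2).
      { apply HC; [apply box_center, Hr| |exact Sq]. intro i. specialize (Sq i). lra. }
      lra.
    - intros fn f Sn Hl i.
      assert (K := is_lim_seq_abs _ _ (is_lim_seq_minus' _ (fun _ => p i) _ _ (Hl i I) (is_lim_seq_const (p i)))).
      apply (is_lim_seq_le _ (fun _ => r / 2) _ (Finite (r / 2)) (fun n => Sn n i) K (is_lim_seq_const _)).
    - intros f f' d Sf Sf' Hd t _.
      replace (_ - _) with ((f t - Phi f t) - (f' t - Phi f' t)) by ring.
      apply HC; try (intro i; specialize (Sf i); specialize (Sf' i); lra).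
      intro i. apply Hd, I.
    - intros k _.
      replace (_ - _) with (ell w k) by (unfold ell, Phi, sum4; ring). left. apply Ww.
    - exists q. intros _. split.
      + intro i. specialize (Sq i). lra.
      + apply Phi_inj. intro k. specialize (Eq k I). simpl in Eq. lra. }
  set (G := fun w => proj1_sig (constructive_indefinite_description _ (Ex w))).
  assert (HG : forall w, W w -> box p r (G w) /\ forall i, F (G w) i = w i).
  { intro w. unfold G. destruct (constructive_indefinite_description _ (Ex w)) as [q Hq]. exact Hq. }
  assert (Lip : forall q q', box p r q -> box p r q' -> forall B, (forall k, Rabs (Phi q' k - Phi q k) <= B) ->
     forall k, Rabs (q' k - q k) <= 2 * B).
  { intros q q' Bq Bq' B HBd k.
    destruct (max_component (fun i => q' i - q i)) as [m [Hm [Hmi [i0 E0]]]].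
    pose proof (HC q q' m Bq Bq' Hmi i0) as K. specialize (HBd i0).
    assert (m <= m / 2 + B).
    { rewrite E0 at 1.
      replace (q' i0 - q i0) with (((q' i0 - Phi q' i0) - (q i0 - Phi q i0)) + (Phi q' i0 - Phi q i0)) by ring.
      eapply Rle_trans; [apply Rabs_triang|]. lra. }
    specialize (Hmi k). lra. }
  set (V' := fun q => box p r q /\ W (F q)).
  (* A bound for the operator L in the sup norm, with 1 added to keep it positive. *)
  set (Lam := 1 + sum4 (fun k => sum_abs (L k))).
  assert (HLam : forall k, sum_abs (L k) <= Lam - 1).
  { intro k. unfold Lam. pose proof (sum4_ge_term (fun k => sum_abs (L k)) k (fun k => sum_abs_nonneg (L k))). simpl in *. lra. }
  assert (HLam1 : 1 <= Lam) by (pose proof (HLam i1); pose proof (sum_abs_nonneg (L i1)); lra).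
  assert (LB : forall (u : ix -> R) d k, (forall i, Rabs (u i) <= d) -> Rabs (sum4 (fun j => L k j * u j)) <= Lam * d).
  { intros u d k Hu. assert (0 <= d) by (eapply Rle_trans; [apply Rabs_pos|apply (Hu i1)]).
    apply Rle_trans with (sum_abs (L k) * d); [|specialize (HLam k); nra].
    replace (sum_abs (L k) * d) with (sum4 (fun j => Rabs (L k j) * d)) by (unfold sum_abs, sum4; ring).
    apply Rabs_sum4_le. intro j. rewrite Rabs_mult. apply Rmult_le_compat_l; [apply Rabs_pos|apply Hu]. }
  assert (OW : open W).
  { apply open_box_iff. intros w Ww.
    destruct (max_component (ell w)) as [m [Hm [Hmi [i0 E0]]]].
    assert (m < r / 4) by (rewrite E0; apply Ww).
    exists ((r / 4 - m) / Lam). split; [apply Rdiv_lt_0_compat; lra|].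
    intros w' Bw' k.
    destruct (max_component (fun i => w' i - w i)) as [m' [Hm' [Hmi' [i0' E0']]]].
    assert (Lam * m' < r / 4 - m).
    { specialize (Bw' i0'). rewrite <- E0' in Bw'. apply (Rmult_lt_compat_l Lam) in Bw'; [|lra].
      unfold Rdiv in Bw' at 1. replace (Lam * ((r / 4 - m) * / Lam)) with (r / 4 - m) in Bw' by (field; lra). lra. }
    replace (ell w' k) with (sum4 (fun j => L k j * (w' j - w j)) + ell w k) by (unfold ell, sum4; ring).
    eapply Rle_lt_trans; [apply Rabs_triang|].
    specialize (Hmi k). pose proof (LB (fun i => w' i - w i) m' k Hmi'). lra. }
  assert (LipG : forall w w' d, W w -> W w' -> (forall i, Rabs (w' i - w i) <= d) -> forall k, Rabs (G w' k - G w k) <= 2 * (Lam * d)).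
  { intros w w' d Ww Ww' Hd. destruct (HG w Ww) as [B1 E1], (HG w' Ww') as [B2 E2].
    apply Lip; auto. intro k.
    replace (Phi (G w') k - Phi (G w) k) with (sum4 (fun j => L k j * (w' j - w j))).
    - apply LB, Hd.
    - unfold Phi, sum4. rewrite !E1, !E2. ring. }
  assert (GV : forall w, W w -> V (G w)) by (intros w Ww; apply HB, HG, Ww).
  assert (Gc : forall k w, W w -> continuous (fun q : ix -> R => G q k) w).
  { intros k w Ww. apply continuous_box_iff. intros e He.
    destruct (proj1 (open_box_iff W) OW w Ww) as [s [Hs HsW]].
    exists (Rmin s (e / (4 * Lam))). split; [apply Rmin_glb_lt; [exact Hs|apply Rdiv_lt_0_compat; lra]|].
    intros w' Bw'. apply Rle_lt_trans with (2 * (Lam * (e / (4 * Lam)))).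
    - apply LipG; auto.
      + apply HsW, (box_mono w (Rmin s (e / (4 * Lam)))); [apply Rmin_l|exact Bw'].
      + intro i. left. eapply Rlt_le_trans; [apply Bw'|apply Rmin_r].
    - replace (2 * (Lam * (e / (4 * Lam)))) with (e / 2) by (field; lra). lra. }
  assert (Gd : forall i n w, W w -> has_partial i (fun q => G q n) w (inv4 (DF (G w)) n i)).
  { intros i n w Ww. unfold has_partial. apply is_derive_eps. intros e He.
    pose proof (GV w Ww) as VG. set (N := inv4 (DF (G w))).
    set (Nb := 1 + sum_abs (N n)).
    assert (HNb : 1 <= Nb) by (unfold Nb; pose proof (sum_abs_nonneg (N n)); lra).
    set (e' := e / (8 * Lam * Nb)).
    assert (He' : 0 < e') by (apply Rdiv_lt_0_compat; [exact He|nra]).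
    destruct (common_radius (fun k s => forall q, box (G w) s q ->
      Rabs (F q k - F (G w) k - sum4 (fun j => DF (G w) k j * (q j - G w j))) <= e' * sum_abs (fun j => q j - G w j))) as [s1 [Hs1 H1]].
    { intros k s s' Hs H q Bq. apply H, (box_mono (G w) s'); [lra|exact Bq]. }
    { intro k. apply (frechet V (fun q => F q k)); auto. apply HF. }
    destruct (proj1 (open_box_iff W) OW w Ww) as [s0 [Hs0 HsW]].
    exists (Rmin s0 (s1 / (2 * Lam))). split; [apply Rmin_glb_lt; [exact Hs0|apply Rdiv_lt_0_compat; lra]|].
    intros t Ht. set (w' := upd w i (w i + t)).
    assert (Dw : forall k, w' k - w k = kron i k * t).
    { intro k. unfold w', upd, kron. destruct (ix_eqb i k) eqn:Eik; [|ring].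
      replace k with i by (destruct i, k; try discriminate; reflexivity). ring. }
    assert (Dw' : forall k, Rabs (w' k - w k) <= Rabs t).
    { intro k. rewrite Dw. unfold kron. destruct (ix_eqb i k); rewrite ?Rmult_1_l, ?Rmult_0_l, ?Rabs_R0; [lra|apply Rabs_pos]. }
    assert (Ww' : W w').
    { apply HsW. intro k. eapply Rle_lt_trans; [apply Dw'|]. eapply Rlt_le_trans; [exact Ht|apply Rmin_l]. }
    pose proof (LipG w w' (Rabs t) Ww Ww' Dw') as LG.
    assert (Bt : 2 * (Lam * Rabs t) < s1).
    { assert (K : Rabs t < s1 / (2 * Lam)) by (eapply Rlt_le_trans; [exact Ht|apply Rmin_r]).
      apply (Rmult_lt_compat_l (2 * Lam)) in K; [|lra].
      replace (2 * Lam * (s1 / (2 * Lam))) with s1 in K by (field; lra). lra. }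
    assert (BG : box (G w) s1 (G w')) by (intro k; eapply Rle_lt_trans; [apply LG|exact Bt]).
    rewrite upd_id. fold w'.
    set (dl := fun j => G w' j - G w j).
    assert (SA : sum_abs dl <= 8 * Lam * Rabs t).
    { unfold sum_abs, sum4, dl. pose proof (LG i1). pose proof (LG i2). pose proof (LG i3). pose proof (LG i4). lra. }
    assert (Rk : forall k, Rabs (kron i k * t - sum4 (fun j => DF (G w) k j * dl j)) <= e' * (8 * Lam * Rabs t)).
    { intro k. rewrite <- Dw. rewrite <- (proj2 (HG w' Ww') k), <- (proj2 (HG w Ww) k).
      eapply Rle_trans; [apply (H1 k (G w') BG)|]. apply Rmult_le_compat_l; [lra|exact SA]. }
    (* F(G(w')) - F(G(w)) is exactly t times the i-th unit vector. The remainder of F at G(w),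
       multiplied by the inverse Jacobian, is therefore the remainder of G. *)
    replace (G w' n - G w n - N n i * t) with (- sum4 (fun k => N n k * (kron i k * t - sum4 (fun j => DF (G w) k j * dl j)))).
    - rewrite Rabs_Ropp.
      apply Rle_trans with (sum4 (fun k => Rabs (N n k) * (e' * (8 * Lam * Rabs t)))).
      + apply Rabs_sum4_le. intro k. rewrite Rabs_mult. apply Rmult_le_compat_l; [apply Rabs_pos|apply Rk].
      + replace (sum4 _) with (sum_abs (N n) * (e' * (8 * Lam * Rabs t))) by (unfold sum_abs, sum4; ring).
        replace (e * Rabs t) with (Nb * (e' * (8 * Lam * Rabs t))) by (unfold e'; field; split; lra).
        apply Rmult_le_compat_r; [|unfold Nb; lra].
        apply Rmult_le_pos; [lra|]. pose proof (Rabs_pos t). nra.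
    - transitivity (sum4 (fun j => sum4 (fun k => N n k * DF (G w) k j) * dl j) - sum4 (fun k => kron i k * N n k) * t).
      + unfold sum4. ring.
      + rewrite sum4_kron_r.
        rewrite (sum4_ext _ (fun j => kron n j * dl j)); [rewrite sum4_kron_r; reflexivity|].
        intro j. unfold N. rewrite inv4_l by (apply HD, VG). reflexivity. }
  assert (GS : forall k n, Ck k W (fun q => G q n)).
  { induction k as [|k IH]; intro n.
    - split; [|exact I]. intros w Ww. apply Gc, Ww.
    - apply Ck_intro with (fun i w => inv4 (DF (G w)) n i); auto.
      intro i. apply (Ck_compose k V W (fun q => inv4 (DF q) n i) G); auto.
      apply Ck_inv4; auto. intros a b. apply (smooth_on_partial V (fun r => F r a)), HF. }
  exists V', W, G.
  split; [|split; [exact OW|split; [|split; [|split]]]].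
  - apply open_box_iff. intros q [Bq Wq].
    destruct (proj1 (open_box_iff _) (open_box p r) q Bq) as [s0 [Hs0 HB0]].
    destruct (proj1 (open_box_iff W) OW (F q) Wq) as [s1 [Hs1 HB1]].
    destruct (continuous_radius (fun i q => F q i) q s1 Hs1) as [s2 [Hs2 HB2]].
    { intro i. apply (Ck_continuous 0 V (fun q => F q i)); [apply HF|apply HB, Bq]. }
    exists (Rmin s0 s2). split; [apply Rmin_glb_lt; assumption|]. intros q' Bq'. split.
    + apply HB0, (box_mono q (Rmin s0 s2)); [apply Rmin_l|exact Bq'].
    + apply HB1. intro i. apply HB2, (box_mono q (Rmin s0 s2)); [apply Rmin_r|exact Bq'].
  - split; [apply box_center, Hr|]. intro k.
    replace (ell (F p) k) with 0 by (unfold ell, sum4; ring). rewrite Rabs_R0. lra.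
  - intros q [Bq _]. apply HB, Bq.
  - intros n k. apply GS.
  - split.
    + intros q [Bq Wq]. split; [exact Wq|]. destruct (HG (F q) Wq) as [B E]. intro i.
      apply Rminus_diag_uniq.
      assert (K : Rabs (G (F q) i - q i) <= 2 * 0).
      { apply Lip; auto. intro k. replace (Phi (G (F q)) k - Phi q k) with 0; [rewrite Rabs_R0; lra|].
        unfold Phi, sum4. rewrite !E. ring. }
      pose proof (Rabs_pos (G (F q) i - q i)).
      destruct (Req_dec (G (F q) i - q i) 0) as [|N]; [assumption|]. apply Rabs_pos_lt in N. lra.
    + intros w Ww. destruct (HG w Ww) as [B E]. split; [|exact E]. split; [exact B|].
      replace (F (G w)) with w; [exact Ww|]. apply functional_extensionality; intro i; symmetry; apply E.
Qed.
End InverseFunction.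

(** * Flat linear systems in two variables *)

(* Real (r) and imaginary (m) parts of three complex components. *)
Inductive i6 : Set := r0 | m0 | r1 | m1 | r2 | m2.

Definition sum6 (f : i6 -> R) : R := f r0 + f m0 + f r1 + f m1 + f r2 + f m2.

Lemma sum6_ext f g : (forall i, f i = g i) -> sum6 f = sum6 g.
Proof. intro H. unfold sum6. rewrite !H. reflexivity. Qed.

Lemma Rabs_sum6_le f b : (forall i, Rabs (f i) <= b) -> Rabs (sum6 f) <= 6 * b.
Proof.
  intro H. pose proof (H r0) as B0. pose proof (H m0) as B1. pose proof (H r1) as B2.
  pose proof (H m1) as B3. pose proof (H r2) as B4. pose proof (H m2) as B5.
  apply Rabs_le_between in B0, B1, B2, B3, B4, B5. apply Rabs_le_between. unfold sum6. lra.
Qed.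

Lemma continuous_sum6 (f : i6 -> R -> R) x : (forall i, continuous (f i) x) ->
  continuous (fun t => sum6 (fun i => f i t)) x.
Proof.
  intro H. unfold sum6.
  repeat (apply (continuous_plus (V := R_NormedModule)); [|apply H]). apply H.
Qed.

Lemma is_derive_sum6 (f : i6 -> R -> R) x l : (forall i, is_derive (f i) x (l i)) ->
  is_derive (fun t => sum6 (fun i => f i t)) x (sum6 l).
Proof.
  intro H. unfold sum6. repeat (apply (is_derive_plus (V := R_NormedModule)); [|apply H]). apply H.
Qed.

Lemma Ck_sum6 V k (f : i6 -> pt -> R) : open V ->
  (forall j, Ck k V (f j)) -> Ck k V (fun p => sum6 (fun j => f j p)).
Proof. intros HV Hf. unfold sum6. repeat apply Ck_plus; auto. Qed.

Lemma Rabs_RInt_le (f : R -> R) a b M :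
  (forall x, Rmin a b <= x <= Rmax a b -> continuous f x /\ Rabs (f x) <= M) ->
  Rabs (RInt f a b) <= M * Rabs (b - a).
Proof.
  intro H. rewrite Rmult_comm. apply (norm_RInt_le_const_abs f a b).
  - intros x Hx. apply H, Hx.
  - apply (RInt_correct (V := R_CompleteNormedModule)), (ex_RInt_continuous (V := R_CompleteNormedModule)).
    intros x Hx. apply H, Hx.
Qed.

Lemma continuous_of_lipschitz (f : R -> R) t0 r K t : Rabs (t - t0) < r ->
  (forall s s', Rabs (s - t0) < r -> Rabs (s' - t0) < r -> Rabs (f s - f s') <= K * Rabs (s - s')) ->
  continuous f t.
Proof.
  intros Ht HL. apply filterlim_locally. intros [e He].
  set (K' := Rabs K + 1). assert (HK : 0 < K') by (unfold K'; pose proof (Rabs_pos K); lra).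
  assert (Hd : 0 < Rmin (r - Rabs (t - t0)) (e / K')).
  { apply Rmin_glb_lt; [lra|apply Rdiv_lt_0_compat; lra]. }
  exists (mkposreal _ Hd). intros s Hs.
  assert (Hs1 : Rabs (s - t) < r - Rabs (t - t0)) by (eapply Rlt_le_trans; [exact Hs|apply Rmin_l]).
  assert (Hs2 : Rabs (s - t) < e / K') by (eapply Rlt_le_trans; [exact Hs|apply Rmin_r]).
  assert (Hs3 : Rabs (s - t0) < r).
  { replace (s - t0) with ((s - t) + (t - t0)) by ring. eapply Rle_lt_trans; [apply Rabs_triang|]. lra. }
  change (Rabs (f s - f t) < e). eapply Rle_lt_trans; [apply HL; assumption|].
  apply (Rmult_lt_compat_l K') in Hs2; [|lra]. replace (K' * (e / K')) with e in Hs2 by (field; lra).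
  pose proof (Rabs_pos (s - t)). pose proof (Rle_abs K). unfold K' in *. nra.
Qed.

Lemma interval_convex (t0 r a b x : R) : Rabs (a - t0) < r -> Rabs (b - t0) < r ->
  Rmin a b <= x <= Rmax a b -> Rabs (x - t0) < r.
Proof. intros Ha Hb Hx. apply (between_box a b); assumption. Qed.

(** Picard iteration on the whole interval. Six terms of size K times 2m give the Lipschitz constant
    12 K m; then 12 K r <= 1 keeps iterates below 2m, and 6 K r <= 1/2 is the contraction. The
    invariant set contains the Lipschitz bound because it survives pointwise limits and yields
    continuity, hence integrability. *)
Lemma linear_ode (A : i6 -> i6 -> R -> R) (t0 r K m : R) (u0 : i6 -> R) :
  0 < r -> 0 <= K -> 12 * K * r <= 1 -> (forall c, Rabs (u0 c) <= m) ->
  (forall c d t, Rabs (t - t0) < r -> continuous (A c d) t /\ Rabs (A c d t) <= K) ->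
  exists u : i6 -> R -> R, (forall c, u c t0 = u0 c) /\
    (forall c t, Rabs (t - t0) < r -> Rabs (u c t) <= 2 * m /\
       is_derive (u c) t (sum6 (fun d => A c d t * u d t))).
Proof.
  intros Hr HK HKr Hm HA.
  assert (Pm : 0 <= m) by (eapply Rle_trans; [apply Rabs_pos|apply (Hm r0)]).
  assert (D0 : Rabs (t0 - t0) < r) by (rewrite Rminus_diag, Rabs_R0; exact Hr).
  set (D := fun x : i6 * R => Rabs (snd x - t0) < r).
  set (S := fun f : i6 * R -> R => forall c, (forall t, Rabs (t - t0) < r -> Rabs (f (c, t)) <= 2 * m) /\
     (forall t s, Rabs (t - t0) < r -> Rabs (s - t0) < r -> Rabs (f (c, t) - f (c, s)) <= 12 * K * m * Rabs (t - s))).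
  set (I := fun (f : i6 * R -> R) c s => sum6 (fun d => A c d s * f (d, s))).
  set (Phi := fun (f : i6 * R -> R) (x : i6 * R) => u0 (fst x) + RInt (I f (fst x)) t0 (snd x)).
  assert (Sc : forall f, S f -> forall c t, Rabs (t - t0) < r -> continuous (fun s => f (c, s)) t).
  { intros f Sf c t Ht. apply (continuous_of_lipschitz _ t0 r (12 * K * m)); [exact Ht|]. apply (Sf c). }
  assert (Ic : forall f, S f -> forall c t, Rabs (t - t0) < r -> continuous (I f c) t /\ Rabs (I f c t) <= 12 * K * m).
  { intros f Sf c t Ht. split.
    - apply (continuous_sum6 (fun d s => A c d s * f (d, s))). intro d.
      apply (continuous_mult (A c d) (fun s => f (d, s))); [apply HA, Ht|apply Sc; assumption].
    - replace (12 * K * m) with (6 * (K * (2 * m))) by ring. apply Rabs_sum6_le. intro d. apply Rabs_mult_le; [apply HA, Ht|apply Sf, Ht]. }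
  assert (Iex : forall f, S f -> forall c a b, Rabs (a - t0) < r -> Rabs (b - t0) < r -> ex_RInt (I f c) a b).
  { intros f Sf c a b Ha Hb. apply (ex_RInt_continuous (V := R_CompleteNormedModule) (I f c)). intros x Hx. apply (Ic f Sf).
    apply (interval_convex t0 r a b); assumption. }
  assert (Km : 12 * K * m * r <= m) by nra.
  assert (KP : 0 <= 12 * K * m) by nra.
  destruct (contraction_fixpoint (i6 * R) D S Phi (fun x => u0 (fst x)) m) as [f [Sf Ef]].
  - intro c. simpl. split.
    + intros t _. specialize (Hm c). lra.
    + intros t s _ _. rewrite Rminus_diag, Rabs_R0. apply Rmult_le_pos; [exact KP|apply Rabs_pos].
  - intros f Sf c. unfold Phi; simpl. split.
    + intros t Ht. eapply Rle_trans; [apply Rabs_triang|].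
      assert (Rabs (RInt (I f c) t0 t) <= 12 * K * m * Rabs (t - t0)).
      { apply Rabs_RInt_le. intros x Hx. apply (Ic f Sf), (interval_convex t0 r t0 t); assumption. }
      specialize (Hm c). nra.
    + intros t s Ht Hs.
      replace (u0 c + RInt (I f c) t0 t - (u0 c + RInt (I f c) t0 s)) with (RInt (I f c) s t).
      * apply Rabs_RInt_le. intros x Hx. apply (Ic f Sf), (interval_convex t0 r s t); assumption.
      * pose proof (RInt_Chasles (V := R_CompleteNormedModule) (I f c) t0 s t (Iex f Sf c t0 s D0 Hs) (Iex f Sf c s t Hs Ht)) as E.
        unfold plus in E; simpl in E. lra.
  - intros fn f Sn Hl c. split.
    + intros t Ht.
      assert (K1 := is_lim_seq_abs _ _ (Hl (c, t) Ht)).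
      apply (is_lim_seq_le _ (fun _ => 2 * m) _ (Finite (2 * m)) (fun n => proj1 (Sn n c) t Ht) K1 (is_lim_seq_const _)).
    + intros t s Ht Hs.
      assert (K1 := is_lim_seq_abs _ _ (is_lim_seq_minus' _ _ _ _ (Hl (c, t) Ht) (Hl (c, s) Hs))).
      apply (is_lim_seq_le _ (fun _ => 12 * K * m * Rabs (t - s)) _ (Finite (12 * K * m * Rabs (t - s)))
        (fun n => proj2 (Sn n c) t s Ht Hs) K1 (is_lim_seq_const _)).
  - intros f f' d Sf Sf' Hd [c t] Ht. unfold D in Ht; simpl in Ht. unfold Phi; simpl.
    replace (_ - _) with (RInt (fun s => minus (I f c s) (I f' c s)) t0 t).
    2:{ rewrite (RInt_minus (V := R_CompleteNormedModule)) by (apply Iex; assumption). unfold minus, plus, opp; simpl. ring. }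
    assert (Rabs (RInt (fun s => minus (I f c s) (I f' c s)) t0 t) <= 6 * (K * d) * Rabs (t - t0)).
    { apply Rabs_RInt_le. intros x Hx.
      assert (Hx' : Rabs (x - t0) < r) by (apply (interval_convex t0 r t0 t); assumption).
      split; [apply (continuous_minus (I f c) (I f' c)); apply Ic; assumption|].
      replace (minus (I f c x) (I f' c x)) with (sum6 (fun d => A c d x * (f (d, x) - f' (d, x))))
        by (unfold I, sum6, minus, plus, opp; simpl; ring).
      apply Rabs_sum6_le. intro e. apply Rabs_mult_le; [apply HA, Hx'|apply (Hd (e, x)), Hx']. }
    assert (0 <= d) by (eapply Rle_trans; [apply Rabs_pos|apply (Hd (c, t)); exact Ht]).
    assert (6 * (K * d) * Rabs (t - t0) <= 6 * (K * d) * r) by (apply Rmult_le_compat_l; [nra|lra]).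
    assert (12 * K * r * d <= 1 * d) by (apply Rmult_le_compat_r; assumption). lra.
  - intros [c t] Ht. unfold D in Ht; simpl in Ht. unfold Phi; simpl.
    set (f0 := fun x : i6 * R => u0 (fst x)).
    assert (Sf0 : S f0).
    { intro c'. unfold f0; simpl. split.
      - intros t' _. specialize (Hm c'). lra.
      - intros t' s _ _. rewrite Rminus_diag, Rabs_R0. apply Rmult_le_pos; [exact KP|apply Rabs_pos]. }
    assert (EE : forall v : R, u0 c + v - u0 c = v) by (intro; ring). rewrite EE.
    assert (Rabs (RInt (I f0 c) t0 t) <= 12 * K * m * Rabs (t - t0)).
    { apply Rabs_RInt_le. intros x Hx. apply (Ic f0 Sf0), (interval_convex t0 r t0 t); assumption. }
    nra.
  - exists (fun c t => f (c, t)). split.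
    + intro c. rewrite <- (Ef (c, t0)) by exact D0. unfold Phi; simpl. rewrite (RInt_point (V := R_CompleteNormedModule)). unfold zero; simpl. ring.
    + intros c t Ht. split; [apply Sf, Ht|].
      assert (Hloc : forall t, Rabs (t - t0) < r -> locally t (fun s => Rabs (s - t0) < r)).
      { intros s Hs. assert (P : 0 < r - Rabs (s - t0)) by lra. exists (mkposreal _ P). intros s' Hs'.
        change (Rabs (s' - s) < r - Rabs (s - t0)) in Hs'.
        replace (s' - t0) with ((s' - s) + (s - t0)) by ring. eapply Rle_lt_trans; [apply Rabs_triang|]. lra. }
      apply is_derive_ext_loc with (fun s => u0 c + RInt (I f c) t0 s).
      * generalize (Hloc t Ht). apply filter_imp. intros s Hs. exact (Ef (c, s) Hs).
      * replace (sum6 _) with (0 + I f c t) by (unfold I; ring).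
        apply (is_derive_plus (V := R_NormedModule) (fun _ => u0 c) (fun s => RInt (I f c) t0 s)).
        -- apply (is_derive_const (V := R_NormedModule)).
        -- apply (is_derive_RInt (I f c) (fun s => RInt (I f c) t0 s) t0 t).
           ++ generalize (Hloc t Ht). apply filter_imp. intros s Hs. apply (RInt_correct (V := R_CompleteNormedModule)), Iex; assumption.
           ++ apply Ic; assumption.
Qed.

(* Gronwall: a bound b for D improves to e + rho r + b / 2, because 6 K r <= 1 / 2. *)
Lemma ode_estimate (B : i6 -> i6 -> R -> R) (rem D : i6 -> R -> R) (t0 r K rho e b : R) :
  0 < r -> 0 <= K -> 12 * K * r <= 1 ->
  (forall c d t, Rabs (t - t0) < r -> Rabs (B c d t) <= K) ->
  (forall c t, Rabs (t - t0) < r -> is_derive (D c) t (sum6 (fun d => B c d t * D d t) + rem c t)) ->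
  (forall c t, Rabs (t - t0) < r -> Rabs (rem c t) <= rho) ->
  (forall c, Rabs (D c t0) <= e) ->
  (forall c t, Rabs (t - t0) < r -> Rabs (D c t) <= b) ->
  forall c t, Rabs (t - t0) < r -> Rabs (D c t) <= 2 * (e + rho * r).
Proof.
  intros Hr HK HKr HB HD Hrem H0 Hb.
  assert (D0 : Rabs (t0 - t0) < r) by (rewrite Rminus_diag, Rabs_R0; exact Hr).
  assert (Pe : 0 <= e) by (eapply Rle_trans; [apply Rabs_pos|apply (H0 r0)]).
  assert (Pr : 0 <= rho) by (eapply Rle_trans; [apply Rabs_pos|apply (Hrem r0 t0 D0)]).
  assert (It : forall n c t, Rabs (t - t0) < r -> Rabs (D c t) <= 2 * (e + rho * r) + b / 2 ^ n).
  { induction n as [|n IH]; intros c t Ht.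
    - specialize (Hb c t Ht). simpl. nra.
    - set (b' := 2 * (e + rho * r) + b / 2 ^ n) in *.
      assert (Pb : 0 <= b') by (eapply Rle_trans; [apply Rabs_pos|apply (IH c t Ht)]).
      assert (V : Rabs (D c t - D c t0) <= (6 * (K * b') + rho) * Rabs (t - t0)).
      { apply (bounded_variation _ (fun t => sum6 (fun d => B c d t * D d t) + rem c t)).
        intros s Hs. assert (Hs' : Rabs (s - t0) < r) by lra. split; [apply HD, Hs'|].
        eapply Rle_trans; [apply Rabs_triang|]. apply Rplus_le_compat; [|apply Hrem, Hs'].
        apply Rabs_sum6_le. intro d. apply Rabs_mult_le; [apply HB, Hs'|apply IH, Hs']. }
      replace (D c t) with ((D c t - D c t0) + D c t0) by ring.
      eapply Rle_trans; [apply Rabs_triang|]. specialize (H0 c).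
      assert (12 * K * r * b' <= 1 * b') by (apply Rmult_le_compat_r; assumption).
      assert ((6 * (K * b') + rho) * Rabs (t - t0) <= (6 * (K * b') + rho) * r).
      { apply Rmult_le_compat_l; [|lra]. nra. }
      assert (b / 2 ^ S n = b / 2 ^ n / 2) by (simpl; field; apply pow_nonzero; lra).
      unfold b' in *. nra. }
  intros c t Ht. apply Rminus_le. apply (Rle_of_half_pow _ b). intro n. specialize (It n c t Ht). lra.
Qed.

Lemma is_derive_minus_R (f g : R -> R) x l m :
  is_derive f x l -> is_derive g x m -> is_derive (fun t => f t - g t) x (l - m).
Proof. intros Hf Hg. apply (is_derive_minus (V := R_NormedModule) f g x l m Hf Hg). Qed.

Lemma common_radius6 (P : i6 -> R -> Prop) :
  (forall i r r', 0 < r' <= r -> P i r -> P i r') ->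
  (forall i, exists r, 0 < r /\ P i r) -> exists r, 0 < r /\ forall i, P i r.
Proof.
  intros Hm H.
  destruct (common_radius (fun i r => match i with i1 => P r0 r | i2 => P m0 r | i3 => P r1 r | i4 => P m1 r end)) as [r [Hr Hr']].
  - intros []; apply Hm.
  - intros []; apply H.
  - destruct (H r2) as [s [Hs Hs']], (H m2) as [t [Ht Ht']].
    exists (Rmin r (Rmin s t)).
    assert (0 < Rmin r (Rmin s t)) by (repeat apply Rmin_glb_lt; assumption).
    split; [assumption|].
    pose proof (Rmin_l r (Rmin s t)). pose proof (Rmin_r r (Rmin s t)). pose proof (Rmin_l s t). pose proof (Rmin_r s t).
    intros []; [apply (Hm _ r); [lra|apply (Hr' i1)] | apply (Hm _ r); [lra|apply (Hr' i2)]
      | apply (Hm _ r); [lra|apply (Hr' i3)] | apply (Hm _ r); [lra|apply (Hr' i4)]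
      | apply (Hm _ s); [lra|exact Hs'] | apply (Hm _ t); [lra|exact Ht']].
Qed.

(* Transport along the x-axis, then vertically; the x-equation holds off the axis because
   G(x', y) - G(x, y) - (x' - x) A G satisfies the vertical equation up to O((x' - x)^2). *)
Lemma frobenius2 (A B Ay Bx : i6 -> i6 -> R -> R -> R) (x0 y0 r K : R) (u0 : i6 -> R) :
  let Q x y := Rabs (x - x0) < r /\ Rabs (y - y0) < r in
  0 < r -> 0 <= K -> 12 * K * r <= 1 ->
  (forall c d x y, Q x y -> continuous (fun x => A c d x y) x /\ continuous (fun y => B c d x y) y) ->
  (forall c d x y, Q x y -> Rabs (A c d x y) <= K /\ Rabs (B c d x y) <= K /\ Rabs (Bx c d x y) <= K) ->
  (forall c d x y, Q x y -> is_derive (fun y => A c d x y) y (Ay c d x y)) ->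
  (forall c d x x' y, Q x y -> Q x' y -> Rabs (B c d x' y - B c d x y - Bx c d x y * (x' - x)) <= K * (x' - x) ^ 2) ->
  (forall c d x y, Q x y ->
     Ay c d x y + sum6 (fun e => A c e x y * B e d x y) = Bx c d x y + sum6 (fun e => B c e x y * A e d x y)) ->
  exists (G : i6 -> R -> R -> R) (m : R), (forall c, G c x0 y0 = u0 c) /\
    forall c x y, Q x y -> Rabs (G c x y) <= m /\
      is_derive (fun x => G c x y) x (sum6 (fun d => A c d x y * G d x y)) /\
      is_derive (fun y => G c x y) y (sum6 (fun d => B c d x y * G d x y)).
Proof.
  intros Q Hr HK HKr Hcont Hbd HdA HdB Hflat.
  set (m := sum6 (fun c => Rabs (u0 c))).
  assert (Hm : forall c, Rabs (u0 c) <= m).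
  { unfold m, sum6. pose proof (Rabs_pos (u0 r0)). pose proof (Rabs_pos (u0 m0)). pose proof (Rabs_pos (u0 r1)).
    pose proof (Rabs_pos (u0 m1)). pose proof (Rabs_pos (u0 r2)). pose proof (Rabs_pos (u0 m2)). intros []; lra. }
  assert (Pm : 0 <= m) by (eapply Rle_trans; [apply Rabs_pos|apply (Hm r0)]).
  assert (X0 : Rabs (x0 - x0) < r) by (rewrite Rminus_diag, Rabs_R0; exact Hr).
  assert (Y0 : Rabs (y0 - y0) < r) by (rewrite Rminus_diag, Rabs_R0; exact Hr).
  destruct (linear_ode (fun c d x => A c d x y0) x0 r K m u0 Hr HK HKr Hm) as [G0 [G00 HG0]].
  { intros c d t Ht. split; [apply (Hcont c d t y0); split; assumption|apply (Hbd c d t y0); split; assumption]. }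
  assert (Ex : forall x, exists u : i6 -> R -> R, Rabs (x - x0) < r ->
    (forall c, u c y0 = G0 c x) /\
    (forall c t, Rabs (t - y0) < r -> Rabs (u c t) <= 2 * (2 * m) /\ is_derive (u c) t (sum6 (fun d => B c d x t * u d t)))).
  { intro x. destruct (Rlt_dec (Rabs (x - x0)) r) as [Hx|Hx].
    - destruct (linear_ode (fun c d y => B c d x y) y0 r K (2 * m) (fun c => G0 c x) Hr HK HKr) as [u Hu].
      + intro c. apply HG0, Hx.
      + intros c d t Ht. split; [apply (Hcont c d x t); split; assumption|apply (Hbd c d x t); split; assumption].
      + exists u. intros _. exact Hu.
    - exists (fun _ _ => 0). intro; contradiction. }
  (* The vertical solutions are chosen independently of each other, so regularity in x has to be
     recovered by estimates. *)
  set (G := fun c x y => proj1_sig (constructive_indefinite_description _ (Ex x)) c y).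
  assert (HG : forall x, Rabs (x - x0) < r -> (forall c, G c x y0 = G0 c x) /\
    (forall c t, Rabs (t - y0) < r -> Rabs (G c x t) <= 4 * m /\ is_derive (fun y => G c x y) t (sum6 (fun d => B c d x t * G d x t)))).
  { intros x Hx. unfold G. destruct (constructive_indefinite_description _ (Ex x)) as [u Hu]; simpl.
    destruct (Hu Hx) as [H1 H2]. split; [exact H1|]. intros c t Ht. destruct (H2 c t Ht). split; [lra|assumption]. }
  exists G, (4 * m). split.
  { intro c. rewrite (proj1 (HG x0 X0)). apply G00. }
  intros c x y [Hx Hy]. split; [apply HG; assumption|]. split; [|apply HG; assumption].
  (* A Lipschitz constant of B in x: K from the derivative, and 2 K r from the quadratic remainder
     since |x' - x| <= 2r. *)
  set (K3 := K * (1 + 2 * r)).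
  assert (HB1 : forall c d x' y, Rabs (x' - x0) < r -> Rabs (y - y0) < r -> Rabs (B c d x' y - B c d x y) <= K3 * Rabs (x' - x)).
  { intros c' d x' y' Hx' Hy'. pose proof (HdB c' d x x' y' (conj Hx Hy') (conj Hx' Hy')) as H1.
    destruct (Hbd c' d x y' (conj Hx Hy')) as [_ [_ H2]].
    replace (B c' d x' y' - B c' d x y') with ((B c' d x' y' - B c' d x y' - Bx c' d x y' * (x' - x)) + Bx c' d x y' * (x' - x)) by ring.
    eapply Rle_trans; [apply Rabs_triang|]. rewrite Rabs_mult.
    assert (Dx : Rabs (x' - x) <= 2 * r).
    { replace (x' - x) with ((x' - x0) - (x - x0)) by ring. eapply Rle_trans; [apply Rabs_triang|]. rewrite Rabs_Ropp. lra. }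
    pose proof (Rabs_pos (x' - x)) as Px. rewrite <- (pow2_abs (x' - x)) in H1.
    assert (Rabs (Bx c' d x y') * Rabs (x' - x) <= K * Rabs (x' - x)) by (apply Rmult_le_compat_r; assumption).
    assert (K * Rabs (x' - x) * Rabs (x' - x) <= K * Rabs (x' - x) * (2 * r)) by (apply Rmult_le_compat_l; [nra|assumption]).
    unfold K3. nra. }
  assert (HG0x : forall c x', Rabs (x' - x0) < r -> Rabs (G0 c x' - G0 c x) <= 6 * (K * (2 * m)) * Rabs (x' - x)).
  { intros c' x' Hx'.
    destruct (MVT_gen (G0 c') x x' (fun t => sum6 (fun d => A c' d t y0 * G0 d t))) as [z [Hz E]].
    - intros t Ht. apply HG0. apply (interval_convex x0 r x x'); try assumption. lra.
    - intros t Ht. apply continuity_pt_filterlim, (@ex_derive_continuous R_AbsRing R_NormedModule).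
      eexists. apply HG0. apply (interval_convex x0 r x x'); assumption.
    - rewrite E, Rabs_mult. apply Rmult_le_compat_r; [apply Rabs_pos|].
      assert (Hz' : Rabs (z - x0) < r) by (apply (interval_convex x0 r x x'); assumption).
      apply Rabs_sum6_le. intro d. rewrite Rabs_mult. apply Rmult_le_compat; try apply Rabs_pos.
      + apply (Hbd c' d z y0). split; assumption.
      + apply HG0, Hz'. }
  (* The Lipschitz constant of G in x that [ode_estimate] returns for the difference of two vertical
     solutions. *)
  set (C1 := 2 * (6 * (K * (2 * m)) + 6 * (K3 * (4 * m)) * r)).
  assert (PK3 : 0 <= K3) by (unfold K3; nra).
  assert (HG1 : forall x', Rabs (x' - x0) < r -> forall c y, Rabs (y - y0) < r -> Rabs (G c x' y - G c x y) <= C1 * Rabs (x' - x)).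
  { intros x' Hx' c' y' Hy'.
    replace (C1 * Rabs (x' - x)) with (2 * (6 * (K * (2 * m)) * Rabs (x' - x) + (6 * (K3 * Rabs (x' - x) * (4 * m))) * r))
      by (unfold C1; ring).
    apply (ode_estimate (fun c d t => B c d x t) (fun c t => sum6 (fun d => (B c d x' t - B c d x t) * G d x' t))
       (fun c t => G c x' t - G c x t) y0 r K _ _ (8 * m)); auto.
    - intros a b t Ht. apply (Hbd a b x t). split; assumption.
    - intros a t Ht. replace (_ + _) with (sum6 (fun d => B a d x' t * G d x' t) - sum6 (fun d => B a d x t * G d x t))
        by (unfold sum6; ring).
      apply is_derive_minus_R; apply HG; assumption.
    - intros a t Ht. apply Rabs_sum6_le. intro d. apply Rabs_mult_le; [apply HB1; assumption|apply HG; assumption].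
    - intro a. rewrite (proj1 (HG x' Hx')), (proj1 (HG x Hx)). apply HG0x, Hx'.
    - intros a t Ht. eapply Rle_trans; [apply Rabs_triang|]. rewrite Rabs_Ropp.
      destruct (proj2 (HG x Hx) a t Ht), (proj2 (HG x' Hx') a t Ht). lra. }
  set (C2 := 6 * (K * (4 * m)) + 6 * (K * C1)).
  assert (PC1 : 0 <= C1) by (unfold C1; assert (0 <= K * m) by nra; assert (0 <= K3 * m) by nra; nra).
  assert (PC2 : 0 <= C2) by (unfold C2; assert (0 <= K * m) by nra; nra).
  apply is_derive_eps. intros e He.
  destruct (common_radius6 (fun c d => forall h, Rabs h < d ->
     Rabs (G0 c (x + h) - G0 c x - sum6 (fun d => A c d x y0 * G0 d x) * h) <= e / 4 * Rabs h)) as [d [Hd Hd6]].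
  { intros a d d' Hd H h Hh. apply H. lra. }
  { intro a. apply (proj1 (is_derive_eps _ _ _) (proj2 (HG0 a x Hx))); lra. }
  set (d' := Rmin (Rmin d (r - Rabs (x - x0))) (e / (4 * (C2 * r + 1)))).
  assert (PCr : 0 <= C2 * r) by (apply Rmult_le_pos; lra).
  exists d'. split.
  { repeat apply Rmin_glb_lt; [exact Hd|lra|]. apply Rdiv_lt_0_compat; lra. }
  intros h Hh.
  assert (Hh1 : Rabs h < d /\ Rabs h < r - Rabs (x - x0) /\ Rabs h < e / (4 * (C2 * r + 1))).
  { unfold d' in Hh. pose proof (Rmin_l (Rmin d (r - Rabs (x - x0))) (e / (4 * (C2 * r + 1)))).
    pose proof (Rmin_r (Rmin d (r - Rabs (x - x0))) (e / (4 * (C2 * r + 1)))).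
    pose proof (Rmin_l d (r - Rabs (x - x0))). pose proof (Rmin_r d (r - Rabs (x - x0))). lra. }
  destruct Hh1 as [Hh1 [Hh2 Hh3]].
  assert (Hxh : Rabs (x + h - x0) < r).
  { replace (x + h - x0) with ((x - x0) + h) by ring. eapply Rle_lt_trans; [apply Rabs_triang|]. lra. }
  set (x' := x + h) in *.
  assert (Ex' : x' - x = h) by (unfold x'; ring).
  set (D := fun c t => G c x' t - G c x t - h * sum6 (fun d => A c d x t * G d x t)).
  assert (HD : forall c t, Rabs (t - y0) < r -> Rabs (D c t) <= 2 * (e / 4 * Rabs h + C2 * h ^ 2 * r)).
  { apply (ode_estimate (fun c d t => B c d x t)
       (fun c t => sum6 (fun d => (B c d x' t - B c d x t - Bx c d x t * h) * G d x' t)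
                   + h * sum6 (fun d => Bx c d x t * (G d x' t - G d x t)))
       D y0 r K _ _ (8 * m + Rabs h * (6 * (K * (4 * m))))); auto.
    - intros a b t Ht. apply (Hbd a b x t). split; assumption.
    - intros a t Ht.
      (* Flatness enters here: the y-derivative A_y G + A B G of A G becomes B_x G + B A G, which
         makes D a solution of the vertical equation up to terms quadratic in h. *)
      assert (F1 : is_derive (fun t => sum6 (fun d => A a d x t * G d x t)) t
         (sum6 (fun d => (Bx a d x t + sum6 (fun e => B a e x t * A e d x t)) * G d x t))).
      { replace (sum6 _) with (sum6 (fun d => Ay a d x t * G d x t + A a d x t * sum6 (fun e => B d e x t * G e x t))).
        - apply (is_derive_sum6 (fun d t => A a d x t * G d x t)). intro b.
          apply (Derive.is_derive_mult (fun t => A a b x t) (fun t => G b x t)); [apply HdA; split; assumption|apply HG; assumption].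
        - rewrite (sum6_ext (fun d => (Bx a d x t + _) * G d x t) (fun d => (Ay a d x t + sum6 (fun e => A a e x t * B e d x t)) * G d x t))
            by (intro; rewrite Hflat by (split; assumption); reflexivity).
          unfold sum6. ring. }
      replace (_ + _) with (sum6 (fun d => B a d x' t * G d x' t) - sum6 (fun d => B a d x t * G d x t)
         - h * (sum6 (fun d => (Bx a d x t + sum6 (fun e => B a e x t * A e d x t)) * G d x t)))
        by (unfold D, sum6; ring).
      unfold D. apply is_derive_minus_R; [apply is_derive_minus_R; apply HG; assumption|].
      apply (is_derive_scal (fun t => sum6 (fun d => A a d x t * G d x t))), F1.
    - intros a t Ht. eapply Rle_trans; [apply Rabs_triang|].
      assert (Rabs (sum6 (fun d => (B a d x' t - B a d x t - Bx a d x t * h) * G d x' t)) <= 6 * (K * h ^ 2 * (4 * m))).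
      { apply Rabs_sum6_le. intro b. apply Rabs_mult_le; [|apply HG; assumption].
        rewrite <- Ex'. apply HdB; split; assumption. }
      assert (Rabs (h * sum6 (fun d => Bx a d x t * (G d x' t - G d x t))) <= Rabs h * (6 * (K * (C1 * Rabs h)))).
      { rewrite Rabs_mult. apply Rmult_le_compat_l; [apply Rabs_pos|]. apply Rabs_sum6_le. intro b. apply Rabs_mult_le; [apply (Hbd a b x t); split; assumption|].
        rewrite <- Ex'. apply HG1; assumption. }
      replace (C2 * h ^ 2) with (6 * (K * h ^ 2 * (4 * m)) + Rabs h * (6 * (K * (C1 * Rabs h)))); [lra|].
      rewrite <- (pow2_abs h). unfold C2. ring.
    - intro a. unfold D. rewrite (proj1 (HG x' Hxh)), (proj1 (HG x Hx)).
      rewrite (sum6_ext _ (fun d => A a d x y0 * G0 d x)) by (intro; rewrite (proj1 (HG x Hx)); reflexivity).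
      rewrite (Rmult_comm h). apply Hd6, Hh1.
    - intros a t Ht. unfold D. eapply Rle_trans; [apply Rabs_triang|]. apply Rplus_le_compat.
      + eapply Rle_trans; [apply Rabs_triang|]. rewrite Rabs_Ropp.
        destruct (proj2 (HG x Hx) a t Ht), (proj2 (HG x' Hxh) a t Ht). lra.
      + rewrite Rabs_Ropp, Rabs_mult. apply Rmult_le_compat_l; [apply Rabs_pos|]. apply Rabs_sum6_le. intro b. apply Rabs_mult_le; [apply (Hbd a b x t); split; assumption|apply HG; assumption]. }
  specialize (HD c y Hy). unfold D in HD. rewrite (Rmult_comm h) in HD.
  eapply Rle_trans; [exact HD|].
  assert (T : Rabs h * (4 * (C2 * r + 1)) <= e).
  { apply (Rmult_lt_compat_r (4 * (C2 * r + 1))) in Hh3; [|lra].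
    replace (e / (4 * (C2 * r + 1)) * (4 * (C2 * r + 1))) with e in Hh3 by (field; lra). lra. }
  rewrite <- (pow2_abs h). pose proof (Rabs_pos h).
  assert (Rabs h * (Rabs h * (4 * (C2 * r + 1))) <= Rabs h * e) by (apply Rmult_le_compat_l; assumption).
  nra.
Qed.

Lemma sum6_ge_term (f : i6 -> R) i : (forall j, 0 <= f j) -> f i <= sum6 f.
Proof.
  intro H. unfold sum6. pose proof (H r0). pose proof (H m0). pose proof (H r1).
  pose proof (H m1). pose proof (H r2). pose proof (H m2). destruct i; lra.
Qed.

Lemma sum6_nonneg (f : i6 -> R) : (forall j, 0 <= f j) -> 0 <= sum6 f.
Proof. intro H. apply Rle_trans with (f r0); [apply H|apply sum6_ge_term, H]. Qed.

(** By linearity the radius is fixed before the initial value, so several solutions share one box.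
    The solution of the planar problem is extended constantly in z and t, and its smoothness on R^4
    is a bootstrap from the equations. *)
Lemma frobenius (V : pt -> Prop) (A B : i6 -> i6 -> pt -> R) (p0 : pt) : open V -> V p0 ->
  (forall c d, smooth_on V (A c d) /\ smooth_on V (B c d)) ->
  (forall c d p q, p i1 = q i1 -> p i2 = q i2 -> A c d p = A c d q /\ B c d p = B c d q) ->
  (forall p, V p -> forall c d,
     partial i2 (A c d) p + sum6 (fun e => A c e p * B e d p)
     = partial i1 (B c d) p + sum6 (fun e => B c e p * A e d p)) ->
  exists r, 0 < r /\ (forall q, box p0 r q -> V q) /\ forall u0 : i6 -> R,
  exists G : i6 -> pt -> R, (forall c, G c p0 = u0 c) /\ (forall c, smooth_on (box p0 r) (G c)) /\
    forall c p, box p0 r p ->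
      has_partial i1 (G c) p (sum6 (fun d => A c d p * G d p)) /\
      has_partial i2 (G c) p (sum6 (fun d => B c d p * G d p)) /\
      has_partial i3 (G c) p 0 /\ has_partial i4 (G c) p 0.
Proof.
  intros HV Vp HS Hind Hflat.
  set (D1 := fun c d => partial i1 (B c d)). set (D11 := fun c d => partial i1 (D1 c d)).
  assert (HD1 : forall c d, smooth_on V (D1 c d)) by (intros; apply smooth_on_partial, HS).
  assert (HD11 : forall c d, smooth_on V (D11 c d)) by (intros; apply smooth_on_partial, HD1).
  set (T := fun c d p => A c d p ^ 2 + B c d p ^ 2 + D1 c d p ^ 2 + D11 c d p ^ 2).
  set (N := fun p => sum6 (fun c => sum6 (fun d => T c d p))).
  assert (HN : continuous N p0).
  { apply (Ck_continuous 0 V); [|exact Vp]. unfold N, T.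
    apply (Ck_sum6 V 0 (fun c p => sum6 (fun d => A c d p ^ 2 + B c d p ^ 2 + D1 c d p ^ 2 + D11 c d p ^ 2)) HV). intro c.
    apply (Ck_sum6 V 0 (fun d p => A c d p ^ 2 + B c d p ^ 2 + D1 c d p ^ 2 + D11 c d p ^ 2) HV). intro d.
    repeat apply Ck_plus; try exact HV; apply Ck_pow; try exact HV; [apply HS|apply HS|apply HD1|apply HD11]. }
  destruct (proj1 (continuous_box_iff N p0) HN 1 Rlt_0_1) as [ra [Hra HNa]].
  destruct (proj1 (open_box_iff V) HV p0 Vp) as [rb [Hrb HVb]].
  (* On the box N stays below N(p0) + 1, and x^2 <= N implies |x| <= N + 1 <= K for each coefficient
     and derivative collected in N. *)
  set (K := N p0 + 2).
  assert (TP : forall c d p, 0 <= T c d p) by (intros; unfold T; repeat apply Rplus_le_le_0_compat; apply pow2_ge_0).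
  assert (PN : forall p, 0 <= N p) by (intro; unfold N; apply sum6_nonneg; intro; apply sum6_nonneg; intro; apply TP).
  assert (HK : 2 <= K) by (unfold K; specialize (PN p0); lra).
  set (r := Rmin (Rmin ra rb) (/ (12 * K))).
  assert (Hr : 0 < r) by (repeat apply Rmin_glb_lt; try assumption; apply Rinv_0_lt_compat; lra).
  assert (Hr1 : r <= ra) by (eapply Rle_trans; apply Rmin_l).
  assert (Hr2 : r <= rb) by (eapply Rle_trans; [apply Rmin_l|apply Rmin_r]).
  assert (HKr : 12 * K * r <= 1).
  { assert (r <= / (12 * K)) by apply Rmin_r. apply (Rmult_le_compat_l (12 * K)) in H; [|lra]. rewrite Rinv_r in H by lra. lra. }
  assert (BV : forall q, box p0 r q -> V q) by (intros q Bq; apply HVb, (box_mono p0 r); assumption).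
  assert (Bd : forall q c d, box p0 r q -> Rabs (A c d q) <= K /\ Rabs (B c d q) <= K /\ Rabs (D1 c d q) <= K /\ Rabs (D11 c d q) <= K).
  { intros q c d Bq.
    assert (HT : T c d q <= N q).
    { unfold N. eapply Rle_trans; [apply (sum6_ge_term (fun d => T c d q) d)|apply (sum6_ge_term (fun c => sum6 (fun d => T c d q)) c)].
      - intro; apply TP.
      - intro; apply sum6_nonneg; intro; apply TP. }
    assert (HQ : N q < N p0 + 1).
    { assert (Rabs (N q - N p0) < 1) by (apply HNa, (box_mono p0 r); assumption). apply Rabs_def2 in H. lra. }
    unfold T in HT.
    pose proof (pow2_ge_0 (A c d q)). pose proof (pow2_ge_0 (B c d q)). pose proof (pow2_ge_0 (D1 c d q)). pose proof (pow2_ge_0 (D11 c d q)).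
    assert (S : forall x, x ^ 2 <= N q -> Rabs x <= K).
    { intros x Hx. rewrite <- (pow2_abs x) in Hx. pose proof (Rabs_pos x). unfold K. nra. }
    repeat split; apply S; lra. }
  set (P := fun (x y : R) (i : ix) => match i with i1 => x | i2 => y | i3 => p0 i3 | i4 => p0 i4 end).
  assert (BP : forall x y, Rabs (x - p0 i1) < r /\ Rabs (y - p0 i2) < r -> box p0 r (P x y)).
  { intros x y [Hx Hy] []; simpl; try assumption; rewrite Rminus_diag, Rabs_R0; exact Hr. }
  assert (U1 : forall x y s, upd (P x y) i1 s = P s y).
  { intros; apply functional_extensionality; intros []; reflexivity. }
  assert (U2 : forall x y s, upd (P x y) i2 s = P x s).
  { intros; apply functional_extensionality; intros []; reflexivity. }
  assert (Dx : forall f x y, smooth_on V f -> Rabs (x - p0 i1) < r /\ Rabs (y - p0 i2) < r ->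
     is_derive (fun s => f (P s y)) x (partial i1 f (P x y))).
  { intros f x y Hf Hxy. pose proof (smooth_on_has_partial V f i1 (P x y) Hf (BV _ (BP x y Hxy))) as H.
    revert H. apply is_derive_ext. intro s. rewrite U1. reflexivity. }
  assert (Dy : forall f x y, smooth_on V f -> Rabs (x - p0 i1) < r /\ Rabs (y - p0 i2) < r ->
     is_derive (fun s => f (P x s)) y (partial i2 f (P x y))).
  { intros f x y Hf Hxy. pose proof (smooth_on_has_partial V f i2 (P x y) Hf (BV _ (BP x y Hxy))) as H.
    revert H. apply is_derive_ext. intro s. rewrite U2. reflexivity. }
  exists r. split; [exact Hr|]. split; [exact BV|]. intro u0.
  destruct (frobenius2 (fun c d x y => A c d (P x y)) (fun c d x y => B c d (P x y))
     (fun c d x y => partial i2 (A c d) (P x y)) (fun c d x y => D1 c d (P x y)) (p0 i1) (p0 i2) r K u0) as [G [m [G0 HG]]]; auto.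
  - lra.
  - intros c d x y Hxy. split; apply (@ex_derive_continuous R_AbsRing R_NormedModule); eexists.
    + apply (Dx (A c d)); [apply HS|exact Hxy].
    + apply (Dy (B c d)); [apply HS|exact Hxy].
  - intros c d x y Hxy. destruct (Bd (P x y) c d (BP x y Hxy)) as [Q1 [Q2 [Q3 _]]]. auto.
  - intros c d x y Hxy. apply (Dy (A c d)); [apply HS|exact Hxy].
  - intros c d x x' y [Hx Hy] [Hx' _].
    (* The mean value theorem is applied twice; the bound on [D11] yields the quadratic
       remainder. *)
    assert (BVr : Rabs ((B c d (P x' y) - D1 c d (P x y) * (x' - x)) - (B c d (P x y) - D1 c d (P x y) * (x - x)))
      <= K * Rabs (x' - x) * Rabs (x' - x)).
    { destruct (MVT_gen (fun s => B c d (P s y) - D1 c d (P x y) * (s - x)) x x' (fun s => D1 c d (P s y) - D1 c d (P x y))) as [z [Hz E]].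
      - intros s Hs. assert (Hs' : Rabs (s - p0 i1) < r) by (apply (interval_convex (p0 i1) r x x'); try assumption; lra).
        apply is_derive_minus_R; [apply (Dx (B c d)); [apply HS|split; assumption]|].
        auto_derive; [exact I|ring].
      - intros s Hs. assert (Hs' : Rabs (s - p0 i1) < r) by (apply (interval_convex (p0 i1) r x x'); assumption).
        apply continuity_pt_filterlim; apply (@ex_derive_continuous R_AbsRing R_NormedModule (fun s => B c d (P s y) - D1 c d (P x y) * (s - x))).
        eexists. apply is_derive_minus_R; [apply (Dx (B c d)); [apply HS|split; assumption]|].
        auto_derive; [exact I|reflexivity].
      - rewrite E, Rabs_mult. apply Rmult_le_compat_r; [apply Rabs_pos|].
        assert (Hz' : Rabs (z - p0 i1) < r) by (apply (interval_convex (p0 i1) r x x'); assumption).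
        destruct (MVT_gen (fun s => D1 c d (P s y)) x z (fun s => D11 c d (P s y))) as [z' [Hz1 E']].
        + intros s Hs. assert (Hs' : Rabs (s - p0 i1) < r) by (apply (interval_convex (p0 i1) r x z); try assumption; lra).
          apply (Dx (D1 c d)); [apply HD1|split; assumption].
        + intros s Hs. assert (Hs' : Rabs (s - p0 i1) < r) by (apply (interval_convex (p0 i1) r x z); assumption).
          apply continuity_pt_filterlim; apply (@ex_derive_continuous R_AbsRing R_NormedModule (fun s => D1 c d (P s y))).
          eexists. apply (Dx (D1 c d)); [apply HD1|split; assumption].
        + rewrite E', Rabs_mult. apply Rmult_le_compat; try apply Rabs_pos.
          * apply Bd, BP. split; [apply (interval_convex (p0 i1) r x z); assumption|assumption].
          * apply (between_dist x x'), Hz. }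
    rewrite Rmult_assoc in BVr. replace (Rabs (x' - x) * Rabs (x' - x)) with ((x' - x) ^ 2) in BVr by (rewrite <- pow2_abs; ring).
    replace (B c d (P x' y) - B c d (P x y) - D1 c d (P x y) * (x' - x)) with
     ((B c d (P x' y) - D1 c d (P x y) * (x' - x)) - (B c d (P x y) - D1 c d (P x y) * (x - x))) by ring.
    exact BVr.
  - set (g := fun c (p : pt) => G c (p i1) (p i2)).
    assert (HP : forall p, box p0 r p -> forall c,
      has_partial i1 (g c) p (sum6 (fun d => A c d p * g d p)) /\
      has_partial i2 (g c) p (sum6 (fun d => B c d p * g d p)) /\
      has_partial i3 (g c) p 0 /\ has_partial i4 (g c) p 0).
    { intros p Bp c. destruct (HG c (p i1) (p i2) (conj (Bp i1) (Bp i2))) as [_ [H1 H2]].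
      rewrite (sum6_ext _ (fun d => A c d p * g d p)) in H1
        by (intro d; rewrite (proj1 (Hind c d (P (p i1) (p i2)) p eq_refl eq_refl)); reflexivity).
      rewrite (sum6_ext _ (fun d => B c d p * g d p)) in H2
        by (intro d; rewrite (proj2 (Hind c d (P (p i1) (p i2)) p eq_refl eq_refl)); reflexivity).
      split; [exact H1|]. split; [exact H2|].
      split; [exact (@is_derive_const R_AbsRing R_NormedModule (g c p) (p i3))|exact (@is_derive_const R_AbsRing R_NormedModule (g c p) (p i4))]. }
    assert (Hgm : forall p c, box p0 r p -> Rabs (g c p) <= m).
    { intros p c Bp. apply (HG c (p i1) (p i2) (conj (Bp i1) (Bp i2))). }
    assert (Pm : 0 <= m) by (eapply Rle_trans; [apply Rabs_pos|apply (Hgm p0 r0), box_center, Hr]).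
    assert (Hpar : forall p c i, box p0 r p -> Rabs (partial i (g c) p) <= 6 * (K * m)).
    { intros p c i Bp. destruct (HP p Bp c) as [H1 [H2 [H3 H4]]].
      assert (0 <= K * m) by (apply Rmult_le_pos; lra).
      destruct i; erewrite has_partial_partial by eassumption; try (rewrite Rabs_R0; lra);
      apply Rabs_sum6_le; intro d; rewrite Rabs_mult; apply Rmult_le_compat; try apply Rabs_pos; try apply Hgm; try apply Bd; assumption. }
    (* [Ck] asks for joint continuity on R^4; it follows from bounded partial derivatives through
       [mvt4]. *)
    assert (Hc : forall p c, box p0 r p -> continuous (g c) p).
    { intros p c Bp. apply continuous_box_iff. intros e He.
      destruct (proj1 (open_box_iff _) (open_box p0 r) p Bp) as [s [Hs HB]].
      set (K2 := 24 * (K * m) + 1). assert (PK : 0 <= K * m) by (apply Rmult_le_pos; lra).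
      exists (Rmin s (e / K2)). split; [apply Rmin_glb_lt; [exact Hs|apply Rdiv_lt_0_compat; unfold K2; lra]|].
      intros q Bq. destruct (mvt4 (g c) p0 r p q) as [xi [Bxi [_ E]]].
      - exact Bp.
      - apply HB, (box_mono p (Rmin s (e / K2))); [apply Rmin_l|exact Bq].
      - intros w i Bw. destruct (HP w Bw c) as [H1 [H2 [H3 H4]]].
        destruct i; eapply has_partial_ex; eassumption.
      - rewrite E. apply Rle_lt_trans with (sum4 (fun i => 6 * (K * m) * (e / K2))).
        + apply Rabs_sum4_le. intro i. apply Rabs_mult_le; [apply Hpar, Bxi|].
          left. eapply Rlt_le_trans; [apply Bq|apply Rmin_r].
        + assert (Pe : 0 < e / K2) by (apply Rdiv_lt_0_compat; unfold K2; lra).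
          assert (Ee : K2 * (e / K2) = e) by (field; unfold K2; lra).
          set (X := e / K2) in *. clearbody X. unfold sum4. unfold K2 in Ee. lra. }
    exists g. split; [exact G0|]. split; [|intros c p Bp; apply HP, Bp].
    assert (Sm : forall k c, Ck k (box p0 r) (g c)).
    { induction k as [|k IH]; intro c.
      - split; [|exact I]. intros p Bp. apply Hc, Bp.
      - apply Ck_intro with (fun i => match i with i1 => fun p => sum6 (fun d => A c d p * g d p)
          | i2 => fun p => sum6 (fun d => B c d p * g d p) | _ => fun _ => 0 end).
        + apply open_box.
        + intros p Bp. apply Hc, Bp.
        + intros i p Bp. destruct (HP p Bp c) as [H1 [H2 [H3 H4]]]. destruct i; assumption.
        + assert (Ob := open_box p0 r). intros []; try (apply Ck_const, Ob).
          * apply (Ck_sum6 _ k (fun d p => A c d p * g d p) Ob). intro d. apply Ck_mult; [exact Ob| |apply IH].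
            apply (Ck_sub k V); [exact BV|apply HS].
          * apply (Ck_sum6 _ k (fun d p => B c d p * g d p) Ob). intro d. apply Ck_mult; [exact Ob| |apply IH].
            apply (Ck_sub k V); [exact BV|apply HS]. }
    intros c k. apply Sm.
Qed.

(** * The hyperboloid model of the complex ball *)

Inductive c3 : Set := k0 | k1 | k2.

Definition csum3 (f : c3 -> C) : C := (f k0 + f k1 + f k2)%C.

Definition eps (c : c3) : C := match c with k0 => RtoC (-1) | _ => RtoC 1 end.

Definition ckron (c d : c3) : C :=
  match c, d with k0, k0 | k1, k1 | k2, k2 => RtoC 1 | _, _ => RtoC 0 end.

Definition herm (X Y : c3 -> C) : C := csum3 (fun c => (eps c * X c * Cconj (Y c))%C).

(** Here det F det E = 1, and comparison with the adjugate of E shows that F is a two-sided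
    inverse. *)
Lemma left_inverse_right3 (E F : c3 -> c3 -> C) :
  (forall c d, csum3 (fun b => (F c b * E b d)%C) = ckron c d) ->
  forall b d, csum3 (fun c => (E b c * F c d)%C) = ckron b d.
Proof.
  intro H.
  set (det := fun m : c3 -> c3 -> C => (m k0 k0 * (m k1 k1 * m k2 k2 - m k1 k2 * m k2 k1)
     - m k0 k1 * (m k1 k0 * m k2 k2 - m k1 k2 * m k2 k0)
     + m k0 k2 * (m k1 k0 * m k2 k1 - m k1 k1 * m k2 k0))%C).
  assert (D : (det F * det E)%C = RtoC 1).
  { transitivity (det (fun c d => csum3 (fun b => (F c b * E b d)%C))); [unfold det, csum3; ring|].
    unfold det. rewrite !H. unfold ckron. ring. }
  set (adj := fun c b : c3 => match c, b with
    | k0, k0 => (E k1 k1 * E k2 k2 - E k1 k2 * E k2 k1)%C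
    | k0, k1 => (E k0 k2 * E k2 k1 - E k0 k1 * E k2 k2)%C
    | k0, k2 => (E k0 k1 * E k1 k2 - E k0 k2 * E k1 k1)%C
    | k1, k0 => (E k1 k2 * E k2 k0 - E k1 k0 * E k2 k2)%C
    | k1, k1 => (E k0 k0 * E k2 k2 - E k0 k2 * E k2 k0)%C
    | k1, k2 => (E k0 k2 * E k1 k0 - E k0 k0 * E k1 k2)%C
    | k2, k0 => (E k1 k0 * E k2 k1 - E k1 k1 * E k2 k0)%C
    | k2, k1 => (E k0 k1 * E k2 k0 - E k0 k0 * E k2 k1)%C
    | k2, k2 => (E k0 k0 * E k1 k1 - E k0 k1 * E k1 k0)%C end).
  assert (FA : forall c b, (F c b * det E)%C = adj c b).
  { intros c b.
    transitivity (csum3 (fun d => (csum3 (fun n => (F c n * E n d)%C) * adj d b)%C)).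
    - unfold csum3, det, adj. destruct b; ring.
    - unfold csum3 at 1. rewrite !H. destruct c; unfold ckron; ring. }
  intros b d.
  transitivity (det F * (csum3 (fun c => (E b c * (F c d * det E))%C)))%C.
  - transitivity ((det F * det E) * csum3 (fun c => (E b c * F c d)%C))%C; [rewrite D; ring|unfold csum3; ring].
  - transitivity (det F * (det E * ckron b d))%C.
    + f_equal. unfold csum3. rewrite !FA. unfold adj, det, ckron. destruct b, d; ring.
    + transitivity ((det F * det E) * ckron b d)%C; [ring|]. rewrite D. ring.
Qed.

(** Parallel transport controls products of solutions, which are the columns of the matrix, whereas
    the frame vectors are its rows. A pseudo-unitary matrix is so on both sides. *)
Lemma unitary_rows (e : c3 -> c3 -> C) :
  (forall c d, csum3 (fun b => (eps b * Cconj (e b c) * e b d)%C) = (eps c * ckron c d)%C) ->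
  forall b d, herm (e b) (e d) = (eps b * ckron b d)%C.
Proof.
  intros H b d.
  pose proof (left_inverse_right3 e (fun c b => (eps c * eps b * Cconj (e b c))%C)) as K.
  assert (K' : csum3 (fun c => (e b c * (eps c * eps d * Cconj (e d c)))%C) = ckron b d).
  { apply K. intros c n.
    transitivity (eps c * csum3 (fun b0 => (eps b0 * Cconj (e b0 c) * e b0 n)%C))%C; [unfold csum3; ring|].
    rewrite H. destruct c, n; unfold eps, ckron; rewrite <- ?RtoC_mult; f_equal; ring. }
  transitivity (eps d * csum3 (fun c => (e b c * (eps c * eps d * Cconj (e d c)))%C))%C.
  - unfold herm, csum3, eps. destruct d; ring.
  - rewrite K'. destruct b, d; unfold eps, ckron; ring.
Qed.

Definition lincomb (x : c3 -> C) (e : c3 -> c3 -> C) (c : c3) : C := csum3 (fun b => (x b * e b c)%C).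

Lemma herm_lincomb (e : c3 -> c3 -> C) x y :
  (forall b d, herm (e b) (e d) = (eps b * ckron b d)%C) -> herm (lincomb x e) (lincomb y e) = herm x y.
Proof.
  intro H.
  transitivity (csum3 (fun b => csum3 (fun d => (x b * Cconj (y d) * herm (e b) (e d))%C))).
  - unfold herm, lincomb, csum3. rewrite !Cplus_conj, !Cmult_conj. ring.
  - unfold csum3. rewrite !H. unfold herm, csum3, ckron, eps. ring.
Qed.

(* X and Y are the differentials of v = v_0 (1, w) when dw is xi, respectively up. *)
Lemma ball_pullback (a : R) (w xi up : pt) (v X Y : c3 -> C) :
  let cw k := match k with k1 => (w i1, w i2) | _ => (w i3, w i4) end : C in
  let cxi k := match k with k1 => (xi i1, xi i2) | _ => (xi i3, xi i4) end : C in
  let cup k := match k with k1 => (up i1, up i2) | _ => (up i3, up i4) end : C in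
  a <> 0 ->
  (forall k, k <> k0 -> v k = (cw k * v k0)%C) ->
  (forall k, k <> k0 -> X k = (cxi k * v k0 + cw k * X k0)%C) ->
  (forall k, k <> k0 -> Y k = (cup k * v k0 + cw k * Y k0)%C) ->
  (fst (v k0) ^ 2 + snd (v k0) ^ 2) * (1 - norm2 w) = 1 ->
  sum4 (fun k => sum4 (fun l => ball_metric a w k l * xi k * up l))
  = / a ^ 2 * fst (herm X Y + herm X v * herm v Y)%C.
Proof.
  intros cw cxi cup ha Hv HX HY HN.
  unfold herm, csum3.
  rewrite (HX k1), (HX k2), (HY k1), (HY k2), (Hv k1), (Hv k2) by discriminate. clear HX HY Hv.
  destruct (v k0) as [p q], (X k0) as [x0 x1], (Y k0) as [y0 y1]. simpl in HN.
  set (w1 := w i1) in *. set (w2 := w i2) in *. set (w3 := w i3) in *. set (w4 := w i4) in *.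
  set (s := norm2 w - 1).
  (* Oriented for [ring]: w4^2 and p^2 s are the monomials to eliminate, with s = |w|^2 - 1. *)
  assert (Hw : w4 ^ 2 = s + 1 - w1 ^ 2 - w2 ^ 2 - w3 ^ 2) by (unfold s, norm2, sum4; fold w1 w2 w3 w4; ring).
  assert (Hs : p ^ 2 * s = - 1 - q ^ 2 * s) by (unfold s; lra).
  assert (Q1 : 1 - norm2 w <> 0) by (intro Z; rewrite Z in HN; lra).
  assert (B : forall k l, ball_metric a w k l = / a ^ 2 * (kron k l * (p ^ 2 + q ^ 2) + (w k * w l + mul_I w k * mul_I w l) * (p ^ 2 + q ^ 2) ^ 2)).
  { intros k l. unfold ball_metric. f_equal.
    assert (I1 : / (1 - norm2 w) = p ^ 2 + q ^ 2).
    { apply Rmult_eq_reg_r with (1 - norm2 w); [|exact Q1]. rewrite Rinv_l by exact Q1. lra. }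
    unfold Rdiv. rewrite <- pow_inv, I1. reflexivity. }
  transitivity (/ a ^ 2 * sum4 (fun k => sum4 (fun l => (kron k l * (p ^ 2 + q ^ 2) + (w k * w l + mul_I w k * mul_I w l) * (p ^ 2 + q ^ 2) ^ 2) * xi k * up l))).
  { rewrite (sum4_ext _ (fun k => sum4 (fun l => / a ^ 2 * (kron k l * (p ^ 2 + q ^ 2) + (w k * w l + mul_I w k * mul_I w l) * (p ^ 2 + q ^ 2) ^ 2) * xi k * up l)))
      by (intro; apply sum4_ext; intro; rewrite B; reflexivity).
    unfold sum4. ring. }
  f_equal. unfold sum4, kron, mul_I, cw, cxi, cup, eps. cbn -[pow]. fold w1 w2 w3 w4. clearbody s.
  generalize (xi i1) (xi i2) (xi i3) (xi i4) (up i1) (up i2) (up i3) (up i4). intros.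
  ring [Hw Hs].
Qed.

Section BallMap.
Variables (a : R) (ha : a <> 0) (V : pt -> Prop) (HV : open V) (vr vi : c3 -> pt -> R).
Hypothesis vr_smooth : forall k, smooth_on V (vr k).
Hypothesis vi_smooth : forall k, smooth_on V (vi k).
Let v p k : C := (vr k p, vi k p).
Hypothesis v_unit : forall p, V p -> herm (v p) (v p) = RtoC (-1).

Let D p := vr k0 p * vr k0 p + vi k0 p * vi k0 p.

(** The affine chart (v_1 / v_0, v_2 / v_0), each quotient written as v_k times the conjugate of v_0
    over |v_0|^2. *)
Definition ball_map (p : pt) (j : ix) : R :=
  match j with
  | i1 => (vr k1 p * vr k0 p + vi k1 p * vi k0 p) / D p
  | i2 => (vi k1 p * vr k0 p - vr k1 p * vi k0 p) / D p
  | i3 => (vr k2 p * vr k0 p + vi k2 p * vi k0 p) / D p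
  | i4 => (vi k2 p * vr k0 p - vr k2 p * vi k0 p) / D p
  end.

(** In signature (-, +, +) the normalisation gives |v_0| >= 1, so the chart is defined everywhere,
    and it puts the quotients inside the ball. *)
Lemma unit_eq p : V p -> D p = 1 + vr k1 p ^ 2 + vi k1 p ^ 2 + vr k2 p ^ 2 + vi k2 p ^ 2.
Proof.
  intro Vp. pose proof (f_equal fst (v_unit p Vp)) as E.
  unfold herm, csum3, eps, v in E. simpl in E. unfold D. lra.
Qed.

Lemma denom_pos p : V p -> 0 < D p.
Proof.
  intro Vp. rewrite unit_eq by exact Vp.
  pose proof (pow2_ge_0 (vr k1 p)). pose proof (pow2_ge_0 (vi k1 p)).
  pose proof (pow2_ge_0 (vr k2 p)). pose proof (pow2_ge_0 (vi k2 p)). lra.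
Qed.

Lemma ball_map_norm p : V p -> D p * (1 - norm2 (ball_map p)) = 1.
Proof.
  intro Vp. pose proof (denom_pos p Vp) as P. pose proof (unit_eq p Vp) as E.
  assert (N : norm2 (ball_map p) = (vr k1 p ^ 2 + vi k1 p ^ 2 + vr k2 p ^ 2 + vi k2 p ^ 2) / D p).
  { unfold norm2, sum4, ball_map. unfold D in *. field. lra. }
  rewrite N.
  replace (vr k1 p ^ 2 + vi k1 p ^ 2 + vr k2 p ^ 2 + vi k2 p ^ 2) with (D p - 1) by lra. field. lra.
Qed.

Lemma ball_map_ball p : V p -> ball2 (ball_map p).
Proof.
  intro Vp. pose proof (ball_map_norm p Vp) as E. pose proof (denom_pos p Vp).
  unfold ball2. destruct (Rlt_le_dec (norm2 (ball_map p)) 1); [assumption|].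
  assert (D p * (1 - norm2 (ball_map p)) <= 0) by nra. lra.
Qed.

Lemma ball_map_smooth : smooth_vec_on V ball_map.
Proof.
  intros j k. assert (Ck k V (fun p => vr k0 p * vr k0 p + vi k0 p * vi k0 p)) as KD.
  { apply Ck_plus; [exact HV| |]; apply Ck_mult; try exact HV; first [apply vr_smooth|apply vi_smooth]. }
  assert (N : forall p, V p -> vr k0 p * vr k0 p + vi k0 p * vi k0 p <> 0).
  { intros p Vp. apply Rgt_not_eq, denom_pos, Vp. }
  unfold ball_map, D. destruct j; cbn -[Ck];
    (apply Ck_div; [exact HV|exact N| |exact KD]);
    (apply Ck_minus || apply Ck_plus); try exact HV; apply Ck_mult; try exact HV; first [apply vr_smooth|apply vi_smooth].
Qed.

Let X p i k : C := (partial i (vr k) p, partial i (vi k) p).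

Lemma ball_map_partial p i : V p ->
  let xi j := partial i (fun q => ball_map q j) p in
  X p i k1 = Cplus (Cmult (xi i1, xi i2) (v p k0)) (Cmult (ball_map p i1, ball_map p i2) (X p i k0)) /\
  X p i k2 = Cplus (Cmult (xi i3, xi i4) (v p k0)) (Cmult (ball_map p i3, ball_map p i4) (X p i k0)).
Proof.
  intros Vp xi.
  assert (Er : forall k, has_partial i (vr k) p (partial i (vr k) p))
    by (intro k; apply (smooth_on_has_partial V); [apply vr_smooth|exact Vp]).
  assert (Ei : forall k, has_partial i (vi k) p (partial i (vi k) p))
    by (intro k; apply (smooth_on_has_partial V); [apply vi_smooth|exact Vp]).
  assert (Ew : forall j, has_partial i (fun q => ball_map q j) p (xi j))
    by (intro j; apply (smooth_on_has_partial V); [apply ball_map_smooth|exact Vp]).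
  (* It suffices to differentiate w v0 = v. *)
  assert (W : forall q, V q ->
     vr k1 q = ball_map q i1 * vr k0 q - ball_map q i2 * vi k0 q /\ vi k1 q = ball_map q i1 * vi k0 q + ball_map q i2 * vr k0 q /\
     vr k2 q = ball_map q i3 * vr k0 q - ball_map q i4 * vi k0 q /\ vi k2 q = ball_map q i3 * vi k0 q + ball_map q i4 * vr k0 q).
  { intros q Vq. pose proof (denom_pos q Vq) as P. unfold ball_map. unfold D in *. repeat split; field; lra. }
  assert (L : forall j j' k, (forall q, V q -> vr k q = ball_map q j * vr k0 q - ball_map q j' * vi k0 q) ->
     partial i (vr k) p = xi j * vr k0 p + ball_map p j * partial i (vr k0) p - (xi j' * vi k0 p + ball_map p j' * partial i (vi k0) p)).
  { intros j j' k Hk. rewrite (partial_ext_open V _ (fun q => ball_map q j * vr k0 q - ball_map q j' * vi k0 q)); auto.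
    apply has_partial_partial. apply has_partial_minus; apply has_partial_mult with (f := fun q => ball_map q _); auto. }
  assert (L' : forall j j' k, (forall q, V q -> vi k q = ball_map q j * vi k0 q + ball_map q j' * vr k0 q) ->
     partial i (vi k) p = xi j * vi k0 p + ball_map p j * partial i (vi k0) p + (xi j' * vr k0 p + ball_map p j' * partial i (vr k0) p)).
  { intros j j' k Hk. rewrite (partial_ext_open V _ (fun q => ball_map q j * vi k0 q + ball_map q j' * vr k0 q)); auto.
    apply has_partial_partial. apply has_partial_plus; apply has_partial_mult with (f := fun q => ball_map q _); auto. }
  split; unfold X, v, Cplus, Cmult; cbn [fst snd]; f_equal.
  - rewrite (L i1 i2 k1 (fun q Vq => proj1 (W q Vq))). ring.
  - rewrite (L' i1 i2 k1 (fun q Vq => proj1 (proj2 (W q Vq)))). ring.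
  - rewrite (L i3 i4 k2 (fun q Vq => proj1 (proj2 (proj2 (W q Vq))))). ring.
  - rewrite (L' i3 i4 k2 (fun q Vq => proj2 (proj2 (proj2 (W q Vq))))). ring.
Qed.

(** Because <v, v> = - 1, the product on the right removes the components of the two tangent vectors
    along v, which the chart does not see. *)
Lemma ball_map_pullback p i j : V p ->
  sum4 (fun k => sum4 (fun l => ball_metric a (ball_map p) k l
     * partial i (fun q => ball_map q k) p * partial j (fun q => ball_map q l) p))
  = / a ^ 2 * fst (herm (X p i) (X p j) + herm (X p i) (v p) * herm (v p) (X p j))%C.
Proof.
  intro Vp.
  apply (ball_pullback a (ball_map p) (fun k => partial i (fun q => ball_map q k) p) (fun k => partial j (fun q => ball_map q k) p)
    (v p) (X p i) (X p j) ha).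
  - intros k Hk. pose proof (denom_pos p Vp) as P. unfold v, Cmult. unfold D in P.
    destruct k; [contradiction| |]; unfold ball_map; cbn [fst snd]; f_equal; unfold D; field; lra.
  - intros k Hk. destruct (ball_map_partial p i Vp) as [E1 E2]. destruct k; [contradiction|exact E1|exact E2].
  - intros k Hk. destruct (ball_map_partial p j Vp) as [E1 E2]. destruct k; [contradiction|exact E1|exact E2].
  - transitivity (D p * (1 - norm2 (ball_map p))); [unfold v, D; cbn [fst snd]; ring|apply ball_map_norm, Vp].
Qed.

Lemma ball_map_locally_isometric (M : pt -> Prop) (g : metric) p : V p -> (forall q, V q -> M q) ->
  (forall q, V q -> det4 (g q) <> 0) ->
  (forall q i j, V q -> g q i j = / a ^ 2 * fst (herm (X q i) (X q j) + herm (X q i) (v q) * herm (v q) (X q j))%C) ->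
  exists (V' W : (ix -> R) -> Prop) (F G : pt -> pt),
    open V' /\ open W /\ V' p /\
    (forall q, V' q -> M q) /\ (forall q, W q -> ball2 q) /\
    smooth_vec_on V' F /\ smooth_vec_on W G /\
    (forall q, V' q -> W (F q) /\ forall i, G (F q) i = q i) /\
    (forall q, W q -> V' (G q) /\ forall i, F (G q) i = q i) /\
    (forall q, V' q -> forall i j,
       g q i j = sum4 (fun k => sum4 (fun l =>
         ball_metric a (F q) k l * partial i (fun r => F r k) q * partial j (fun r => F r l) q))).
Proof.
  intros Vp VM gdet Hg.
  assert (Iso : forall q, V q -> forall i j,
       g q i j = sum4 (fun k => sum4 (fun l =>
         ball_metric a (ball_map q) k l * partial i (fun r => ball_map r k) q * partial j (fun r => ball_map r l) q))).
  { intros q Vq i j. rewrite ball_map_pullback by exact Vq. apply Hg, Vq. }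
  destruct (inverse_function V ball_map HV ball_map_smooth) with (p := p) as [V' [W [G [O1 [O2 [P1 [P2 [P3 [P4 P5]]]]]]]]].
  - intros q Vq Z. apply (gdet q Vq).
    set (DF := fun k i => partial i (fun r => ball_map r k) q) in *.
    (* det g is (det DF)^2 times the determinant of the ball metric, so nondegeneracy of g makes the
       Jacobian invertible. *)
    transitivity (det4 (fun i j => sum4 (fun k => DF k i * sum4 (fun l => ball_metric a (ball_map q) k l * DF l j)))).
    + f_equal. apply functional_extensionality; intro i; apply functional_extensionality; intro j.
      rewrite Iso by exact Vq. unfold DF, sum4. ring.
    + rewrite (det4_mul (fun i k => DF k i) (fun k j => sum4 (fun l => ball_metric a (ball_map q) k l * DF l j))).
      rewrite (det4_mul (ball_metric a (ball_map q)) DF). rewrite Z. ring.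
  - exact Vp.
  - exists V', W, ball_map, G. repeat split; auto.
    + intros w Ww. destruct (P5 w Ww) as [Vw Ew].
      replace w with (ball_map (G w)) by (apply functional_extensionality; exact Ew).
      apply ball_map_ball, P2, Vw.
    + intros j k. apply Ck_sub with V; [exact P2|apply ball_map_smooth].
    + apply P4; assumption.
    + intros i. apply P4; assumption.
    + apply P5; assumption.
    + intros i. apply P5; assumption.
Qed.
End BallMap.

(** * The Frenet frame of a holomorphic curve in the ball *)

Section Frenet.
Variables (a : R) (ha : a <> 0) (U : R * R -> Prop) (U_open : open U) (h H : R -> R -> R).
Hypothesis h_pos : forall x y, U (x, y) -> 0 < h x y.
Hypothesis H_pos : forall x y, U (x, y) -> 0 < H x y.
Hypothesis h_smooth : smooth2 U h.
Hypothesis H_smooth : smooth2 U H.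
Hypothesis H_eq : forall x y, U (x, y) ->
  laplacian (fun u v => ln (H u v)) x y = 2 * a ^ 2 * h x y ^ 2 + 4 * a ^ 2 * H x y ^ 2.
Hypothesis h_eq : forall x y, U (x, y) ->
  laplacian (fun u v => ln (h u v)) x y = - 4 * a ^ 2 * h x y ^ 2 - 2 * a ^ 2 * H x y ^ 2.


Definition lx (f : R -> R -> R) p := lift2 (ddx f) p / lift2 f p.
Definition ly (f : R -> R -> R) p := lift2 (ddy f) p / lift2 f p.

(** The phases are the trace-free solution of phi_1 - phi_0 = star d ln H and phi_2 - phi_1 = star d
    ln h, where star df = f_x dy - f_y dx; hence the factor 1/3. These two relations are what d eta
    and d mu require. *)
Definition phix (b : c3) (p : pt) : R := / 3 *
  match b with k0 => 2 * ly H p + ly h p | k1 => ly h p - ly H p | k2 => - (ly H p + 2 * ly h p) end.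
Definition phiy (b : c3) (p : pt) : R := / 3 *
  match b with k0 => - (2 * lx H p + lx h p) | k1 => lx H p - lx h p | k2 => lx H p + 2 * lx h p end.

(* The su(2,1)-connection de_0 = i phi_0 e_0 + eta e_1, de_1 = conj(eta) e_0 + i phi_1 e_1 + mu e_2,
   de_2 = - conj(mu) e_1 + i phi_2 e_2, with eta = - a H (dx + i dy), mu = a h (dx + i dy);
   it is flat by the equations for ln h and ln H. *)
Definition frenx (c d : i6) (p : pt) : R :=
  match c, d with
  | r0, m0 => - phix k0 p | m0, r0 => phix k0 p
  | r1, m1 => - phix k1 p | m1, r1 => phix k1 p
  | r2, m2 => - phix k2 p | m2, r2 => phix k2 p
  | r0, r1 | m0, m1 | r1, r0 | m1, m0 => - (a * lift2 H p)
  | r1, r2 | m1, m2 => a * lift2 h p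
  | r2, r1 | m2, m1 => - (a * lift2 h p)
  | _, _ => 0
  end.
Definition freny (c d : i6) (p : pt) : R :=
  match c, d with
  | r0, m0 => - phiy k0 p | m0, r0 => phiy k0 p
  | r1, m1 => - phiy k1 p | m1, r1 => phiy k1 p
  | r2, m2 => - phiy k2 p | m2, r2 => phiy k2 p
  | r0, m1 | m1, r0 => a * lift2 H p
  | m0, r1 | r1, m0 => - (a * lift2 H p)
  | r1, m2 | r2, m1 => - (a * lift2 h p)
  | m1, r2 | m2, r1 => a * lift2 h p
  | _, _ => 0
  end.

Let V := dom2 U.
Let HV : open V := open_dom2 U U_open.
Let sH1 : smooth2 U (ddx H) := smooth2_ddx U H H_smooth.
Let sH2 : smooth2 U (ddy H) := smooth2_ddy U H H_smooth.
Let sh1 : smooth2 U (ddx h) := smooth2_ddx U h h_smooth.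
Let sh2 : smooth2 U (ddy h) := smooth2_ddy U h h_smooth.

Lemma Hf_neq p : V p -> lift2 H p <> 0.
Proof. intro Vp. apply Rgt_not_eq, H_pos, Vp. Qed.
Lemma hf_neq p : V p -> lift2 h p <> 0.
Proof. intro Vp. apply Rgt_not_eq, h_pos, Vp. Qed.

Lemma smooth_lift2_V f : smooth2 U f -> smooth_on V (lift2 f).
Proof. intros Hf' k. apply Ck_lift2; auto. Qed.

Lemma log_smooth : (smooth_on V (lx H) /\ smooth_on V (ly H)) /\ (smooth_on V (lx h) /\ smooth_on V (ly h)).
Proof.
  repeat split; intro k; unfold lx, ly; apply Ck_div; try exact HV; try apply smooth_lift2_V; auto;
    first [apply Hf_neq|apply hf_neq].
Qed.

Lemma phi_smooth b : smooth_on V (phix b) /\ smooth_on V (phiy b).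
Proof.
  destruct log_smooth as [[S1 S2] [S3 S4]].
  split; intro k; unfold phix, phiy; (apply Ck_mult; [exact HV|apply Ck_const, HV|]); destruct b;
  repeat first [ apply S1 | apply S2 | apply S3 | apply S4 | ck_step; [exact HV|..] ].
Qed.

Lemma fren_smooth c d : smooth_on V (frenx c d) /\ smooth_on V (freny c d).
Proof.
  assert (SX : forall b k, Ck k V (phix b)) by (intros; apply phi_smooth).
  assert (SY : forall b k, Ck k V (phiy b)) by (intros; apply phi_smooth).
  split; intro k; destruct c, d; unfold frenx, freny; cbv beta iota;
  repeat first [ apply SX | apply SY | apply smooth_lift2_V; assumption | ck_step; [exact HV|..] ].
Qed.

Lemma laplacian_solve f p L : (forall x y, U (x, y) -> 0 < f x y) -> smooth2 U f -> V p ->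
  laplacian (fun u v => ln (f u v)) (p i1) (p i2) = L ->
  lift2 (ddx (ddx f)) p = L * lift2 f p - lift2 (ddy (ddy f)) p + (lift2 (ddx f) p ^ 2 + lift2 (ddy f) p ^ 2) / lift2 f p.
Proof.
  intros fpos fs Vp HL. rewrite (laplacian_ln U f) in HL by auto. rewrite <- HL. unfold lift2.
  field. apply Rgt_not_eq, fpos, Vp.
Qed.

(** Off the complex diagonal, flatness holds by the choice of the phases, or because eta and mu are
    both multiples of dx + i dy. On it, the densities of d phi_0, d phi_1, d phi_2 must be - 2a^2
    H^2, 2a^2 (H^2 + h^2) and - 2a^2 h^2, which are combinations of [H_eq] and [h_eq]. *)
Lemma fren_flat p : V p -> forall c d,
     partial i2 (frenx c d) p + sum6 (fun e => frenx c e p * freny e d p)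
     = partial i1 (freny c d) p + sum6 (fun e => freny c e p * frenx e d p).
Proof.
  intros Vp c d.
  pose proof (laplacian_solve H p _ H_pos H_smooth Vp (H_eq _ _ Vp)) as LH.
  pose proof (laplacian_solve h p _ h_pos h_smooth Vp (h_eq _ _ Vp)) as Lh.
  pose proof (Hf_neq p Vp) as H0. pose proof (hf_neq p Vp) as h0.
  change (H (p i1) (p i2)) with (lift2 H p) in *. change (h (p i1) (p i2)) with (lift2 h p) in *.
  assert (X : forall l m, has_partial i2 (frenx c d) p l -> has_partial i1 (freny c d) p m ->
     l + sum6 (fun e => frenx c e p * freny e d p) = m + sum6 (fun e => freny c e p * frenx e d p) ->
     partial i2 (frenx c d) p + sum6 (fun e => frenx c e p * freny e d p)
     = partial i1 (freny c d) p + sum6 (fun e => freny c e p * frenx e d p)).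
  { intros l m Hl Hm E. rewrite (has_partial_partial _ _ _ _ Hl), (has_partial_partial _ _ _ _ Hm). exact E. }
  destruct c, d;
  (eapply X; [unfold frenx, phix, lx, ly, Rdiv; hp; first [exact H0|exact h0]
    |unfold freny, phiy, lx, ly, Rdiv; hp; first [exact H0|exact h0]|];
   cbn -[sum6 lift2]; rewrite ?LH, ?Lh; unfold sum6; cbn -[lift2]; unfold phix, phiy, lx, ly;
   first [ring | field; auto]).
Qed.

Definition re6 (b : c3) : i6 := match b with k0 => r0 | k1 => r1 | k2 => r2 end.
Definition im6 (b : c3) : i6 := match b with k0 => m0 | k1 => m1 | k2 => m2 end.

(** A single solution of the linear system collects one coordinate of all three frame vectors: G k
    holds the k-th coordinates of e_0, e_1, e_2. *)
Definition frame_vec (G : c3 -> i6 -> pt -> R) (p : pt) (b k : c3) : C := (G k (re6 b) p, G k (im6 b) p).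

Lemma constant_of_partials r p0 (f : pt -> R) : 0 < r ->
  (forall p i, box p0 r p -> has_partial i f p 0) -> forall p, box p0 r p -> f p = f p0.
Proof.
  intros Hr Hf p Bp.
  destruct (mvt4 f p0 r p0 p) as [xi [Bxi [_ E]]]; auto using box_center.
  - intros w i Bw. eapply has_partial_ex, Hf, Bw.
  - unfold sum4 in E. rewrite !(has_partial_partial _ f _ 0) in E by (apply Hf, Bxi). lra.
Qed.

Definition parallel (r : R) (p0 : pt) (G : i6 -> pt -> R) : Prop :=
  forall c p, box p0 r p ->
    has_partial i1 (G c) p (sum6 (fun d => frenx c d p * G d p)) /\
    has_partial i2 (G c) p (sum6 (fun d => freny c d p * G d p)) /\
    has_partial i3 (G c) p 0 /\ has_partial i4 (G c) p 0.

Lemma parallel_partial r p0 G i c p : parallel r p0 G -> box p0 r p ->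
  has_partial i (G c) p (match i with i1 => sum6 (fun d => frenx c d p * G d p)
    | i2 => sum6 (fun d => freny c d p * G d p) | _ => 0 end).
Proof. intros PG Bp. destruct (PG c p Bp) as [Q1 [Q2 [Q3 Q4]]]. destruct i; assumption. Qed.

(* The connection matrices lie in su(2,1). *)
Lemma parallel_form_constant r p0 F G p : 0 < r -> parallel r p0 F -> parallel r p0 G -> box p0 r p ->
  let form q := csum3 (fun b => (eps b * Cconj (F (re6 b) q, F (im6 b) q) * (G (re6 b) q, G (im6 b) q))%C) in
  form p = form p0.
Proof.
  intros Hr PF PG Bp form.
  set (hre := fun q => - (F r0 q * G r0 q + F m0 q * G m0 q) + (F r1 q * G r1 q + F m1 q * G m1 q)
     + (F r2 q * G r2 q + F m2 q * G m2 q)).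
  set (him := fun q => - (F r0 q * G m0 q - F m0 q * G r0 q) + (F r1 q * G m1 q - F m1 q * G r1 q)
     + (F r2 q * G m2 q - F m2 q * G r2 q)).
  assert (E : forall q, form q = (hre q, him q)).
  { intro q. unfold form, csum3, eps, hre, him, Cconj, Cplus, Cmult, RtoC. cbn. f_equal; ring. }
  rewrite !E.
  f_equal; apply (constant_of_partials r); auto; intros q i Bq; eapply has_partial_eq.
  1: unfold hre; hp; lazymatch goal with |- context [F] => apply (parallel_partial r p0 F) | _ => apply (parallel_partial r p0 G) end; assumption.
  2: unfold him; hp; lazymatch goal with |- context [F] => apply (parallel_partial r p0 F) | _ => apply (parallel_partial r p0 G) end; assumption.
  all: destruct i; unfold sum6; cbn; ring.
Qed.

Lemma frenet_frame p0 : V p0 -> exists r (G : c3 -> i6 -> pt -> R), 0 < r /\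
  (forall k c, smooth_on (box p0 r) (G k c)) /\ (forall k, parallel r p0 (G k)) /\
  (forall p, box p0 r p -> forall b d, herm (frame_vec G p b) (frame_vec G p d) = (eps b * ckron b d)%C).
Proof.
  intro Vp0.
  destruct (frobenius V frenx freny p0 HV Vp0 fren_smooth) as [r [Hr [_ HG]]].
  { intros c d p q E1 E2. unfold frenx, freny, phix, phiy, lx, ly, lift2. rewrite E1, E2. split; reflexivity. }
  { apply fren_flat. }
  (* At p0 the frame is the standard basis of C^{2,1}, which is pseudo-unitary. *)
  set (u0 := fun (k : c3) (c : i6) => match k, c with k0, r0 | k1, r1 | k2, r2 => 1 | _, _ => 0 end).
  set (G := fun k => proj1_sig (constructive_indefinite_description _ (HG (u0 k)))).
  assert (GP : forall k, (forall c, G k c p0 = u0 k c) /\ (forall c, smooth_on (box p0 r) (G k c)) /\ parallel r p0 (G k)).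
  { intro k. unfold G. destruct (constructive_indefinite_description _ (HG (u0 k))) as [g Hg]. exact Hg. }
  exists r, G. split; [exact Hr|]. split; [intro k; apply GP|]. split; [intro k; apply GP|].
  intros p Bp. apply unitary_rows. intros k l.
  etransitivity; [apply (parallel_form_constant r p0 (G k) (G l) p Hr); [apply GP|apply GP|exact Bp]|].
  cbv beta. unfold csum3, re6, im6. rewrite !(fun c => proj1 (GP k) c), !(fun c => proj1 (GP l) c).
  destruct k, l; unfold u0, eps, ckron, Cconj, Cplus, Cmult, RtoC; cbn; f_equal; ring.
Qed.

(* The point of the hyperboloid: v = cosh(az) e_0 + sinh(az) e^{2iat} e_1. *)
Definition nvec (p : pt) (b : c3) : C :=
  match b with k0 => (ch a p, 0) | k1 => (sh a p * cs a p, sh a p * sn a p) | k2 => (0, 0) end.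

(** Components of the coordinate derivatives of v in the moving frame: the derivative of [nvec] plus
    the connection applied to it. *)
Definition nutan (p : pt) (i : ix) (b : c3) : C :=
  let aH := a * lift2 H p in let ah := a * lift2 h p in
  match i, b with
  | i1, k0 => (- (sh a p * cs a p * aH), ch a p * phix k0 p - sh a p * sn a p * aH)
  | i1, k1 => (- (ch a p * aH) - sh a p * sn a p * phix k1 p, sh a p * cs a p * phix k1 p)
  | i1, k2 => (sh a p * cs a p * ah, sh a p * sn a p * ah)
  | i2, k0 => (- (sh a p * sn a p * aH), ch a p * phiy k0 p + sh a p * cs a p * aH)
  | i2, k1 => (- (sh a p * sn a p * phiy k1 p), sh a p * cs a p * phiy k1 p - ch a p * aH)
  | i2, k2 => (- (sh a p * sn a p * ah), sh a p * cs a p * ah)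
  | i3, k0 => (a * sh a p, 0)
  | i3, k1 => (a * ch a p * cs a p, a * ch a p * sn a p)
  | i4, k1 => (- (2 * a * sh a p * sn a p), 2 * a * sh a p * cs a p)
  | _, _ => (0, 0)
  end.

Lemma herm_nvec p : herm (nvec p) (nvec p) = RtoC (-1).
Proof.
  pose proof (ch_sq a p) as E1. pose proof (cs_sq a p) as E2.
  unfold herm, csum3, nvec, eps, Cconj, Cmult, Cplus, RtoC. cbn -[sh ch sn cs]. f_equal; ring [E1 E2].
Qed.

(** The e_2-component of dv is a e^{2iat} (theta_1 + i theta_2). Along sinh(az) e_0 + cosh(az)
    e^{2iat} e_1, the unit vector orthogonal to v in the span of e_0 and e_1, dv has component a
    (theta_4 + i theta_3); there phi_1 - phi_0 produces l2 and n2. The factor 1 / a^2 leaves the sum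
    of the squares. *)
Lemma metric_nutan p : domM U p -> forall i j,
  metric_of (coframe a h H) p i j
  = / a ^ 2 * fst (herm (nutan p i) (nutan p j) + herm (nutan p i) (nvec p) * herm (nvec p) (nutan p j))%C.
Proof.
  intros Mp i j.
  pose proof (ch_sq a p) as E1. pose proof (cs_sq a p) as E2.
  pose proof (Hf_neq p (proj1 Mp)) as H0. pose proof (hf_neq p (proj1 Mp)) as h0.
  unfold metric_of.
  rewrite (sum4_ext _ (fun k => coframe' a h H k p i * coframe' a h H k p j))
    by (intro; rewrite !(coframe_eq a ha U h H H_pos H_smooth) by exact Mp; reflexivity).
  unfold herm, csum3, eps, Cconj, Cmult, Cplus, RtoC, sum4.
  destruct i, j; cbn -[sh ch sn cs phix phiy lift2]; unfold phix, phiy, lx, ly;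
   field_simplify_eq [E1 E2]; try (ring [E1 E2]); auto.
Qed.

(** * The map to the hyperboloid and its differential *)

Section Map.
Variables (p0 : pt) (r : R) (G : c3 -> i6 -> pt -> R).
Hypothesis G_smooth : forall k c, smooth_on (box p0 r) (G k c).
Hypothesis GP : forall k, parallel r p0 (G k).

Definition vre k p := ch a p * G k r0 p + sh a p * (cs a p * G k r1 p - sn a p * G k m1 p).
Definition vim k p := ch a p * G k m0 p + sh a p * (cs a p * G k m1 p + sn a p * G k r1 p).

Lemma v_lincomb p : (fun k => (vre k p, vim k p) : C) = lincomb (nvec p) (frame_vec G p).
Proof.
  apply functional_extensionality; intro k. unfold lincomb, csum3, nvec, frame_vec, Cplus, Cmult, vre, vim.
  cbn -[sh ch sn cs]. f_equal; ring.
Qed.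

Lemma v_smooth k : smooth_on (box p0 r) (vre k) /\ smooth_on (box p0 r) (vim k).
Proof.
  assert (Ob := open_box p0 r).
  split; intro n; unfold vre, vim, sh, ch, sn, cs; repeat first [ apply G_smooth | ck_step; [exact Ob|..] ].
Qed.

(** By the Leibniz rule and the parallel equations dv is again a combination of the frame. Its
    coefficients do not involve G, which disappears from products by [herm_lincomb]. *)
Lemma v_tangent p i : box p0 r p ->
  (fun k => (partial i (vre k) p, partial i (vim k) p) : C) = lincomb (nutan p i) (frame_vec G p).
Proof.
  intro Bp. apply functional_extensionality; intro k.
  pose proof (fun c => parallel_partial r p0 (G k) i c p (GP k) Bp) as P.
  assert (Pch : has_partial i (ch a) p (match i with i3 => a * sh a p | _ => 0 end)).
  { unfold ch. eapply has_partial_eq; [hp|]. unfold kron, sh. destruct i; cbn -[sinh]; ring. }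
  assert (Psh : has_partial i (sh a) p (match i with i3 => a * ch a p | _ => 0 end)).
  { unfold sh. eapply has_partial_eq; [hp|]. unfold kron, ch. destruct i; cbn -[cosh]; ring. }
  assert (Pcs : has_partial i (cs a) p (match i with i4 => - 2 * a * sn a p | _ => 0 end)).
  { unfold cs. eapply has_partial_eq; [hp|]. unfold kron, sn. destruct i; cbn -[sin]; ring. }
  assert (Psn : has_partial i (sn a) p (match i with i4 => 2 * a * cs a p | _ => 0 end)).
  { unfold sn. eapply has_partial_eq; [hp|]. unfold kron, cs. destruct i; cbn -[cos]; ring. }
  assert (Er := has_partial_plus i _ _ p _ _ (has_partial_mult i _ _ p _ _ Pch (P r0))
    (has_partial_mult i _ _ p _ _ Psh (has_partial_minus i _ _ p _ _ (has_partial_mult i _ _ p _ _ Pcs (P r1)) (has_partial_mult i _ _ p _ _ Psn (P m1))))).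
  assert (Ei := has_partial_plus i _ _ p _ _ (has_partial_mult i _ _ p _ _ Pch (P m0))
    (has_partial_mult i _ _ p _ _ Psh (has_partial_plus i _ _ p _ _ (has_partial_mult i _ _ p _ _ Pcs (P m1)) (has_partial_mult i _ _ p _ _ Psn (P r1))))).
  cbv beta in Er, Ei.
  unfold vre, vim. rewrite (has_partial_partial _ _ _ _ Er), (has_partial_partial _ _ _ _ Ei).
  unfold lincomb, csum3, frame_vec, Cplus, Cmult, sum6.
  destruct i; cbn -[sh ch sn cs phix phiy lift2]; f_equal; ring.
Qed.
End Map.

Lemma locally_isometric_ball : locally_isometric (domM U) (metric_of (coframe a h H)) ball2 (ball_metric a).
Proof.
  intros p Mp.
  destruct (frenet_frame p (proj1 Mp)) as [r [G [Hr [GS [GP GU]]]]].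
  (* The box that carries the frame may leave M, hence the intersection. *)
  set (W := fun q => domM U q /\ box p r q).
  assert (OW : open W) by (apply open_and; [apply open_domM, U_open|apply open_box]).
  apply (ball_map_locally_isometric a ha W OW (vre G) (vim G)).
  - intros k n. apply Ck_sub with (box p r); [intros q [_ Bq]; exact Bq|apply (v_smooth p r G GS k)].
  - intros k n. apply Ck_sub with (box p r); [intros q [_ Bq]; exact Bq|apply (v_smooth p r G GS k)].
  - intros q [_ Bq]. rewrite v_lincomb, herm_lincomb by (apply GU, Bq). apply herm_nvec.
  - split; [exact Mp|apply box_center, Hr].
  - intros q [Mq _]; exact Mq.
  - intros q [Mq _]. apply (metric_of_det (domM U)); [|exact Mq].
    apply (coframe_det a ha U h H h_pos H_pos H_smooth).
  - intros q i j [Mq Bq].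
    rewrite (v_lincomb G q), (v_tangent p r G GP q i Bq), (v_tangent p r G GP q j Bq).
    rewrite !herm_lincomb by (apply GU, Bq). apply metric_nutan, Mq.
Qed.
End Frenet.

Theorem theorem4p7
  (a : R) (ha : a <> 0)
  (U : R * R -> Prop) (U_open : open U)
  (h H : R -> R -> R)
  (h_pos : forall x y, U (x, y) -> 0 < h x y)
  (H_pos : forall x y, U (x, y) -> 0 < H x y)
  (h_smooth : forall x y, U (x, y) -> forall n, ex_diff_n h n x y)
  (H_smooth : forall x y, U (x, y) -> forall n, ex_diff_n H n x y)
  (H_eq : forall x y, U (x, y) ->
     laplacian (fun u v => ln (H u v)) x y
     = 2 * a ^ 2 * h x y ^ 2 + 4 * a ^ 2 * H x y ^ 2)
  (M : pt -> Prop) (M_def : M = domM U)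
  (th : ix -> oneform) (th_def : th = coframe a h H)
  (g : metric) (g_def : g = metric_of th)
  (E : ix -> vfield)
  (E_dual : forall p, M p -> forall i j, eval1 (th i) (E j) p = kron i j)
  (Omega Omegabar : twoform)
  (Omega_def :
     Omega = add_twoform (wedge11 (th i1) (th i2)) (wedge11 (th i3) (th i4)))
  (Omegabar_def :
     Omegabar = add_twoform (wedge11 (th i1) (th i2)) (wedge11 (th i4) (th i3)))
  (J Jbar : endo)
  (J_def : forall p, M p -> forall i j, kahler_form g J p i j = Omega p i j)
  (Jbar_def :
     forall p, M p -> forall i j, kahler_form g Jbar p i j = Omegabar p i j)
  (theta : oneform) (theta_def : theta = fun p i => - alpha a p * th i4 p i) :
  let Lap_ln_h := laplacian (fun u v => ln (h u v)) in
  (forall x y, U (x, y) ->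
     laplacian (fun u v => ln (H u v)) x y
     = 2 * a ^ 2 * h x y ^ 2 + 4 * a ^ 2 * H x y ^ 2)
  /\
  is_Lee_form M g J theta
  /\
  (forall p, M p ->
     let x := p i1 in let y := p i2 in let z := p i3 in let t := p i4 in
     let hp := h x y in
     let Hp := H x y in
     let Lp := Lap_ln_h x y in
     let lambda :=
       - ((4 * a ^ 2 * hp ^ 2 + 2 * a ^ 2 * Hp ^ 2 + Lp)
          / (hp ^ 2 * sinh (a * z) ^ 2)) - 6 * a ^ 2 in
     gprod g (nabla g (E i1) (E i1)) (E i2) p
       = - (a * cosh (a * z) * sin (2 * a * t) * Hp / (sinh (a * z) ^ 2 * hp))
         - partial_derive 0 1 h x y / (sinh (a * z) * hp ^ 2)
     /\
     gprod g (nabla g (E i2) (E i2)) (E i1) p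
       = - (a * cosh (a * z) * cos (2 * a * t) * Hp / (sinh (a * z) ^ 2 * hp))
         - partial_derive 1 0 h x y / (sinh (a * z) * hp ^ 2)
     /\
     (forall i j, Ric g E (E i) (E j) p
        = if ix_eqb i j
          then match i with i1 | i2 => lambda | i3 | i4 => - 6 * a ^ 2 end
          else 0)
     /\
     scal_curv g E p
       = - ((8 * a ^ 2 * hp ^ 2 + 4 * a ^ 2 * Hp ^ 2 + 2 * Lp)
            / (hp ^ 2 * sinh (a * z) ^ 2)) - 24 * a ^ 2
     /\
     conf_scal g E theta p
       = - ((8 * a ^ 2 * hp ^ 2 + 4 * a ^ 2 * Hp ^ 2 + 2 * Lp)
            / (hp ^ 2 * sinh (a * z) ^ 2))
     /\
     (let F := oriented E in
      let w := (4 * a ^ 2 * hp ^ 2 + 2 * a ^ 2 * Hp ^ 2 + Lp)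
               / (hp ^ 2 * sinh (a * z) ^ 2) in
      forall phi psi : twoform, orthonormal_basis_LM F Omega phi psi p ->
      forall i j,
        Weyl_minus g F p (comp2 F Omega p) i j = - (w / 3) * comp2 F Omega p i j
        /\ Weyl_minus g F p (comp2 F phi p) i j = w / 6 * comp2 F phi p i j
        /\ Weyl_minus g F p (comp2 F psi p) i j = w / 6 * comp2 F psi p i j)
     /\
     sec_curv g (E i1) (E i2) p
       = - ((2 * a ^ 2 * Hp ^ 2 + Lp) / (sinh (a * z) ^ 2 * hp ^ 2))
         - 4 * a ^ 2 * coth (a * z) ^ 2
     /\
     sec_curv g (E i3) (E i4) p = - 4 * a ^ 2)
  /\
  (space_form M g Jbar <->
     forall x y, U (x, y) ->
       Lap_ln_h x y = - 4 * a ^ 2 * h x y ^ 2 - 2 * a ^ 2 * H x y ^ 2)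
  /\
  (space_form M g Jbar -> locally_isometric M g ball2 (ball_metric a)).
Proof.
  subst M th g theta Omega Omegabar. intro Lap_ln_h.
  assert (hs : smooth2 U h) by exact h_smooth.
  assert (Hs : smooth2 U H) by exact H_smooth.
  pose proof (space_form_iff a ha U U_open h H h_pos H_pos hs Hs H_eq E E_dual Jbar Jbar_def) as SF.
  split; [exact H_eq|]. split; [|split; [|split; [exact SF|]]].
  - apply (Lee_form a ha U U_open h H h_pos H_pos hs Hs H_eq J J_def).
  - intros p Mp x y z t hp Hp Lp lambda.
    assert (S0 : sinh (a * z) <> 0) by apply (sh_neq_0 a ha U p Mp).
    assert (C0 : cosh (a * z) <> 0) by apply Rgt_not_eq, cosh_pos.
    assert (h0 : hp <> 0) by apply (h_neq_0 U h h_pos p Mp).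
    assert (W : wfun a h H p = (4 * a ^ 2 * hp ^ 2 + 2 * a ^ 2 * Hp ^ 2 + Lp) / (hp ^ 2 * sinh (a * z) ^ 2)) by reflexivity.
    split; [|split; [|split; [|split; [|split; [|split; [|split]]]]]].
    + rewrite (gprod_nabla_E a ha U U_open h H h_pos H_pos hs Hs H_eq E E_dual i1 i1 i2 p Mp).
      change (partial_derive 0 1 h x y) with (ddy h x y).
      unfold conn, sfun, kap, fB, fq0, sn, sh, ch, lift2. cbn -[sinh cosh].
      fold x y z t hp Hp. field. auto.
    + rewrite (gprod_nabla_E a ha U U_open h H h_pos H_pos hs Hs H_eq E E_dual i2 i2 i1 p Mp).
      change (partial_derive 1 0 h x y) with (ddx h x y).
      unfold conn, sfun, kap, fA, fp0, cs, sh, ch, lift2. cbn -[sinh cosh].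
      fold x y z t hp Hp. field. auto.
    + intros i j. rewrite (Ric_E a ha U U_open h H h_pos H_pos hs Hs H_eq E E_dual i j p Mp), W. reflexivity.
    + rewrite (scal_curv_E a ha U U_open h H h_pos H_pos hs Hs H_eq E E_dual p Mp), W. field. auto.
    + rewrite (conf_scal_E a ha U U_open h H h_pos H_pos hs Hs H_eq E E_dual p Mp), W. field. auto.
    + intros F w phi psi HB i j.
      change w with (wfun a h H p).
      apply (Weyl_minus_LM a ha U U_open h H h_pos H_pos hs Hs H_eq E E_dual p phi psi Mp HB i j).
    + rewrite (sec_curv_E a ha U U_open h H h_pos H_pos hs Hs H_eq E E_dual i1 i2 p Mp), W.
      (* The value - 4a^2 - w of [rtab] takes the stated form through coth^2 = 1 + 1 / sinh^2. *)
      unfold rtab, coth. cbn -[sinh cosh].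
      pose proof (cosh_sq (a * z)) as E1. field_simplify_eq [E1]; [ring [E1]|auto].
    + rewrite (sec_curv_E a ha U U_open h H h_pos H_pos hs Hs H_eq E E_dual i3 i4 p Mp).
      unfold rtab. cbn. ring.
  - intro HSF.
    apply (locally_isometric_ball a ha U U_open h H h_pos H_pos hs Hs H_eq (proj1 SF HSF)).
Qed.
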